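(* Let $\varepsilon>0$. If $\xi(x)$ tends to $\infty$ with $x$ sufficiently slowly (i.e. there is a function $\xi_0(x)\to\infty$ such that the following holds for every $\xi$ with $\xi(x)\to\infty$ and $\xi(x)\leq\xi_0(x)$ for all large $x$), then $$P_x\big(M(n,\xi)\leq1+\varepsilon\big)=1+o(1)\qquad(x\to\infty).$$ Moreover, $$P_x\big(M^+(n,\xi)\geq1-\varepsilon\big)=1+o(1),\qquad P_x\big(M^-(n,\xi)\leq-1+\varepsilon\big)=1+o(1)\qquad(x\to\infty).$$
   Context: $\log_k$ denotes the $k$-th iterated logarithm; $\tau$ is the number-of-divisors function; $\omega(n,t)$ is the number of distinct primes $p\mid n$ with $p\leq t$. $P_x$ is the probability measure on the integers $n$ with $1<n\leq x$ assigning to each $n$ a weight proportional to $\tau(n-1)$. For a function $\xi(x)\to\infty$ and $x$ large, put $$\Lambda(n,t):=\frac{\omega(n,t)-\log_2t}{\sqrt{2\log_2t\,\log_4t}}\qquad(t>\xi(x)),$$ $$M(n,\xi):=\sup_{\xi(x)<t\leq x}|\Lambda(n,t)|,\quad M^+(n,\xi):=\sup_{\xi(x)<t\leq x}\Lambda(n,t),\quad M^-(n,\xi):=\inf_{\xi(x)<t\leq x}\Lambda(n,t).$$ *)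

(* Defs.v *)
From HB Require Import structures.
From mathcomp Require Import all_boot all_order all_algebra.
From mathcomp Require Import all_classical all_reals all_analysis.
Set Implicit Arguments.
Unset Strict Implicit.
Unset Printing Implicit Defensive.
Import Order.TTheory GRing.Theory Num.Theory.
Import numFieldNormedType.Exports.
Local Open Scope classical_set_scope.
Local Open Scope ring_scope.

Definition tau (n : nat) : nat := size (divisors n).

Definition omega (R : realType) (n : nat) (t : R) : nat :=
  size [seq p <- primes n | p%:R <= t].

Definition log_iter (R : realType) (k : nat) (t : R) : R := iter k (@ln R) t.

(* For [x < 2] there is no [n] with [1 < n <= x]; both sums are then empty and
   [shifted_div_prob x A = 0 / 0 = 0]. *)
Definition shifted_div_prob (R : realType) (x : R) (A : set nat) : R :=
  (\sum_(2 <= n < (Num.truncn x).+1 | `[< A n >]) (tau n.-1)%:R) /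
  (\sum_(2 <= n < (Num.truncn x).+1) (tau n.-1)%:R).

(* [Lambda n t] has its usual meaning once [log_iter 4 t > 0]; at smaller [t]
   its value depends on the conventions for [ln], [Num.sqrt] and division. *)
Definition Lambda (R : realType) (n : nat) (t : R) : R :=
  ((omega n t)%:R - log_iter 2 t)
    / Num.sqrt (2 * log_iter 2 t * log_iter 4 t).

(* Suprema and infima are taken in [\bar R], where they are always the true
   ones: if [x <= xi x] the range of [t] is empty, and if [xi x] is small the
   values may be unbounded, because [log_iter 4 t] can be arbitrarily close
   to 0. Neither occurs for large [x] when [xi] tends to +oo slowly. *)
Definition Mabs (R : realType) (xi : R -> R) (x : R) (n : nat) : \bar R :=
  ereal_sup [set (`|Lambda n t|)%:E | t in [set t : R | xi x < t <= x]].

Definition Mplus (R : realType) (xi : R -> R) (x : R) (n : nat) : \bar R :=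
  ereal_sup [set (Lambda n t)%:E | t in [set t : R | xi x < t <= x]].

Definition Mminus (R : realType) (xi : R -> R) (x : R) (n : nat) : \bar R :=
  ereal_inf [set (Lambda n t)%:E | t in [set t : R | xi x < t <= x]].

(* Main.v *)
(* The divisors d of n - 1 with d <= sqrt n carry at least half of the weight
   tau (n - 1), so it is enough to fix d and let n = d m + 1 with m uniform.
   A prime p not dividing d then divides n with probability 1/p and a prime
   dividing d never does; for most d the latter primes are negligible, as the
   average of the sum of 1/p over p | d is bounded.

   For fixed d, moments of order (log_2 x)^2 of the indicators of p | n agree
   with those of independent Bernoulli variables for p up to
   y = exp (log x / (log_2 x)^3), hence so do the two laws up to o(1).  Between
   y and x^(1/4) there are few prime factors by Markov's inequality, and at most
   three exceed x^(1/4).  By Mertens' theorem the independent variables have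
   partial sums of mean log_2 t + O(1).

   In the independent model the upper half of the law of the iterated logarithm
   follows from Ville's inequality on geometric blocks of log_2 t.  The lower
   half uses sparse blocks: a change of measure shows that the j-th block
   increment exceeds (1 - eps) times the scale with probability at least c / j,
   and the blocks are independent. *)
Require Import Defs.
From HB Require Import structures.
From mathcomp Require Import all_boot all_order all_algebra.
From mathcomp Require Import all_classical all_reals all_analysis.
From mathcomp Require Import ring lra zify.
Set Implicit Arguments.
Unset Strict Implicit.
Unset Printing Implicit Defensive.
Import Order.TTheory GRing.Theory Num.Theory.
Import numFieldNormedType.Exports.
Local Open Scope classical_set_scope.
Local Open Scope ring_scope.

(** * Exponential inequalities *)

(** The restriction d <= sqrt n enters as 4 X^2 >= x for the length X of the progression. Each
    moment carries an error 1/X, and about (3 y)^K such errors add up; y is so small that y^K is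
    only x^(1 / log_2 x) for K = (log_2 x)^2. The order K is forced from the other side: truncating
    an inclusion-exclusion expansion costs 3^K times a K-th factorial moment, and Rankin's trick
    brings this down to exp(9 log_2 x) / 3^K. The comparison holds for arbitrary events, so the path
    functionals need no regularity. All thresholds are uniform in d once the sum of 1/p over p | d
    is at most a constant W, which depends only on the permitted failure probability. The two halves
    use xi differently. The upper half holds on all of (T0, x] for a fixed T0, hence for every xi
    tending to infinity. The lower half finds its t in a fixed window (T0, T1], which lies in
    (xi(x), x] only if xi grows slowly; xi0 comes from a diagonal argument over the starting
    points. *)

Lemma expR_ge_quad0 (R : realType) (x : R) : 0 <= x ->
  1 + x + x ^+ 2 / 2 <= expR x.
Proof.
move=> x0.
have -> : 1 + x + x ^+ 2 / 2 = series (exp_coeff x) 3.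
  rewrite /series /= !big_nat_recr//= big_nil /exp_coeff /= !factS fact0 /=.
  by rewrite !mulr1n expr0 expr1 !divr1 add0r.
apply: nondecreasing_cvgn_le; last exact: is_cvg_series_exp_coeff.
apply/nondecreasing_seqP => n; rewrite /series /= big_nat_recr//= lerDl.
by rewrite exp_coeff_ge0.
Qed.

Lemma half_pow_fact_le n : (2 ^ n.+1 <= (n.+2)`!)%N.
Proof.
elim: n => // n IH; rewrite expnS factS.
by apply: leq_mul.
Qed.

(** From the cubic term on, the n-th coefficient is at most [2 ^ (1 - n)], so for [x <= 1] the tail
    is at most [x ^+ 3] times a geometric series of sum 1/2; the factor [1 - 2^-1 ^+ k.+1] records
    how much of it is spent. *)
Lemma expR_le_cubic (R : realType) (x : R) : 0 <= x <= 1 ->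
  expR x <= 1 + x + x ^+ 2 / 2 + x ^+ 3 / 2.
Proof.
move=> /andP[x0 x1].
apply: limr_le; first exact: is_cvg_series_exp_coeff.
near=> n.
have -> : n = ((n - 3) + 3)%N by rewrite subnK//; near: n; exists 3%N.
elim: (n - 3)%N => [|k _].
  rewrite /series /= add0n !big_nat_recr//= big_nil /exp_coeff /= !factS fact0 /=.
  rewrite !mulr1n expr0 expr1 !divr1 add0r lerDl.
  by rewrite divr_ge0// exprn_ge0.
suff: series (exp_coeff x) (k.+1 + 3)%N <=
   1 + x + x ^+ 2 / 2 + x ^+ 3 / 2 * (1 - 2^-1 ^+ k.+1).
  move=> /le_trans; apply; rewrite lerD2l ler_piMr ?divr_ge0 ?exprn_ge0//.
elim: k => [|k IH].
  rewrite /series /= !big_nat_recr//= big_nil /exp_coeff /= !factS fact0 /=.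
  rewrite !mulr1n expr0 expr1 !divr1 add0r.
  have := exprn_ge0 3 x0; set y := x ^+ 3; lra.
rewrite /series /= addSn big_nat_recr//=.
rewrite -[X in X + _]/(series (exp_coeff x) (k.+1 + 3)%N).
apply: (le_trans (lerD IH (lexx _))).
rewrite -addrA lerD2l /exp_coeff /=.
have h1 : x ^+ (k.+1 + 3) <= x ^+ 3.
  by rewrite ler_wiXn2l// leq_addl.
have h2 : ((k.+1 + 3)`!%:R)^-1 <= 2^-1 ^+ (k.+3) :> R.
  rewrite exprVn lef_pV2 ?posrE ?exprn_gt0// ?ltr0n ?fact_gt0//.
  rewrite -natrX ler_nat addn3 (leq_trans _ (half_pow_fact_le _))//.
have h3 : x ^+ (k.+1 + 3) / (k.+1 + 3)`!%:R <= x ^+ 3 * 2^-1 ^+ k.+3.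
  by apply: ler_pM => //; rewrite ?exprn_ge0// invr_ge0.
apply: (le_trans (lerD (lexx _) h3)).
rewrite !exprS.
have : 0 <= (2^-1 : R) ^+ k by rewrite exprn_ge0// invr_ge0.
set z := 2^-1 ^+ k; have := exprn_ge0 3 x0; rewrite !exprS expr0.
set y := x * _; move=> y0 z0.
rewrite -subr_ge0.
have -> : y / 2 * (1 - 2^-1 * (2^-1 * z)) -
  (y / 2 * (1 - 2^-1 * z) + y * (2^-1 * (2^-1 * (2^-1 * z)))) = 0 by field.
by [].
Unshelve. all: by end_near. Qed.

(** The error is relative to the quadratic term and symmetric in the sign, because the same bound
    serves deviations above and below the mean. For negative [x] it comes from inverting a lower
    bound at [- x]. *)
Lemma expR_le_quad (R : realType) (x : R) : `|x| <= 1 ->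
  expR x <= 1 + x + x ^+ 2 / 2 * (1 + `|x|).
Proof.
have [x0 x1|x0 x1] := ger0P x.
  apply: (le_trans (expR_le_cubic _)); first by rewrite x0.
  by rewrite le_eqVlt; apply/orP; left; apply/eqP; field.
set a := - x in x1 *; have a0 : 0 < a by rewrite /a; lra.
have -> : x = - a by rewrite opprK.
rewrite expRN; have := expR_ge_quad0 (ltW a0) => h.
have p : 0 < 1 + a + a ^+ 2 / 2 by have := sqr_ge0 a; lra.
apply: (@le_trans _ _ (1 + a + a ^+ 2 / 2)^-1).
  by rewrite lef_pV2 ?posrE ?expR_gt0.
rewrite -[leLHS]mul1r ler_pdivrMr// -subr_ge0.
have -> : (1 + - a + (- a) ^+ 2 / 2 * (1 + a)) * (1 + a + a ^+ 2 / 2) - 1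
  = a ^+ 3 * (1 / 2 + 3 / 4 * a + a ^+ 2 / 4) by field.
by rewrite mulr_ge0 ?exprn_ge0// ?ltW//; have := sqr_ge0 a; lra.
Qed.

Lemma expR_ge_quad (R : realType) (x : R) : `|x| <= 1 ->
  1 + x + x ^+ 2 / 2 * (1 - `|x|) <= expR x.
Proof.
have [x0 x1|x0 x1] := ger0P x.
  apply: (le_trans _ (expR_ge_quad0 x0)); rewrite lerD2l ler_piMr//.
    by rewrite divr_ge0// sqr_ge0.
  lra.
set a := - x in x1 *; have a0 : 0 < a by rewrite /a; lra.
have -> : x = - a by rewrite opprK.
rewrite expRN.
have := @expR_le_cubic _ a; rewrite (ltW a0) x1 => /(_ isT) h.
have p : 0 < 1 + a + a ^+ 2 / 2 + a ^+ 3 / 2.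
  by apply: lt_le_trans h; exact: expR_gt0.
apply: (@le_trans _ _ (1 + a + a ^+ 2 / 2 + a ^+ 3 / 2)^-1); last first.
  by rewrite lef_pV2 ?posrE ?expR_gt0.
rewrite -[leRHS]mul1r ler_pdivlMr// -subr_ge0.
have -> : 1 - (1 + - a + (- a) ^+ 2 / 2 * (1 - a)) *
    (1 + a + a ^+ 2 / 2 + a ^+ 3 / 2)
  = a ^+ 4 * (3 / 4 + a ^+ 2 / 4) by field.
by rewrite mulr_ge0 ?exprn_ge0// ?ltW//; have := sqr_ge0 a; lra.
Qed.

(** Meant for [z = f i * (expR mu - 1)], where [1 + z] is one factor of a moment generating
    function. It comes from inverting [1 - w <= expR (- w)] at [w = z - 2 * z ^+ 2]. *)
Lemma expR_le_1D (R : realType) (z : R) : - 2^-1 <= z <= 2^-1 ->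
  expR (z - 2 * z ^+ 2) <= 1 + z.
Proof.
move=> /andP[z1 z2].
have h := expR_ge1Dx (- (z - 2 * z ^+ 2)).
have p : 0 < 1 - (z - 2 * z ^+ 2) by have := sqr_ge0 z; lra.
rewrite -[z - _]opprK expRN; apply: (@le_trans _ _ (1 - (z - 2 * z ^+ 2))^-1).
  by rewrite lef_pV2 ?posrE ?expR_gt0.
rewrite -[leLHS]mul1r ler_pdivrMr// -subr_ge0.
have -> : (1 + z) * (1 - (z - 2 * z ^+ 2)) - 1 = z ^+ 2 * (1 + 2 * z) by field.
by rewrite mulr_ge0// ?sqr_ge0//; lra.
Qed.

(** * Sums of independent Bernoulli variables *)

(* Expectation of [F] at the random sublist of [l] in which every [i] is kept
   independently with probability [f i]. *)
Fixpoint Emod (R : realType) (T : Type) (f : T -> R) (l : seq T)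
    (F : seq T -> R) : R :=
  if l is i :: l' then
    (1 - f i) * Emod f l' F + f i * Emod f l' (fun s => F (i :: s))
  else F [::].

Definition Pmod (R : realType) (T : Type) (f : T -> R) (l : seq T)
    (P : seq T -> Prop) : R := Emod f l (fun s => `[< P s >]%:R).

Section Emod.
Variables (R : realType) (T : Type) (f : T -> R).
Hypothesis f01 : forall i, 0 <= f i <= 1.
Implicit Types (l s : seq T) (F G : seq T -> R).

Let f0 i : 0 <= f i. Proof. by have /andP[] := f01 i. Qed.
Let f1 i : 0 <= 1 - f i. Proof. by rewrite subr_ge0; have /andP[] := f01 i. Qed.

Lemma Emod_le l F G : (forall s, F s <= G s) -> Emod f l F <= Emod f l G.
Proof.
elim: l F G => [|i l IH] F G FG /=; first exact: FG.
by apply: lerD; apply: ler_wpM2l => //; apply: IH => s; exact: FG.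
Qed.

(** Every sublist inherits [all a], so the comparison is only needed on such sublists; this is how
    sortedness enters Ville's inequality. *)
Lemma Emod_le_all (a : pred T) l F G : all a l ->
  (forall s, all a s -> F s <= G s) -> Emod f l F <= Emod f l G.
Proof.
elim: l F G => [|i l IH] F G /=; first by move=> _ FG; exact: FG.
move=> /andP[ai al] FG.
apply: lerD; apply: ler_wpM2l => //; apply: IH => // s als; apply: FG => //.
by rewrite /= ai.
Qed.

Lemma eq_Emod l F G : (forall s, F s = G s) -> Emod f l F = Emod f l G.
Proof. by move=> FG; congr Emod; apply/funext. Qed.

Lemma Emod_cst l (c : R) : Emod f l (fun=> c) = c.
Proof. by elim: l => //= i l ->; ring. Qed.

Lemma EmodD l F G : Emod f l (fun s => F s + G s) = Emod f l F + Emod f l G.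
Proof. by elim: l F G => //= i l IH F G; rewrite !IH; ring. Qed.

Lemma EmodZ l (c : R) F : Emod f l (fun s => c * F s) = c * Emod f l F.
Proof. by elim: l F => //= i l IH F; rewrite !IH; ring. Qed.

Lemma Emod_sum l (I : Type) (r : seq I) (F : I -> seq T -> R) :
  Emod f l (fun s => \sum_(k <- r) F k s) = \sum_(k <- r) Emod f l (F k).
Proof.
elim: r => [|k r IH].
  by rewrite big_nil -[RHS](Emod_cst l); apply: eq_Emod => s; rewrite big_nil.
rewrite big_cons -IH -EmodD; apply: eq_Emod => s; by rewrite big_cons.
Qed.

Lemma Emod_indep (a : pred T) l F G :
  Emod f l (fun s => F (seq.filter a s) * G (seq.filter (predC a) s)) =
  Emod f (seq.filter a l) F * Emod f (seq.filter (predC a) l) G.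
Proof.
elim: l F G => //= i l IH F G; case: (a i) => /=.
  by rewrite (IH F) (IH (fun s => F (i :: s))); ring.
by rewrite (IH F G) (IH F (fun s => G (i :: s))); ring.
Qed.

Lemma Emod_filter (a : pred T) l F :
  Emod f l (fun s => F (seq.filter a s)) = Emod f (seq.filter a l) F.
Proof.
have := Emod_indep a l F (fun=> 1); rewrite Emod_cst mulr1 => <-.
by apply: eq_Emod => s; rewrite mulr1.
Qed.

Lemma Emod_indep_filter (a : pred T) l F G :
  (forall s, G (seq.filter (predC a) s) = G s) ->
  Emod f l (fun s => F (seq.filter a s) * G s) =
  Emod f (seq.filter a l) F * Emod f l G.
Proof.
move=> hG; rewrite -[in RHS](eq_Emod _ hG) Emod_filter -Emod_indep.
by apply: eq_Emod => s; rewrite hG.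
Qed.

Lemma Emod_expR_size l (mu : R) :
  Emod f l (fun s => expR (mu * (size s)%:R)) =
  \prod_(i <- l) (1 + f i * (expR mu - 1)).
Proof.
elim: l => [|i l IH] /=; first by rewrite mulr0 expR0 big_nil.
rewrite big_cons -IH.
rewrite [X in _ + _ * X = _](_ : _ = expR mu *
  Emod f l (fun s => expR (mu * (size s)%:R))); first by ring.
rewrite -EmodZ; apply: eq_Emod => s.
by rewrite -expRD -natr1 mulrDr mulr1 addrC.
Qed.

Lemma Pmod_ge0 l P : 0 <= Pmod f l P.
Proof. by rewrite -(Emod_cst l 0); apply: Emod_le => s; rewrite ler0n. Qed.

Lemma Pmod_le l (P Q : seq T -> Prop) :
  (forall s, P s -> Q s) -> Pmod f l P <= Pmod f l Q.
Proof.
move=> PQ; apply: Emod_le => s.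
case: (asboolP (P s)) => [/PQ Qs|_]; first by rewrite asboolT.
by rewrite ler0n.
Qed.

Lemma Pmod_le1 l P : Pmod f l P <= 1.
Proof.
by rewrite -[leRHS](Emod_cst l); apply: Emod_le => s; case: asboolP.
Qed.

Lemma PmodC l P : Pmod f l (fun s => ~ P s) = 1 - Pmod f l P.
Proof.
apply/eqP; rewrite -subr_eq0 opprB addrA -EmodD subr_eq0.
apply/eqP; rewrite -[RHS](Emod_cst l); apply: eq_Emod => s.
by rewrite asbool_neg; case: asboolP => _ /=; rewrite ?addr0 ?add0r.
Qed.

Lemma Pmod_exists l (I : eqType) (r : seq I) (P : I -> seq T -> Prop) :
  Pmod f l (fun s => exists2 k, k \in r & P k s) <=
  \sum_(k <- r) Pmod f l (P k).
Proof.
rewrite -Emod_sum; apply: Emod_le => s; case: asboolP => [[k kr Pk]|_].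
  rewrite (big_rem k)//= asboolT//= lerDl.
  by rewrite sumr_ge0// => i _; rewrite ler0n.
by rewrite sumr_ge0// => i _; rewrite ler0n.
Qed.

Lemma Pmod_or l (P Q : seq T -> Prop) :
  Pmod f l (fun s => P s \/ Q s) <= Pmod f l P + Pmod f l Q.
Proof.
rewrite -EmodD; apply: Emod_le => s.
by rewrite asbool_or -natrD ler_nat; case: asbool; case: asbool.
Qed.

Lemma Pmod_and_indep (a : pred T) l (P Q : seq T -> Prop) :
  (forall s, Q (seq.filter (predC a) s) <-> Q s) ->
  Pmod f l (fun s => P (seq.filter a s) /\ Q s) =
  Pmod f (seq.filter a l) P * Pmod f l Q.
Proof.
move=> hQ; rewrite -Emod_indep_filter => [|s]; last first.
  by congr ((_ : bool)%:R); apply/asbool_equiv_eq/hQ.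
by apply: eq_Emod => s; rewrite asbool_and -mulnb natrM.
Qed.

End Emod.

Section Ville.
Variables (R : realType) (T : Type) (f : T -> R) (key : T -> R).
Hypothesis f01 : forall i, 0 <= f i <= 1.

Definition cnt (s : seq T) (t : R) : nat := count (fun i => key i <= t) s.
Definition mass (l : seq T) (t : R) : R := \sum_(i <- l | key i <= t) f i.

(* Ville's inequality for the supermartingale
   [expR (lam * cnt s t - (expR lam - 1) * mass l t)], by conditioning on the
   first element of [l]. *)
Lemma ville l (lam b : R) : pairwise (fun a b => key a <= key b) l ->
  Pmod f l (fun s => exists t,
    b <= lam * (cnt s t)%:R - (expR lam - 1) * mass l t) <= expR (- b).
Proof.
elim: l b => [|i l IH] b sl.
  rewrite /Pmod /=; case: asboolP => [[t]|_]; last exact: expR_ge0.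
  rewrite /cnt /mass big_nil /= !mulr0 subr0 => b0.
  by rewrite -expR0 ler_expR oppr_ge0.
(* With [b > 0] a witness [t] below the first key is impossible, since count and mass both vanish
   there. *)
have [b0|b0] := leP b 0.
  apply: (le_trans (Pmod_le1 f01 _ _)).
  by rewrite -expR0 ler_expR oppr_ge0.
have /= /andP[il sl'] := sl.
have mass_cons t : mass (i :: l) t = (if key i <= t then f i else 0) + mass l t.
  by rewrite /mass big_cons; case: ifP; rewrite ?add0r.
have /andP[fi0 fi1] := f01 i.
have massE t : t < key i -> mass l t = 0.
  move=> ti; rewrite /mass; elim: l il {IH sl sl' mass_cons} => [|j l IH] /=.
    by rewrite big_nil.
  move=> /andP[ij il]; rewrite big_cons IH// ifF//.
  by apply/negbTE; rewrite -ltNge (lt_le_trans ti).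
set g := f i * (expR lam - 1).
(* [e] tells whether the first element is kept. Either way the rest of the list faces the same event
   with threshold [b + g - lam * e], and averaging over [e] multiplies the bound by
   [expR (- g) * (1 + g) <= 1]. *)
have step (e : bool) : Emod f l (fun s => `[< exists t, b <=
      lam * ((e && (key i <= t)) + cnt s t)%:R
        - (expR lam - 1) * mass (i :: l) t >]%:R) <=
    expR (- (b + g - lam * e%:R)).
  apply: le_trans (IH _ sl').
  apply: (Emod_le_all f01 il) => s si.
  case: asboolP => [[t]|_]; last by rewrite ler0n.
  have cntE : t < key i -> cnt s t = 0%N.
    move=> ti; apply/eqP; rewrite -leqn0 leqNgt -has_count -all_predC.
    by apply: sub_all si => j ij; rewrite /= -ltNge (lt_le_trans ti).
  rewrite mass_cons; have [it|ti] := leP (key i) t; last first.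
    by rewrite andbF massE// cntE// !addr0 !mulr0 subr0 leNgt b0.
  move=> h; rewrite asboolT//; exists t; move: h.
  by rewrite andbT natrD /g; lra.
rewrite /Pmod /=.
have := step false; rewrite !mulr0 subr0 => s0.
have := step true; rewrite mulr1 => s1.
apply: (@le_trans _ _ ((1 - f i) * expR (- (b + g)) +
                       f i * expR (- (b + g - lam)))).
  by apply: lerD; apply: ler_wpM2l => //; rewrite subr_ge0.
have -> : - (b + g - lam) = - (b + g) + lam by ring.
rewrite (expRD _ lam) opprD expRD.
have -> : (1 - f i) * (expR (- b) * expR (- g)) +
  f i * (expR (- b) * expR (- g) * expR lam) =
  expR (- b) * (expR (- g) * (1 + g)) by rewrite /g; ring.
rewrite ler_piMr ?expR_ge0// -ler_pdivlMl ?expR_gt0// mulr1 expRN invrK.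
exact: expR_ge1Dx.
Qed.

End Ville.

(** * The upper half of the law of the iterated logarithm *)

(* [lilsc (ln (ln t))] is the denominator of [Lambda n t]. *)
Definition lilsc (R : realType) (u : R) : R := Num.sqrt (2 * u * ln (ln u)).

Section LilBlock.
Variable R : realType.
Implicit Types (d B U u l k w L eps eta : R).

(* Deterministic core of the first half: on the block [U <= u <= (1 + d) * U] of
   [u = log_2 t], the two linear bounds given by [ville] at [k] and [- k], with
   the optimal [k = sqrt (2 l / U)], force the iterated logarithm bound. *)
Lemma lil_block d B U u l k w L :
  0 < d <= 1 -> 1 <= U -> U <= u <= (1 + d) * U -> 1 <= l <= ln (ln u) ->
  k = Num.sqrt (2 * l / U) -> k <= d -> B <= d * Num.sqrt U ->
  `|L - u| <= B ->
  k * w - (expR k - 1) * L < (1 + d) * l ->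
  - k * w - (expR (- k) - 1) * L < (1 + d) * l ->
  `|w - u| <= (1 + 4 * d) * lilsc u.
Proof.
move=> /andP[d0 d1] U1 /andP[Uu uU] /andP[l1 lu] kE kd BU.
rewrite ler_norml => /andP[L1 L2] h1 h2.
have U0 : 0 < U by lra.
have sU1 : 1 <= Num.sqrt U by rewrite -[leLHS]sqrtr1 ler_wsqrtr.
have sUU : Num.sqrt U ^+ 2 = U by rewrite sqr_sqrtr// ltW.
have k0 : 0 < k.
  by rewrite kE sqrtr_gt0 divr_gt0// mulr_gt0//; lra.
have kk : k ^+ 2 * U = 2 * l.
  rewrite kE sqr_sqrtr ?divfK ?gt_eqF//.
  by rewrite divr_ge0// ?mulr_ge0//; lra.
have sU_U : Num.sqrt U <= U.
  by rewrite -{2}sUU expr2 ler_peMr//; lra.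
have BdU : B <= d * U by apply: (le_trans BU); rewrite ler_wpM2l// ltW.
have LU : L <= (1 + 2 * d) * U by lra.
have dU : d * U <= U by rewrite ler_piMl// ltW.
have L0 : 0 <= L by lra.
have k1 : k <= 1 by lra.
have kn : `|k| = k by rewrite gtr0_norm.
have e1 : expR k - 1 <= k + k ^+ 2 / 2 * (1 + k).
  by have := @expR_le_quad _ k; rewrite kn => /(_ k1); lra.
have e2 : expR (- k) - 1 <= - k + k ^+ 2 / 2 * (1 + k).
  by have := @expR_le_quad _ (- k); rewrite normrN kn => /(_ k1); rewrite sqrrN; lra.
(* [r] is [Num.sqrt (2 * l * U)], a lower bound for the scale at [u]. Dividing the two linear bounds
   by [k] leaves [(1 + d) ^+ 2 * r], and [B] adds at most [d * r]. *)
set r := k * U.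
have rE : r ^+ 2 = 2 * l * U by rewrite /r exprMn -kk; ring.
have r0 : 0 < r by rewrite mulr_gt0.
have rsc : r <= lilsc u.
  rewrite -(ger0_norm (ltW r0)) -sqrtr_sqr ler_wsqrtr// rE.
  rewrite -!mulrA ler_wpM2l//.
  by rewrite mulrC ler_pM//; lra.
have Br : B <= d * r.
  apply: (le_trans BU); rewrite ler_wpM2l ?(ltW d0)//.
  rewrite -(@ler_pXn2r _ 2) ?nnegrE ?sqrtr_ge0 ?(ltW r0)//.
  by rewrite sUU rE ler_peMl//; lra.
have q1 : (expR k - 1) * L <= (k + k ^+ 2 / 2 * (1 + k)) * L by rewrite ler_wpM2r.
have q2 : (expR (- k) - 1) * L <= (- k + k ^+ 2 / 2 * (1 + k)) * L by rewrite ler_wpM2r.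
have q3 : k ^+ 2 / 2 * (1 + k) * L <= k * (r * ((1 + d) * (1 + 2 * d) / 2)).
  have -> : k * (r * ((1 + d) * (1 + 2 * d) / 2)) =
    k ^+ 2 / 2 * (1 + d) * ((1 + 2 * d) * U) by rewrite /r; field.
  rewrite ler_pM//.
    by rewrite mulr_ge0 ?divr_ge0 ?sqr_ge0//; lra.
  by rewrite ler_wpM2l ?divr_ge0 ?sqr_ge0//; lra.
have q4 : (1 + d) * l = k * (r * ((1 + d) / 2)).
  have -> : l = k ^+ 2 * U / 2 by rewrite kk; field.
  by rewrite /r; field.
have a1 : k * (w - L) < k * (r * ((1 + d) ^+ 2)).
  have -> : k * (r * (1 + d) ^+ 2) =
    k * (r * ((1 + d) * (1 + 2 * d) / 2)) + k * (r * ((1 + d) / 2)) by field.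
  lra.
have a2 : k * (L - w) < k * (r * ((1 + d) ^+ 2)).
  have -> : k * (r * (1 + d) ^+ 2) =
    k * (r * ((1 + d) * (1 + 2 * d) / 2)) + k * (r * ((1 + d) / 2)) by field.
  lra.
move: a1 a2; rewrite !ltr_pM2l// => a1 a2.
have fin : r * (1 + d) ^+ 2 + d * r <= (1 + 4 * d) * lilsc u.
  apply: (@le_trans _ _ ((1 + 4 * d) * r)); last by rewrite ler_wpM2l//; lra.
  have -> : r * (1 + d) ^+ 2 + d * r = (1 + 3 * d + d ^+ 2) * r by ring.
  rewrite ler_wpM2r ?(ltW r0)//.
  have : d ^+ 2 <= d by rewrite expr2 ler_piMl// ltW.
  lra.
rewrite ler_norml; apply/andP; split; lra.
Qed.

(** A discrete antiderivative that makes tail sums telescope: it follows from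
    [ln ((n + 1) / n) >= 1 / (n + 1)] and [expR y >= 1 + y]. *)
Lemma powRN_telescope d (n : nat) : 0 < d -> (0 < n)%N ->
  d * (n.+1%:R : R) `^ (- (1 + d)) <= n%:R `^ (- d) - n.+1%:R `^ (- d).
Proof.
move=> d0 n0.
have n0' : 0 < n%:R :> R by rewrite ltr0n.
have n1' : 0 < n.+1%:R :> R by rewrite ltr0n.
have -> : (n%:R : R) `^ (- d) = n.+1%:R `^ (- d) * expR (d * ln (n.+1%:R / n%:R)).
  rewrite /powR !gt_eqF// -expRD; congr expR.
  by rewrite ln_div ?posrE//; ring.
have -> : (n.+1%:R : R) `^ (- (1 + d)) = n.+1%:R `^ (- d) / n.+1%:R.
  rewrite opprD addrC powRD; last by rewrite (gt_eqF n1') implybT.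
  by rewrite powR_inv1// ltW.
rewrite -[X in _ - X]mulr1 -mulrBr mulrCA ler_wpM2l ?powR_ge0//.
have h : (n.+1%:R)^-1 <= ln (n.+1%:R / n%:R) :> R.
  have -> : (n.+1%:R / n%:R : R) = (n%:R / n.+1%:R)^-1 by rewrite invf_div.
  rewrite lnV ?posrE ?divr_gt0// lerNr.
  have -> : n%:R / n.+1%:R = 1 + (- n.+1%:R^-1) :> R.
    by rewrite -[n.+1%:R in RHS]natr1; field; rewrite natr1 gt_eqF.
  apply: le_ln1Dx; rewrite ltrN2 invf_lt1// ltr1n.
  by rewrite ltnS.
have := expR_ge1Dx (d * ln (n.+1%:R / n%:R : R)).
have : d * n.+1%:R^-1 <= d * ln (n.+1%:R / n%:R : R) by rewrite ler_wpM2l// ltW.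
move=> q1 q2; rewrite lerBrDr addrC; apply: le_trans q2.
by rewrite lerD2l.
Qed.

Lemma powRN_tail d (J J' : nat) : 0 < d -> (0 < J)%N ->
  \sum_(J.+1 <= j < J') (j%:R : R) `^ (- (1 + d)) <= d^-1 * J%:R `^ (- d).
Proof.
move=> d0 J0.
have [JJ|JJ] := leqP J.+1 J'; last first.
  by rewrite big_geq ?mulr_ge0 ?invr_ge0 ?powR_ge0 ?ltW// ltnW.
suff : \sum_(J.+1 <= j < J') (j%:R : R) `^ (- (1 + d)) <=
    d^-1 * (J%:R `^ (- d) - J'.-1%:R `^ (- d)).
  move=> /le_trans; apply; rewrite ler_wpM2l ?invr_ge0 ?(ltW d0)// lerBlDr lerDl.
  by rewrite powR_ge0.
rewrite -(subnKC JJ); elim: (J' - J.+1)%N => [|k IH].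
  by rewrite addn0 big_geq// subrr mulr0.
rewrite addnS big_nat_recr ?leq_addr//=.
apply: (le_trans (lerD IH (lexx _))); rewrite addSn /=.
have := @powRN_telescope d (J + k) d0 _.
rewrite addn_gt0 J0 /= => /(_ isT) h.
rewrite -ler_pdivlMl// in h.
rewrite -lerBrDl; apply: (le_trans h).
rewrite -mulrBr ler_wpM2l ?invr_ge0 ?(ltW d0)//.
set x := _ `^ _; set y := _ `^ _; set z := _ `^ _; lra.
Qed.

Lemma powRN_small d eta : 0 < d -> 0 < eta ->
  exists2 J : nat, (0 < J)%N & (J%:R : R) `^ (- d) <= eta.
Proof.
move=> d0 e0; pose x := eta `^ (- d^-1).
exists (Num.truncn x).+1 => //.
have x0 : 0 < x by rewrite powR_gt0.
have -> : eta = x `^ (- d).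
  by rewrite /x -powRrM mulrNN mulVf ?gt_eqF// powRr1// ltW.
rewrite !powRN lef_pV2 ?posrE ?powR_gt0 ?ltr0n//.
rewrite ge0_ler_powR ?nnegrE ?ltW// ?ltr0n//.
exact: truncnS_gt.
Qed.

(** [s] is log_3 at the start of a block, so [expR s] and [ln s] play the roles of [U] and [l] in
    [lil_block]. As [expR s >= s ^+ 2 / 2] and [ln s <= s], the optimal exponent is at most
    [Num.sqrt (4 / s)]. *)
Lemma lil_scale_small d B s : 0 < d <= 1 ->
  expR 1 <= s -> 4 / d ^+ 2 <= s -> 2 * B / d <= s ->
  [/\ 1 <= ln s, Num.sqrt (2 * ln s / expR s) <= d &
      B <= d * Num.sqrt (expR s)].
Proof.
move=> /andP[d0 d1] s1 s2 s3.
have s0 : 0 < s by apply: lt_le_trans s1; exact: expR_gt0.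
split.
- by rewrite -(@expRK R 1) ler_ln ?posrE ?expR_gt0.
- rewrite -(ger0_norm (ltW d0)) -sqrtr_sqr ler_wsqrtr//.
  rewrite ler_pdivrMr ?expR_gt0//.
  have h := expR_ge_quad0 (ltW s0).
  have l := ln_sublinear s0.
  have : 4 <= d ^+ 2 * s by rewrite mulrC -ler_pdivrMr// exprn_gt0.
  move=> h4.
  apply: (@le_trans _ _ (d ^+ 2 * (s ^+ 2 / 2))); last first.
    by rewrite ler_wpM2l ?sqr_ge0//; lra.
  have -> : d ^+ 2 * (s ^+ 2 / 2) = (d ^+ 2 * s) * s / 2 by field.
  have : 4 * s <= (d ^+ 2 * s) * s by rewrite ler_wpM2r// ltW.
  lra.
- have -> : Num.sqrt (expR s) = expR (s / 2).
    rewrite -[RHS]ger0_norm ?expR_ge0// -sqrtr_sqr -expRM_natl.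
    by congr (Num.sqrt (expR _)); field.
  have := expR_ge1Dx (s / 2) => h.
  have : B <= d * (s / 2).
    by move: s3; rewrite ler_pdivrMr// => s3; lra.
  move=> /le_trans; apply; rewrite ler_wpM2l ?ltW//; lra.
Qed.

End LilBlock.

Section LilUpper.
Variable R : realType.

(** Ville's inequality bounds the failure on block [j] by [2 / (a * j) ^ (1 + d)], which is
    summable. [T0] depends on [eps], [eta] and [B] but not on the weights, which vary with the
    modulus and with [x]. *)
Lemma lil_upper_model (eps eta B : R) : 0 < eps -> 0 < eta ->
  exists T0 : R, forall (T : Type) (f key : T -> R) (l : seq T) (T1 Y : R),
    T0 <= T1 ->
    (forall i, 0 <= f i <= 1) ->
    pairwise (fun a b => key a <= key b) l ->
    (forall t, T1 < t <= Y -> `|mass f key l t - ln (ln t)| <= B) ->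
    Pmod f l (fun s => exists2 t, T1 < t <= Y &
      (1 + eps) * lilsc (ln (ln t)) < `|(cnt key s t)%:R - ln (ln t)|) <= eta.
Proof.
move=> eps0 eta0.
pose d := Num.min (eps / 4) 1.
have d0 : 0 < d by rewrite lt_min ltr01 andbT divr_gt0.
have d1 : d <= 1 by rewrite ge_min lexx orbT.
have d4 : 4 * d <= eps.
  have : d <= eps / 4 by rewrite ge_min lexx.
  lra.
have d01 : 0 < d <= 1 by rewrite d0 d1.
(* Block [j] is [a * j <= log_3 t < a * (j + 1)], on which log_2 t varies by a factor [1 + d]. *)
pose a := ln (1 + d).
have a0 : 0 < a by rewrite ln_gt0//; lra.
have ea : expR a = 1 + d by rewrite lnK// posrE; lra.
pose S0 := Num.max (expR 1) (Num.max (4 / d ^+ 2) (2 * B / d)).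
(* [C * J ^ (- d)] will bound the sum of the two-sided Ville bounds over all blocks after [J]. *)
pose C := 2 * a `^ (- (1 + d)) * d^-1.
have C0 : 0 < C by rewrite !mulr_gt0 ?powR_gt0 ?invr_gt0.
have [J0 J00 HJ0] := powRN_small d0 (divr_gt0 eta0 C0).
pose J := maxn J0 (Num.truncn (S0 / a)).+1.
have J1 : (0 < J)%N by rewrite leq_max J00.
have JS s : J%:R * a <= s -> S0 <= s.
  move=> /(le_trans _); apply; rewrite -ler_pdivrMr// ltW//.
  apply: (lt_le_trans (truncnS_gt _)); rewrite ler_nat leq_max leqnn orbT//.
exists (expR (expR (expR (a * J.+1%:R)))) => T f key l T1 Y T01 f01 sl hB.
pose k j : R := Num.sqrt (2 * ln (a * j%:R) / expR (a * j%:R)).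
pose J' := (Num.truncn (ln (ln (ln Y)) / a)).+1.
pose bad (j : nat) (s : seq T) :=
  (exists t, (1 + d) * ln (a * j%:R) <=
     k j * (cnt key s t)%:R - (expR (k j) - 1) * mass f key l t) \/
  (exists t, (1 + d) * ln (a * j%:R) <=
     - k j * (cnt key s t)%:R - (expR (- k j) - 1) * mass f key l t).
apply: (@le_trans _ _ (Pmod f l (fun s =>
    exists2 j, j \in index_iota J.+1 J' & bad j s))).
  apply: Pmod_le => // s [t /andP[T1t tY] ht].
  have Jt := le_lt_trans T01 T1t.
  have lt1 : expR (expR (a * J.+1%:R)) < ln t.
    by rewrite -[ltLHS](@expRK R) ltr_ln ?posrE ?expR_gt0// (lt_trans _ Jt)// expR_gt0.
  have lt2 : expR (a * J.+1%:R) < ln (ln t).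
    by rewrite -[ltLHS](@expRK R) ltr_ln ?posrE ?expR_gt0// (lt_trans _ lt1)// expR_gt0.
  have lt3 : a * J.+1%:R < ln (ln (ln t)).
    by rewrite -[ltLHS](@expRK R) ltr_ln ?posrE ?expR_gt0// (lt_trans _ lt2)// expR_gt0.
  have t0 : 0 < t by rewrite (lt_trans _ Jt)// expR_gt0.
  have lt0 : 0 < ln t by rewrite (lt_trans _ lt1)// expR_gt0.
  set u := ln (ln t) in ht lt2 lt3 *.
  have u0 : 0 < u by rewrite (lt_trans _ lt2)// expR_gt0.
  have lu0 : 0 < ln u by rewrite (lt_trans _ lt3)// mulr_gt0.
  have lY : ln u <= ln (ln (ln Y)).
    have Y0 : 0 < Y by exact: lt_le_trans tY.
    have q1 : ln t <= ln Y by rewrite ler_ln ?posrE.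
    have q0 : 0 < ln Y by exact: lt_le_trans q1.
    have q2 : u <= ln (ln Y) by rewrite ler_ln ?posrE.
    by rewrite ler_ln ?posrE// (lt_le_trans u0).
  pose j := Num.truncn (ln u / a).
  have j1 : j%:R <= ln u / a by rewrite truncn_le// divr_ge0// ltW.
  have j2 : ln u / a < j.+1%:R by exact: truncnS_gt.
  rewrite ler_pdivlMr// mulrC in j1; rewrite ltr_pdivrMr// mulrC in j2.
  have Jj : (J.+1 <= j)%N.
    by rewrite /j truncn_ge_nat ?divr_ge0 ?(ltW a0) ?(ltW lu0)// ler_pdivlMr// mulrC ltW.
  exists j.
    by rewrite mem_index_iota Jj /= ltnS le_truncn// ler_pM2r ?invr_gt0.
  rewrite /bad.
  apply: contrapT => /not_orP[/forallNP/(_ t)/negP b1 /forallNP/(_ t)/negP b2].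
  move: b1 b2; rewrite -!ltNge => b1 b2.
  have : S0 <= a * j%:R.
    by apply: JS; rewrite mulrC ler_pM2l// ler_nat ltnW.
  rewrite !ge_max => /andP[s1 /andP[s2 s3]].
  have [c1 c2 c3] := lil_scale_small d01 s1 s2 s3.
  have sj0 : 0 < a * j%:R by apply: lt_le_trans s1; exact: expR_gt0.
  have := @lil_block R d B (expR (a * j%:R)) u (ln (a * j%:R)) (k j)
    (cnt key s t)%:R (mass f key l t) d01 _ _ _ erefl c2 c3 _ b1 b2.
  have -> : 1 <= expR (a * j%:R).
    by apply: le_trans (expR_ge1Dx _); rewrite lerDl ltW.
  have -> : expR (a * j%:R) <= u <= (1 + d) * expR (a * j%:R).
    rewrite -ea -expRD -[u]lnK ?posrE// !ler_expR j1 /=.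
    by move: j2; rewrite -natr1 => j2; clear -j2; lra.
  have -> : 1 <= ln (a * j%:R) <= ln (ln u) by rewrite c1 ler_ln ?posrE.
  have -> : `|mass f key l t - u| <= B by apply: hB; rewrite T1t tY.
  move=> /(_ isT isT isT isT); apply/negP; rewrite -ltNge.
  apply: le_lt_trans ht; rewrite ler_wpM2r ?sqrtr_ge0//; clear -d4; lra.
apply: (le_trans (Pmod_exists f01 _ _ _)).
apply: (@le_trans _ _ (\sum_(J.+1 <= j < J') 2 * a `^ (- (1 + d)) * j%:R `^ (- (1 + d)))).
  rewrite big_nat [leRHS]big_nat; apply: ler_sum => j /andP[Jj _].
  have j0 : 0 < j%:R :> R by rewrite ltr0n (leq_ltn_trans _ Jj).
  apply: (le_trans (Pmod_or f01 _ _ _)).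
  have -> : 2 * a `^ (- (1 + d)) * j%:R `^ (- (1 + d)) =
      expR (- ((1 + d) * ln (a * j%:R))) + expR (- ((1 + d) * ln (a * j%:R))).
    have -> : expR (- ((1 + d) * ln (a * j%:R))) = (a * j%:R) `^ (- (1 + d)).
      by rewrite /powR gt_eqF ?mulr_gt0// mulNr.
    by rewrite powRM ?ltW//; ring.
  by apply: lerD; apply: ville.
rewrite -mulr_sumr.
apply: (@le_trans _ _ (2 * a `^ (- (1 + d)) * (d^-1 * J%:R `^ (- d)))).
  by rewrite ler_wpM2l ?mulr_ge0 ?powR_ge0// powRN_tail.
rewrite mulrA -ler_pdivlMl// mulrC; apply: le_trans HJ0.
rewrite !powRN lef_pV2 ?posrE ?powR_gt0 ?ltr0n//.
by rewrite ge0_ler_powR ?nnegrE ?ler0n ?(ltW d0)// ler_nat leq_max leqnn.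
Qed.

End LilUpper.

(** * Tilting and the lower half *)

Section Tilt.
Variables (R : realType) (T : Type) (f : T -> R).
Hypothesis f01 : forall i, 0 <= f i <= 1.

Let f0 i : 0 <= f i. Proof. by have /andP[] := f01 i. Qed.

(* Cramer's change of measure, with only the moment generating function at
   [(1 - d) lam], [lam] and [(1 + d) lam]: under the tilt by [lam] almost all
   the mass sits where [S] is within [d lam V] of [lam V]. *)
Lemma tilt_lower (l : seq T) (S : seq T -> R) (lam V d tau : R) :
  0 < d <= 1 -> 0 < lam -> 0 <= V -> 0 <= tau <= d ^+ 2 / 16 ->
  8 <= d ^+ 2 * (lam ^+ 2 * V / 2) ->
  expR ((1 - tau) * (lam ^+ 2 * V / 2)) <= Emod f l (fun s => expR (lam * S s)) ->
  Emod f l (fun s => expR ((1 + d) * lam * S s)) <=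
    expR ((1 + d) ^+ 2 * (1 + tau) * (lam ^+ 2 * V / 2)) ->
  Emod f l (fun s => expR ((1 - d) * lam * S s)) <=
    expR ((1 - d) ^+ 2 * (1 + tau) * (lam ^+ 2 * V / 2)) ->
  2^-1 * expR (- ((1 + 3 * d) * (lam ^+ 2 * V / 2))) <=
    Pmod f l (fun s => (1 - d) * lam * V <= S s).
Proof.
move=> /andP[d0 d1] lam0 V0 /andP[t0 td]; set Q := lam ^+ 2 * V / 2 => dQ h1 h2 h3.
have lV : lam * (lam * V) = 2 * Q by rewrite /Q; field.
have Q0 : 0 <= Q by rewrite divr_ge0// mulr_ge0// sqr_ge0.
set P := Pmod _ _ _.
have d2 : d ^+ 2 <= d by rewrite expr2 ler_piMl// ltW.
(* Split by the position of [S]: the middle range costs the maximum of the exponential times [P],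
   and each outer range is bounded by a Chernoff factor with exponent [(1 + d) * lam] or
   [(1 - d) * lam]. *)
have key : Emod f l (fun s => expR (lam * S s)) <=
    expR (2 * (1 + d) * Q) * P +
    (expR (- (2 * d * (1 + d) * Q)) * Emod f l (fun s => expR ((1 + d) * lam * S s)) +
     expR (2 * d * (1 - d) * Q) * Emod f l (fun s => expR ((1 - d) * lam * S s))).
  rewrite -!EmodZ -!EmodD; apply: Emod_le => // s.
  have e1 := expR_ge0 (2 * (1 + d) * Q).
  have e2 : 0 <= expR (- (2 * d * (1 + d) * Q)) * expR ((1 + d) * lam * S s).
    by rewrite mulr_ge0// expR_ge0.
  have e3 : 0 <= expR (2 * d * (1 - d) * Q) * expR ((1 - d) * lam * S s).
    by rewrite mulr_ge0// expR_ge0.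
  case: asboolP => [hS|/negP]; last rewrite -ltNge => hS.
    rewrite mulr1; have [hS'|hS'] := leP (S s) ((1 + d) * lam * V).
      suff : expR (lam * S s) <= expR (2 * (1 + d) * Q) by lra.
      rewrite ler_expR; have -> : 2 * (1 + d) * Q = lam * ((1 + d) * lam * V).
        by rewrite -mulrA mulrCA -lV; ring.
      by rewrite ler_wpM2l// ltW.
    suff : expR (lam * S s) <=
      expR (- (2 * d * (1 + d) * Q)) * expR ((1 + d) * lam * S s) by lra.
    rewrite -expRD ler_expR -subr_ge0.
    have -> : - (2 * d * (1 + d) * Q) + (1 + d) * lam * S s - lam * S s
       = d * lam * (S s - (1 + d) * lam * V).
      have -> : 2 * d * (1 + d) * Q = d * (1 + d) * (2 * Q) by ring.
      by rewrite -lV; ring.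
    by rewrite !mulr_ge0 ?(ltW d0) ?(ltW lam0)// subr_ge0 ltW.
  rewrite mulr0 add0r.
  suff : expR (lam * S s) <=
      expR (2 * d * (1 - d) * Q) * expR ((1 - d) * lam * S s) by lra.
  rewrite -expRD ler_expR -subr_ge0.
  have -> : 2 * d * (1 - d) * Q + (1 - d) * lam * S s - lam * S s
       = d * lam * ((1 - d) * lam * V - S s).
    have -> : 2 * d * (1 - d) * Q = d * (1 - d) * (2 * Q) by ring.
    by rewrite -lV; ring.
  by rewrite !mulr_ge0 ?(ltW d0) ?(ltW lam0)// subr_ge0 ltW.
set M := expR ((1 - tau) * Q) in h1 *.
have tQ : tau * Q <= d ^+ 2 * Q / 16 by rewrite mulrAC ler_wpM2r.
(* The outer exponents are [(1 - d ^+ 2) * Q] plus at most [4 * tau * Q <= d ^+ 2 * Q / 4], whence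
   3/4. As [d ^+ 2 * Q >= 8], each outer term is at most a quarter of [M], and half of [M] is left
   for the middle. *)
have small x : x <= (1 - d ^+ 2 * (3 / 4)) * Q -> expR x <= M / 4.
  move=> hx; apply: (@le_trans _ _ (expR ((1 - tau) * Q - 4))).
    by rewrite ler_expR; apply: (le_trans hx); lra.
  rewrite expRD -/M ler_wpM2l ?expR_ge0// expRN lef_pV2 ?posrE ?expR_gt0//.
  by have := expR_ge1Dx (4 : R); lra.
have dd : d ^+ 2 * Q <= d * Q by rewrite ler_wpM2r.
have tQ0 : 0 <= tau * Q by rewrite mulr_ge0.
have tdQ : tau * Q * d <= tau * Q by rewrite ler_piMr.
have tddQ : tau * Q * d * d <= tau * Q * d by rewrite ler_piMr ?mulr_ge0// ltW.
have tddQ0 : 0 <= tau * Q * d * d by rewrite !mulr_ge0// ltW.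
have s1 : expR (- (2 * d * (1 + d) * Q)) *
    Emod f l (fun s => expR ((1 + d) * lam * S s)) <= M / 4.
  apply: (le_trans (ler_wpM2l (expR_ge0 _) h2)).
  rewrite -expRD; apply: small.
  have -> : - (2 * d * (1 + d) * Q) + (1 + d) ^+ 2 * (1 + tau) * Q
    = (1 - d ^+ 2) * Q + (tau * Q + 2 * (tau * Q * d) + tau * Q * d * d) by ring.
  lra.
have s2 : expR (2 * d * (1 - d) * Q) *
    Emod f l (fun s => expR ((1 - d) * lam * S s)) <= M / 4.
  apply: (le_trans (ler_wpM2l (expR_ge0 _) h3)).
  rewrite -expRD; apply: small.
  have -> : 2 * d * (1 - d) * Q + (1 - d) ^+ 2 * (1 + tau) * Q
    = (1 - d ^+ 2) * Q + (tau * Q - 2 * (tau * Q * d) + tau * Q * d * d) by ring.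
  have : 0 <= tau * Q * d by rewrite mulr_ge0// ltW.
  lra.
have hP : M / 2 <= expR (2 * (1 + d) * Q) * P by lra.
rewrite mulrC -ler_pdivrMl ?expR_gt0// in hP.
apply: le_trans hP; rewrite [leRHS]mulrCA ler_wpM2l ?invr_ge0//.
rewrite -expRN -expRD ler_expR.
lra.
Qed.

Lemma Emod_expR_centered (l : seq T) (mu V : R) :
  Emod f l (fun s => expR (mu * ((size s)%:R - V))) =
  expR (- (mu * V)) * \prod_(i <- l) (1 + f i * (expR mu - 1)).
Proof.
rewrite -Emod_expR_size -EmodZ; apply: eq_Emod => s.
by rewrite -expRD; congr expR; ring.
Qed.

Lemma mgf_le (l : seq T) (mu : R) : `|mu| <= 1 ->
  Emod f l (fun s => expR (mu * ((size s)%:R - \sum_(i <- l) f i))) <=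
  expR (mu ^+ 2 / 2 * (1 + `|mu|) * \sum_(i <- l) f i).
Proof.
move=> mu1; rewrite Emod_expR_centered.
set V := \sum_(i <- l) f i.
apply: (@le_trans _ _ (expR (- (mu * V)) * expR ((expR mu - 1) * V))).
  rewrite ler_wpM2l ?expR_ge0// mulr_sumr expR_sum.
  apply: ler_prod => i _; rewrite mulrC expR_ge1Dx andbT.
  have /andP[a b] := f01 i; have e := expR_ge0 mu.
  have : 0 <= f i * expR mu by rewrite mulr_ge0.
  lra.
rewrite -expRD ler_expR addrC -mulrBl ler_wpM2r ?sumr_ge0//.
by have := expR_le_quad mu1; lra.
Qed.

(** With [z = f i * (expR mu - 1)] a factor [1 + z] is at least [expR (z - 2 * z ^+ 2)]. Since
    [f i <= tau] and [(expR mu - 1) ^+ 2 <= 4 * mu ^+ 2], the exponent loses at most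
    [8 * tau * mu ^+ 2] per unit of mass, which is the [16 * tau]. This is where small success
    probabilities enter. *)
Lemma mgf_ge (l : seq T) (mu tau : R) : `|mu| <= 1 ->
  0 <= tau <= 4^-1 -> all (fun i => f i <= tau) l ->
  expR (mu ^+ 2 / 2 * (1 - `|mu| - 16 * tau) * \sum_(i <- l) f i) <=
  Emod f l (fun s => expR (mu * ((size s)%:R - \sum_(i <- l) f i))).
Proof.
move=> mu1 /andP[t0 t4] ftau; rewrite Emod_expR_centered.
set V := \sum_(i <- l) f i.
set e := expR mu - 1.
have eq := expR_le_quad mu1.
have eq' := expR_ge_quad mu1.
have m2 : mu ^+ 2 <= `|mu|.
  by rewrite -(real_normK (num_real mu)) expr2 ler_piMl.
have e2 : `|e| <= 2 * `|mu|.
  have m3 : mu ^+ 2 / 2 * (1 + `|mu|) <= `|mu|.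
    have : mu ^+ 2 / 2 * (1 + `|mu|) <= mu ^+ 2 / 2 * 2.
      by rewrite ler_wpM2l ?divr_ge0 ?sqr_ge0//; lra.
    by lra.
  have m4 : 0 <= mu ^+ 2 / 2 * (1 - `|mu|).
    by rewrite mulr_ge0 ?divr_ge0 ?sqr_ge0//; lra.
  have := ler_norm mu; have := ler_norm (- mu); rewrite normrN => n1 n2.
  by rewrite ler_norml /e; apply/andP; split; lra.
have esq : e ^+ 2 <= 4 * mu ^+ 2.
  rewrite -[leLHS]ger0_norm ?sqr_ge0// normrX.
  have -> : 4 * mu ^+ 2 = (2 * `|mu|) ^+ 2.
    by rewrite exprMn -normrX [`|mu ^+ 2|]ger0_norm ?sqr_ge0//; ring.
  by rewrite ler_pXn2r// nnegrE mulr_ge0.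
apply: (@le_trans _ _ (expR (- (mu * V)) * expR ((e - 2 * tau * e ^+ 2) * V))).
  rewrite -expRD ler_expR.
  rewrite [leRHS](_ : _ = (e - 2 * tau * e ^+ 2 - mu) * V); last by ring.
  rewrite ler_wpM2r ?sumr_ge0//.
  have : 2 * tau * e ^+ 2 <= 2 * tau * (4 * mu ^+ 2).
    by rewrite ler_wpM2l// mulr_ge0.
  rewrite /e; lra.
rewrite ler_wpM2l ?expR_ge0// mulr_sumr expR_sum.
elim: l ftau @V => [|i l IH] /=; first by rewrite !big_nil.
move=> /andP[fi fl]; rewrite !big_cons; apply: ler_pM; rewrite ?expR_ge0//.
- by rewrite -expR_sum expR_ge0.
- have ez : `|f i * e| <= 2^-1.
    rewrite normrM (ger0_norm (f0 i)).
    by apply: (@le_trans _ _ (4^-1 * 2)); [rewrite ler_pM//; lra | lra].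
  apply: le_trans (expR_le_1D _); last by rewrite -ler_norml.
  rewrite ler_expR.
  have : f i * (f i * e ^+ 2) <= tau * (f i * e ^+ 2).
    by rewrite ler_wpM2r// mulr_ge0// sqr_ge0.
  by rewrite exprMn; lra.
- exact: IH.
Qed.

(** [sg] treats both tails at once. The bounds on [lam] and [tau] make [lam + 16 * tau] and
    [(1 + d) * lam] at most [d ^+ 2 / 16], the accuracy that [tilt_lower] requires. *)
Lemma block_lower (l : seq T) (sg lam d tau : R) :
  sg = 1 \/ sg = -1 -> 0 < d <= 1 -> 0 < lam <= d ^+ 2 / 32 ->
  0 <= tau <= d ^+ 2 / 512 -> all (fun i => f i <= tau) l ->
  8 <= d ^+ 2 * (lam ^+ 2 * (\sum_(i <- l) f i) / 2) ->
  2^-1 * expR (- ((1 + 3 * d) * (lam ^+ 2 * (\sum_(i <- l) f i) / 2))) <=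
  Pmod f l (fun s => (1 - d) * lam * (\sum_(i <- l) f i) <=
     sg * ((size s)%:R - \sum_(i <- l) f i)).
Proof.
move=> hsg /andP[d0 d1] /andP[lam0 lamd] /andP[t0 td] ftau dQ.
set V := \sum_(i <- l) f i in dQ *.
have d2 : d ^+ 2 <= d by rewrite expr2 ler_piMl// ltW.
have V0 : 0 <= V by rewrite sumr_ge0.
have Q0 : 0 <= lam ^+ 2 * V / 2 by rewrite divr_ge0// mulr_ge0// sqr_ge0.
have sg2 : sg ^+ 2 = 1 by case: hsg => ->; rewrite ?sqrrN expr1n.
have sgn x : `|x * sg| = `|x|.
  by rewrite normrM; case: hsg => ->; rewrite ?normrN1 ?normr1 mulr1.
apply: (@tilt_lower _ _ lam V d (d ^+ 2 / 16)) => //.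
- by rewrite d0.
- by rewrite divr_ge0 ?sqr_ge0/=.
- rewrite [X in Emod f l X](_ : _ =
      (fun s => expR ((lam * sg) * ((size s)%:R - V)))); last first.
    by apply/funext => s; congr expR; ring.
  have := @mgf_ge l (lam * sg) tau; rewrite sgn gtr0_norm// => h.
  apply: le_trans (h _ _ ftau); [|lra|lra].
  rewrite ler_expR -/V exprMn sg2 mulr1.
  rewrite [leRHS](_ : _ = (1 - lam - 16 * tau) * (lam ^+ 2 * V / 2)); last by field.
  by rewrite ler_wpM2r//; lra.
- rewrite [X in Emod f l X](_ : _ =
      (fun s => expR (((1 + d) * lam * sg) * ((size s)%:R - V)))); last first.
    by apply/funext => s; congr expR; ring.
  have dl : d * lam <= lam by rewrite ler_piMl// ltW.
  have p : 0 < (1 + d) * lam by rewrite mulr_gt0//; lra.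
  have := @mgf_le l ((1 + d) * lam * sg); rewrite sgn gtr0_norm// => h.
  apply: (le_trans (h _)); first by lra.
  rewrite ler_expR -/V !exprMn sg2 mulr1.
  rewrite [leRHS](_ : _ = ((1 + d) ^+ 2 * (lam ^+ 2 * V / 2)) * (1 + d ^+ 2 / 16));
    last by ring.
  rewrite [leLHS](_ : _ = ((1 + d) ^+ 2 * (lam ^+ 2 * V / 2)) * (1 + (1 + d) * lam));
    last by field.
  by rewrite ler_wpM2l ?mulr_ge0 ?sqr_ge0//; lra.
- rewrite [X in Emod f l X](_ : _ =
      (fun s => expR (((1 - d) * lam * sg) * ((size s)%:R - V)))); last first.
    by apply/funext => s; congr expR; ring.
  have dl : 0 <= d * lam by rewrite mulr_ge0// ltW.
  have dl' : d * lam <= lam by rewrite ler_piMl// ltW.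
  have p : 0 <= (1 - d) * lam by lra.
  have := @mgf_le l ((1 - d) * lam * sg); rewrite sgn ger0_norm// => h.
  apply: (le_trans (h _)); first by lra.
  rewrite ler_expR -/V !exprMn sg2 mulr1.
  rewrite [leRHS](_ : _ = ((1 - d) ^+ 2 * (lam ^+ 2 * V / 2)) * (1 + d ^+ 2 / 16));
    last by ring.
  rewrite [leLHS](_ : _ = ((1 - d) ^+ 2 * (lam ^+ 2 * V / 2)) * (1 + (1 - d) * lam));
    last by field.
  by rewrite ler_wpM2l ?mulr_ge0 ?sqr_ge0//; lra.
Qed.

End Tilt.

(** * Independent sparse blocks *)

Section LilBlocks.
Variable R : realType.

Lemma Pmod_forall_indep (T : Type) (f : T -> R) (l : seq T)
    (a : nat -> pred T) (P : nat -> seq T -> Prop) (p : nat -> R) (J K : nat) :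
  (forall i, 0 <= f i <= 1) ->
  (forall j k i, (j < k)%N -> a k i -> ~~ a j i) ->
  (forall j, (J <= j < K)%N -> Pmod f (seq.filter (a j) l) (P j) <= p j) ->
  Pmod f l (fun s => forall j, (J <= j < K)%N -> P j (seq.filter (a j) s)) <=
  \prod_(J <= j < K) p j.
Proof.
move=> f01 adisj hp.
have [JK|JK] := leqP J K; last by rewrite big_geq ?Pmod_le1// ltnW.
move: hp; rewrite -(subnKC JK); elim: (K - J)%N => [|k IH] hp.
  by rewrite addn0 big_geq// Pmod_le1.
rewrite addnS big_nat_recr ?leq_addr//=.
pose Q (s : seq T) := forall j, (J <= j < J + k)%N -> P j (seq.filter (a j) s).
apply: (@le_trans _ _ (Pmod f l (fun s =>
    P (J + k)%N (seq.filter (a (J + k)%N) s) /\ Q s))).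
  apply: Pmod_le => // s h; split; first by apply: h; lia.
  by move=> j hj; apply: h; lia.
rewrite Pmod_and_indep; last first.
  move=> s; suff h j : (j < J + k)%N ->
      seq.filter (a j) (seq.filter (predC (a (J + k)%N)) s) = seq.filter (a j) s.
    by split=> hQ j /[dup] hj /hQ; rewrite h//; lia.
  move=> jk; rewrite -filter_predI; apply: eq_filter => i /=.
  by case aj : (a j i) => //=; apply/negP => /(adisj _ _ _ jk); rewrite aj.
rewrite mulrC; apply: ler_pM; rewrite ?Pmod_ge0//.
  by apply: IH => j hj; apply: hp; lia.
by apply: hp; lia.
Qed.

Lemma harmonic_ge_ln (J K : nat) : (0 < J)%N -> (J <= K)%N ->
  ln (K%:R : R) - ln (J%:R : R) <= \sum_(J <= j < K) (j%:R)^-1.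
Proof.
move=> J0 JK; rewrite -(subnKC JK); elim: (K - J)%N => [|k IH].
  by rewrite addn0 big_geq// subrr.
rewrite addnS big_nat_recr ?leq_addr//=.
have p : 0 < (J + k)%:R :> R by rewrite ltr0n addn_gt0 J0.
have h : ln ((J + k).+1%:R : R) - ln (J + k)%:R <= (J + k)%:R^-1.
  rewrite -ln_div ?posrE ?ltr0n//.
  have -> : (J + k).+1%:R / (J + k)%:R = 1 + (J + k)%:R^-1 :> R.
    by rewrite -natr1 mulrDl divff ?gt_eqF// mul1r.
  by apply: le_ln1Dx; rewrite (lt_trans (ltrN10 _))// invr_gt0.
  by rewrite addn_gt0 J0.
lra.
Qed.

Lemma harmonic_unbounded (M : R) (J : nat) : (0 < J)%N ->
  exists2 K, (J <= K)%N & M <= \sum_(J <= j < K) (j%:R)^-1.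
Proof.
move=> J0; pose x := expR (M + ln (J%:R : R)).
exists (J + (Num.truncn x).+1)%N; first exact: leq_addr.
apply: le_trans (harmonic_ge_ln J0 (leq_addr _ _)).
rewrite lerBrDr -[leLHS](expRK (R := R)) ler_ln ?posrE ?expR_gt0 ?ltr0n//.
  by rewrite (le_trans (ltW (truncnS_gt _)))// ler_nat leq_addl.
by rewrite addnS.
Qed.

Lemma cnt_split (T : Type) (key : T -> R) (s : seq T) (t1 t2 : R) : t1 <= t2 ->
  cnt key s t2 = (cnt key s t1 + size (seq.filter (fun i => (t1 < key i <= t2)%R) s))%N.
Proof.
move=> t12; rewrite size_filter /cnt; elim: s => //= i s ->.
have [h1|h1] := leP (key i) t1; last by lia.
by rewrite (le_trans h1 t12) /=; lia.
Qed.

Lemma mass_split (T : Type) (f key : T -> R) (l : seq T) (t1 t2 : R) : t1 <= t2 ->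
  mass f key l t2 = mass f key l t1 +
    \sum_(i <- seq.filter (fun i => t1 < key i <= t2) l) f i.
Proof.
move=> t12; rewrite big_filter /mass; elim: l => [|i l IH].
  by rewrite !big_nil addr0.
rewrite !big_cons IH; have [h1|h1] /= := leP (key i) t1.
  by rewrite (le_trans h1 t12) addrA.
by case: ifP => // _; rewrite addrCA.
Qed.

Lemma lilsc_ge0 (u : R) : 0 <= lilsc u. Proof. exact: sqrtr_ge0. Qed.

(** The square root is the tilt parameter [lam] of the block: tilting by it shifts a sum of mean and
    variance near [expR s] by about one scale. *)
Lemma lilsc_expR (s : R) :
  lilsc (expR s) = Num.sqrt (2 * ln s / expR s) * expR s.
Proof.
rewrite /lilsc expRK -[X in _ = _ * X]ger0_norm ?expR_ge0// -sqrtr_sqr.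
rewrite [RHS]mulrC -sqrtrM ?sqr_ge0//; congr (Num.sqrt _).
by field; rewrite gt_eqF ?expR_gt0.
Qed.

(** The inverse of the third iterated logarithm; the block endpoints are equally spaced in its
    argument. *)
Definition tower (s : R) : R := expR (expR (expR s)).

Lemma lnln_tower s : ln (ln (tower s)) = expR s.
Proof. by rewrite /tower !expRK. Qed.

Lemma tower_mono : {mono tower : x y / x <= y}.
Proof. by move=> x y; rewrite /tower !ler_expR. Qed.

Lemma tower_smono : {mono tower : x y / x < y}.
Proof. by move=> x y; rewrite /tower !ltr_expR. Qed.

Lemma tower_gt (x : R) : x < tower x.
Proof.
have h (y : R) : y < expR y by have := expR_ge1Dx y; lra.
by rewrite (lt_trans (h x))// (lt_trans (h _)).
Qed.

(* The block is [exp (s - a) < log_2 t <= exp s] with [r = exp (- a)]; the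
   success probability is [(2 s)^-1], and [s] is a multiple of the index of the
   block, so these probabilities sum to infinity. *)
Lemma block_success (T : Type) (f : T -> R) (l : seq T) (sg r c B s : R) :
  (forall i, 0 <= f i <= 1) -> sg = 1 \/ sg = -1 -> 0 < r <= 4^-1 ->
  r ^+ 2 = 64 * (32 * c) ->
  expR 1 <= s -> 4 / c ^+ 2 <= s -> 2 * B / c <= s -> c^-1 <= ln s ->
  all (fun i => f i <= c / 16) l ->
  `|\sum_(i <- l) f i - (1 - r) * expR s| <= 2 * B ->
  (2 * s)^-1 <= Pmod f l (fun w => (1 - 2 * r) * lilsc (expR s) <=
    sg * ((size w)%:R - \sum_(i <- l) f i)).
Proof.
move=> f01 hsg /andP[r0 r4] rc s1 s2 s3 ls fl.
set V := \sum_(i <- l) f i; rewrite ler_norml => /andP[V1 V2].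
have s0 : 0 < s by apply: lt_le_trans s1; exact: expR_gt0.
have r2 : r ^+ 2 <= r by rewrite expr2 ler_piMl//; lra.
have r20 : 0 < r ^+ 2 by rewrite exprn_gt0.
have c01 : 0 < c <= 1 by apply/andP; split; lra.
have [c1 c2 c3] := lil_scale_small c01 s1 s2 s3.
set lam := Num.sqrt _ in c2.
set U := expR s in c3 V1 V2 *.
have U1 : 1 <= U by apply: le_trans (expR_ge1Dx _); lra.
have sU1 : 1 <= Num.sqrt U by rewrite -[leLHS]sqrtr1 ler_wsqrtr.
have sUU : Num.sqrt U ^+ 2 = U by rewrite sqr_sqrtr//; lra.
have sU : Num.sqrt U <= U by rewrite -{2}sUU expr2 ler_peMr//; lra.
have BU : B <= c * U.
  by apply: (le_trans c3); rewrite ler_wpM2l//; case/andP: c01 => /ltW.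
have r2U : r ^+ 2 * U <= r * U by rewrite ler_wpM2r//; lra.
have cU : r ^+ 2 * U = 64 * (32 * (c * U)) by rewrite rc; ring.
have lam0 : 0 < lam by rewrite sqrtr_gt0 divr_gt0 ?expR_gt0//; lra.
have lamU : lam ^+ 2 * U = 2 * ln s.
  rewrite sqr_sqrtr ?divr_ge0 ?expR_ge0//; last by lra.
  by rewrite divfK// gt_eqF// expR_gt0.
(* This makes [d ^+ 2 / 32 = c]. The block carries a fraction of about [1 - r] of [U], and the
   missing part pays for the factor [1 + 3 * d] of [block_lower]: as
   [(1 + 3 * d) * (1 - 7 / 8 * r) <= 1], the exponent stays below [ln s]. *)
pose d := r / 8.
have dd : d ^+ 2 = r ^+ 2 / 64 by rewrite /d; field.
have V3 : V <= (1 - 7 / 8 * r) * U by lra.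
have V4 : (1 - 9 / 8 * r) * U <= V by lra.
have l20 : 0 <= lam ^+ 2 by exact: sqr_ge0.
have Q1 : lam ^+ 2 * V / 2 <= (1 - 7 / 8 * r) * ln s.
  have : lam ^+ 2 * V <= lam ^+ 2 * ((1 - 7 / 8 * r) * U) by rewrite ler_wpM2l.
  have -> : lam ^+ 2 * ((1 - 7 / 8 * r) * U) = (1 - 7 / 8 * r) * (lam ^+ 2 * U) by ring.
  by rewrite lamU; lra.
have Q2 : (1 - 9 / 8 * r) * ln s <= lam ^+ 2 * V / 2.
  have : lam ^+ 2 * ((1 - 9 / 8 * r) * U) <= lam ^+ 2 * V by rewrite ler_wpM2l.
  have -> : lam ^+ 2 * ((1 - 9 / 8 * r) * U) = (1 - 9 / 8 * r) * (lam ^+ 2 * U) by ring.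
  by rewrite lamU; lra.
have rls : r * ln s <= 4^-1 * ln s by clear -r4 c1; rewrite ler_wpM2r//; lra.
have := @block_lower R T f f01 l sg lam d (c / 16) hsg.
have -> : 0 < d <= 1 by rewrite /d; clear -r0 r4; apply/andP; split; lra.
have -> : 0 < lam <= d ^+ 2 / 32.
  by rewrite lam0 dd /=; apply: (le_trans c2); clear -rc r20; lra.
have -> : 0 <= c / 16 <= d ^+ 2 / 512 by rewrite dd; clear -rc r20; apply/andP; split; lra.
have -> : 8 <= d ^+ 2 * (lam ^+ 2 * V / 2).
  have c1' : 1 <= c * ln s.
    by rewrite mulrC -ler_pdivrMr ?div1r//; clear -rc r20; lra.
  have : r ^+ 2 * ln s = 64 * (32 * (c * ln s)) by rewrite rc; ring.
  have : d ^+ 2 * (2^-1 * ln s) <= d ^+ 2 * (lam ^+ 2 * V / 2).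
    by rewrite ler_wpM2l ?sqr_ge0//; lra.
  by rewrite dd; clear -c1'; lra.
move=> /(_ isT isT isT fl isT) h.
apply: (@le_trans _ _ (2^-1 * expR (- ((1 + 3 * d) * (lam ^+ 2 * V / 2))))).
  rewrite invfM ler_wpM2l ?invr_ge0//.
  have -> : s^-1 = expR (- ln s) by rewrite expRN lnK.
  rewrite ler_expR lerN2.
  apply: (@le_trans _ _ ((1 + 3 * d) * ((1 - 7 / 8 * r) * ln s))).
    by rewrite ler_wpM2l// /d; clear -r0 r4; lra.
  have -> : (1 + 3 * d) * ((1 - 7 / 8 * r) * ln s) =
    ln s - (r / 2) * ln s - (21 / 64 * r ^+ 2) * ln s by rewrite /d; field.
  have : 0 <= (r / 2) * ln s by clear -r0 c1; rewrite mulr_ge0//; lra.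
  have : 0 <= (21 / 64 * r ^+ 2) * ln s by clear -r20 c1; rewrite mulr_ge0//; lra.
  lra.
apply: (le_trans h); apply: Pmod_le => // w; apply: le_trans.
rewrite lilsc_expR -/lam -/U mulrCA -mulrA (mulrCA _ lam) ler_wpM2l ?(ltW lam0)//.
apply: (@le_trans _ _ ((1 - d) * ((1 - 9 / 8 * r) * U))); last first.
  by rewrite ler_wpM2l// /d; clear -r0 r4; lra.
rewrite mulrA ler_wpM2r//; first by clear -U1; lra.
have -> : (1 - d) * (1 - 9 / 8 * r) = 1 - 5 / 4 * r + 9 / 64 * r ^+ 2.
  by rewrite /d; field.
lra.
Qed.

End LilBlocks.

Section LilLowerModel.
Variable R : realType.

(** The window [(T0, T1]] is fixed before the weights. If no earlier endpoint deviates by more than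
    twice its scale, one successful block already gives the required [t], because sparseness makes
    the part before the block small compared with the current scale. *)
Lemma lil_lower_model (eps eta B T0 sg : R) :
  0 < eps <= 1 -> 0 < eta -> sg = 1 \/ sg = -1 ->
  exists T1 : R, forall (T : Type) (f key : T -> R) (l : seq T),
    (forall i, 0 <= f i <= 1) ->
    (forall i, 0 < key i -> f i <= (key i)^-1) ->
    pairwise (fun a b => key a <= key b) l ->
    (forall t, T0 < t <= T1 -> `|mass f key l t - ln (ln t)| <= B) ->
    Pmod f l (fun s => forall t, T0 < t <= T1 ->
      sg * ((cnt key s t)%:R - ln (ln t)) < (1 - eps) * lilsc (ln (ln t))) <= eta.
Proof.
move=> /andP[eps0 eps1] eta0 hsg.
(* log_2 t at consecutive endpoints has ratio [r], so the previous scale is at most [q] times the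
   current one. The losses, [2 * r] from the block, [2 * q] from the past and at most [q] from
   [2 * B], fit into [eps = 6 * q]. *)
pose q := eps / 6; pose r := q ^+ 2.
have q0 : 0 < q by rewrite /q; lra.
have q1 : q <= 6^-1 by rewrite /q; lra.
have r0 : 0 < r by rewrite exprn_gt0.
have rq : r <= q * 6^-1 by rewrite /r expr2 ler_wpM2l ?(ltW q0).
have r4 : 0 < r <= 4^-1 by rewrite r0 /=; lra.
pose a := - ln r.
have er : expR (- a) = r by rewrite opprK lnK.
have a0 : 0 < a.
  by rewrite oppr_gt0 -ln1 ltr_ln ?posrE//; lra.
(* The upper half with [eps = 1] controls the starting points of all blocks at cost [eta / 2]. *)
have [Tu Hu] := lil_upper_model B ltr01 (divr_gt0 eta0 (ltr0n _ 2)).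
pose c := r ^+ 2 / 64 / 32.
have rc : r ^+ 2 = 64 * (32 * c) by rewrite /c; field.
have r20 : 0 < r ^+ 2 by rewrite exprn_gt0.
have c0 : 0 < c by lra.
have r2r : r ^+ 2 <= r by rewrite expr2 ler_piMl//; lra.
have c01 : 0 < c <= 1 by apply/andP; split; lra.
have cq : c <= q / 2 by lra.
pose S0 := Num.max (expR 1) (Num.max (4 / c ^+ 2) (Num.max (2 * B / c)
  (Num.max (expR c^-1) (Num.max T0 (Num.max Tu (16 / c)))))).
pose J := (Num.truncn (S0 / a)).+1.
have JS j : (J <= j)%N -> S0 <= a * j%:R.
  move=> Jj; rewrite mulrC -ler_pdivrMr// (le_trans (ltW (truncnS_gt _)))//.
  by rewrite ler_nat.
have J0 : (0 < J.+1)%N by [].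
(* Block [j] fails with probability at most [1 - 1 / (2 * a * j)]; this many blocks bring the
   product down to [eta / 2]. *)
have [K JK HK] := harmonic_unbounded (2 * a * (- ln (eta / 2))) J0.
pose tt j := tower (a * j%:R).
have ttE j : tt j = tower (a * j%:R) by [].
clearbody tt.
have ttm j k : (tt j <= tt k) = (j <= k)%N.
  by rewrite !ttE tower_mono ler_pM2l// ler_nat.
have ttsm j k : (tt j < tt k) = (j < k)%N.
  by rewrite !ttE tower_smono ltr_pM2l// ltr_nat.
have ttS j : (J <= j)%N -> S0 < tt j.
  by move=> /JS /le_lt_trans; apply; rewrite ttE; exact: tower_gt.
exists (tt K) => T f key l f01 fkey sl hB.
pose blk j : pred T := fun i => tt j.-1 < key i <= tt j.
have T0J : T0 < tt J.
  by apply: le_lt_trans (ttS _ (leqnn J)); rewrite !le_max lexx !orbT.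
have TuJ : Tu < tt J.
  by apply: le_lt_trans (ttS _ (leqnn J)); rewrite !le_max lexx !orbT.
have massE j : (J < j)%N ->
   \sum_(i <- seq.filter (blk j) l) f i = mass f key l (tt j) - mass f key l (tt j.-1).
  move=> hj; rewrite (@mass_split R _ f key l (tt j.-1) (tt j)); last by rewrite ttm leq_pred.
  by rewrite addrAC subrr add0r.
have hBj j : (J <= j <= K)%N -> `|mass f key l (tt j) - expR (a * j%:R)| <= B.
  move=> hj; rewrite -(lnln_tower (a * _)) -ttE; apply: hB.
  rewrite ttm; apply/andP; split; last by clear -hj; lia.
  by apply: (lt_le_trans T0J); rewrite ttm; clear -hj; lia.
have predU j : (0 < j)%N -> expR (a * j.-1%:R) = r * expR (a * j%:R).
  move=> j0; rewrite -er -expRD -[X in expR (_ + _ * X%:R)](prednK j0) -natr1.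
  by congr expR; ring.
have hV j : (J < j <= K)%N ->
    `|\sum_(i <- seq.filter (blk j) l) f i - (1 - r) * expR (a * j%:R)| <= 2 * B.
  move=> hj; rewrite massE; last by clear -hj; lia.
  have := hBj j; have := hBj j.-1; rewrite predU; last by clear -hj; lia.
  have -> : (J <= j <= K)%N by clear -hj; lia.
  have -> : (J <= j.-1 <= K)%N by clear -hj; lia.
  move=> /(_ isT) + /(_ isT); rewrite !ler_norml => /andP[v1 v2] /andP[v3 v4].
  by clear -v1 v2 v3 v4; apply/andP; split; lra.
pose succ j (w : seq T) := (1 - 2 * r) * lilsc (expR (a * j%:R)) <=
    sg * ((size w)%:R - \sum_(i <- seq.filter (blk j) l) f i).
have hS j : (J <= j)%N -> [/\ expR 1 <= a * j%:R, 4 / c ^+ 2 <= a * j%:R,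
     2 * B / c <= a * j%:R, c^-1 <= ln (a * j%:R) & 16 / c <= a * j%:R].
  move=> /JS; rewrite !ge_max => /and5P[s1 s2 s3 s4 /and3P[_ _ s7]]; split => //.
  by rewrite -[leLHS](expRK (R := R)) ler_ln ?posrE ?expR_gt0// (lt_le_trans _ s4)// expR_gt0.
have hsucc j : (J < j <= K)%N ->
    Pmod f (seq.filter (blk j) l) (fun w => ~ succ j w) <= 1 - (2 * (a * j%:R))^-1.
  move=> hj; rewrite PmodC// lerD2l lerN2.
  have [s1 s2 s3 s4 _] := hS j (ltac:(clear -hj; lia)).
  apply: (@block_success R _ f _ sg r c B (a * j%:R)) => //; last exact: hV.
  have [_ _ _ _ s7] := hS j.-1 (ltac:(clear -hj; lia)).
  rewrite all_filter; elim: (l) => //= i l' ->; rewrite andbT; apply/implyP => /andP[ki _].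
  have k1 : 16 / c < key i.
    apply: (le_lt_trans s7); apply: lt_trans ki; rewrite ttE; exact: tower_gt.
  have k0 : 0 < key i by apply: lt_trans k1; rewrite divr_gt0.
  apply: (le_trans (fkey _ k0)); rewrite -[leRHS]invrK lef_pV2 ?posrE ?invr_gt0 ?divr_gt0//.
  by rewrite invf_div ltW.
pose T1 := Num.max T0 Tu.
apply: (@le_trans _ _ (Pmod f l (fun s =>
   (exists2 t, T1 < t <= tt K &
      (1 + 1) * lilsc (ln (ln t)) < `|(cnt key s t)%:R - ln (ln t)|) \/
   (forall j, (J.+1 <= j < K)%N -> ~ succ j (seq.filter (blk j) s))))).
  apply: Pmod_le => // s hs.
  have [h|h] := pselect (exists2 t, T1 < t <= tt K &
      (1 + 1) * lilsc (ln (ln t)) < `|(cnt key s t)%:R - ln (ln t)|); first by left.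
  right => j hj sj.
  have := hs (tt j); have lntt k : ln (ln (tt k)) = expR (a * k%:R) by rewrite ttE lnln_tower.
  rewrite lntt.
  have -> : T0 < tt j <= tt K.
    rewrite ttm; apply/andP; split; last by clear -hj; lia.
    by apply: (lt_le_trans T0J); rewrite ttm; clear -hj; lia.
  move=> /(_ isT); apply/negP; rewrite -leNgt.
  have [s1 s2 s3 s4 _] := hS j (ltac:(clear -hj; lia)).
  have sj0 : 0 < a * j%:R by apply: lt_le_trans s1; exact: expR_gt0.
  have [p1 _ _ _ _] := hS j.-1 (ltac:(clear -hj; lia)).
  have pj0 : 0 < a * j.-1%:R by apply: lt_le_trans p1; exact: expR_gt0.
  set H := lilsc (expR (a * j%:R)) in sj *.
  have H0 : 0 <= H by exact: lilsc_ge0.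
  have prev : `|(cnt key s (tt j.-1))%:R - expR (a * j.-1%:R)| <= 2 * (q * H).
    have : lilsc (expR (a * j.-1%:R)) <= q * H.
      rewrite -(ger0_norm (ltW q0)) -sqrtr_sqr -/r -sqrtrM ?(ltW r0)// ler_wsqrtr//.
      rewrite !expRK predU; last by clear -hj; lia.
      rewrite [leLHS](_ : _ = r * (2 * expR (a * j%:R) * ln (a * j.-1%:R))); last by ring.
      rewrite ler_wpM2l ?(ltW r0)// ler_wpM2l ?mulr_ge0 ?expR_ge0//.
      by rewrite ler_ln ?posrE// ler_pM2l// ler_nat leq_pred.
    move=> lH; rewrite leNgt; apply/negP => bad; apply: h; exists (tt j.-1).
      rewrite ttm gt_max; apply/andP; split; last by clear -hj; lia.
      apply/andP; split; first by apply: (lt_le_trans T0J); rewrite ttm; clear -hj; lia.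
      by apply: (lt_le_trans TuJ); rewrite ttm; clear -hj; lia.
    by rewrite lntt; apply: le_lt_trans bad; clear -lH; lra.
  have [_ _ BsU] := lil_scale_small c01 s1 s2 s3.
  have Hlo : Num.sqrt (expR (a * j%:R)) <= H.
    rewrite ler_wsqrtr// expRK mulrAC ler_peMl ?expR_ge0//.
    have [l1 _ _] := lil_scale_small c01 s1 s2 s3; clear -l1; lra.
  have BH : 2 * B <= q * H.
    have : c * Num.sqrt (expR (a * j%:R)) <= c * H by rewrite ler_wpM2l// ltW.
    have : c * H <= q / 2 * H.
      by rewrite ler_wpM2r.
    by clear -BsU; lra.
  have rH : r * H <= q * 6^-1 * H by rewrite ler_wpM2r.
  have qH0 : 0 <= q * H by rewrite mulr_ge0 ?(ltW q0).
  have eH : eps * H = 6 * (q * H) by rewrite /q; field.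
  have cE : (cnt key s (tt j))%:R = (cnt key s (tt j.-1))%:R +
      (size (seq.filter (blk j) s))%:R :> R.
    by rewrite -natrD -cnt_split// ttm leq_pred.
  have := hV j; have -> : (J < j <= K)%N by clear -hj; lia.
  move=> /(_ isT); move: prev sj; rewrite /succ -/H cE predU; last by clear -hj; lia.
  set V := \sum_(i <- _) _; set U := expR _.
  rewrite !ler_norml => /andP[v1 v2] + /andP[v3 v4].
  by clear -hsg v1 v2 v3 v4 BH rH qH0 eH; case: hsg => ->; lra.
apply: (le_trans (Pmod_or f01 _ _ _)).
rewrite [leRHS](_ : _ = eta / 2 + eta / 2); last by field.
apply: lerD.
  apply: Hu => //; first by rewrite le_max lexx orbT.
  move=> t /andP[t1 t2]; apply: hB; rewrite t2 andbT.
  by apply: le_lt_trans t1; rewrite le_max lexx.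
apply: (le_trans (@Pmod_forall_indep R T f l blk (fun j w => ~ succ j w)
  (fun j => 1 - (2 * (a * j%:R))^-1) J.+1 K f01 _ _)).
- move=> j k i jk /andP[k1 k2]; rewrite negb_and -[X in _ || X]ltNge; apply/orP; right.
  by apply: le_lt_trans k1; rewrite ttm; clear -jk; lia.
- by move=> j hj; apply: hsucc; clear -hj; lia.
apply: (@le_trans _ _ (expR (- \sum_(J.+1 <= j < K) (2 * (a * j%:R))^-1))).
  rewrite -sumrN expR_sum; rewrite big_nat [leRHS]big_nat.
  apply: ler_prod => j hj; rewrite expR_ge1Dx andbT.
  have [s1 _ _ _ _] := hS j (ltac:(clear -hj; lia)).
  rewrite subr_ge0 invf_le1; first by have := expR_ge1Dx (1 : R); clear -s1; lra.
  by have := expR_ge1Dx (1 : R); clear -s1; lra.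
rewrite -[leRHS]lnK ?posrE ?divr_gt0// ler_expR lerNl.
rewrite (eq_bigr (fun j => (2 * a)^-1 * j%:R^-1)); last first.
  by move=> j _; rewrite mulrA invfM.
by rewrite -mulr_sumr -ler_pdivrMl ?invr_gt0 ?mulr_gt0// invrK.
Qed.

End LilLowerModel.

(** * Comparing laws by their moments *)

Section Transfer.
Variables (R : realType) (T : finType).
Implicit Types (A C D : {set T}) (mu nu F : {set T} -> R).

Definition bern (f : T -> R) A : R := \prod_i (if i \in A then f i else 1 - f i).

Definition moment mu C : R := \sum_(D : {set T} | C \subset D) mu D.

(** Moebius inversion on the lattice of subsets: the product vanishes unless [A \subset C], and is
    then -1 to the number of elements of [C] outside [A]. Written over all [i], it lets sums over
    [C] factor by distributivity. *)
Definition mobius_coef F C : R := \sum_(A : {set T}) F A *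
  \prod_i (if i \in C then (if i \in A then 1 else -1) else (i \notin A)%:R).

Lemma mobius_inversion F D : \sum_(C : {set T} | C \subset D) mobius_coef F C = F D.
Proof.
pose g A C i : R := if i \in C then (i \in D)%:R * (if i \in A then 1 else -1)
                    else (i \notin A)%:R.
have -> : \sum_(C : {set T} | C \subset D) mobius_coef F C =
    \sum_(C : {set T}) \sum_(A : {set T}) F A * \prod_i g A C i.
  rewrite big_mkcond; apply: eq_bigr => C _; case: ifPn => [CD|].
    apply: eq_bigr => A _; congr (_ * _); apply: eq_bigr => i _; rewrite /g.
    by case: ifP => // iC; rewrite (fintype.subsetP CD _ iC) mul1r.
  move=> /fintype.subsetPn[i iC iD]; rewrite big1// => A _.
  by rewrite (bigD1 i)//= /g iC (negbTE iD) !mul0r mulr0.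
rewrite exchange_big /= (bigD1 D)//= [X in _ + X]big1 ?addr0 => [|A AD].
  rewrite -mulr_sumr -[RHS]mulr1; congr (_ * _).
  rewrite -[LHS](@bigA_distr R 0 1 *%R +%R T (fun i => (i \in D)%:R * (if i \in D then 1 else -1))
    (fun i => (i \notin D)%:R)).
  by rewrite big1// => i _; case: (i \in D); rewrite /= ?mul1r ?mul0r ?addr0 ?add0r.
rewrite -mulr_sumr.
rewrite -[X in _ * X](@bigA_distr R 0 1 *%R +%R T (fun i => (i \in D)%:R * (if i \in A then 1 else -1))
    (fun i => (i \notin A)%:R)).
have [i hi] : exists i, (i \in A) != (i \in D).
  apply/existsP; apply: contraNT AD; rewrite negb_exists => /forallP h.
  by apply/eqP/setP => i; have := h i; rewrite negbK => /eqP.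
(* An element separating [A] from [D] contributes the factor [-1 + 1] or [0 + 0]. *)
rewrite (bigD1 i)//=; move: hi; case: (i \in A); case: (i \in D) => //= _.
  by rewrite mul0r addr0 mul0r mulr0.
by rewrite mul1r addNr mul0r mulr0.
Qed.

Lemma norm_mobius_coef F C : (forall A, `|F A| <= 1) ->
  `|mobius_coef F C| <= 2 ^+ #|C|.
Proof.
move=> F1; rewrite /mobius_coef.
apply: (le_trans (ler_norm_sum _ _ _)).
apply: (@le_trans _ _ (\sum_(A : {set T})
    \prod_i (if i \in A then (i \in C)%:R else 1))).
  apply: ler_sum => A _; rewrite normrM normr_prod.
  rewrite -[leRHS]mul1r; apply: ler_pM; rewrite ?F1//.
    by rewrite prodr_ge0.
  apply: ler_prod => i _; rewrite normr_ge0 /=.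
  by case: (i \in C); case: (i \in A); rewrite ?normrN ?normr1 ?normr0.
rewrite -[leLHS](@bigA_distr R 0 1 *%R +%R T (fun i => (i \in C)%:R) (fun=> 1)).
rewrite (bigID (mem C))/= [X in _ * X]big1 ?mulr1 => [|i /negbTE ->]; last first.
  by rewrite add0r.
by rewrite (eq_bigr (fun=> 2)) ?prodr_const// => i -> /=; rewrite mulr1n; ring.
Qed.

(** Since ['C(n, k) * 'C(k, j) = 'C(n, j) * 'C(n - j, k - j)]. It charges the low-order terms of a
    truncated expansion to the binomial of order [k]. *)
Lemma bin_mul_ge n k j : (j <= k <= n)%N -> ('C(n, j) <= 'C(n, k) * 'C(k, j))%N.
Proof.
move=> /andP[jk kn].
have p : (0 < j`! * ((k - j)`! * (n - k)`!))%N by rewrite !muln_gt0 !fact_gt0.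
rewrite -(leq_pmul2r p).
have e1 := bin_fact kn; have e2 := bin_fact jk.
have e3 := bin_fact (leq_trans jk kn).
have e4 : ('C(n - j, k - j) * ((k - j)`! * (n - k)`!) = (n - j)`!)%N.
  rewrite -(@bin_fact (n - j) (k - j)) ?leq_sub2r//.
  by congr (_ * (_ * _`!))%N; lia.
have -> : ('C(n, k) * 'C(k, j) * (j`! * ((k - j)`! * (n - k)`!)) = n`!)%N.
  by rewrite -e1 -e2; ring.
rewrite -e3 -e4.
rewrite [leqRHS](_ : _ = 'C(n - j, k - j) *
   ('C(n, j) * (j`! * ((k - j)`! * (n - k)`!))))%N; last by ring.
by rewrite leq_pmull// bin_gt0 leq_sub2r.
Qed.

Lemma bin_le_expn n j : ('C(n, j) <= n ^ j)%N.
Proof.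
apply: (@leq_trans (n ^_ j)); first by rewrite -bin_ffact leq_pmulr ?fact_gt0.
rewrite ffact_prod -[X in (_ <= _ ^ X)%N]card_ord -prod_nat_const.
by apply: leq_prod => i _; rewrite leq_subr.
Qed.

Lemma sum_subsets_card (D : {set T}) (K : nat) (g : nat -> R) :
  \sum_(C : {set T} | (C \subset D) && (#|C| <= K)%N) g #|C| =
  \sum_(j < K.+1) 'C(#|D|, j)%:R * g j.
Proof.
rewrite (partition_big (fun C : {set T} => (inord #|C| : 'I_K.+1)) predT)//=.
apply: eq_bigr => j _; rewrite -cards_draws -sum1_card natr_sum mulr_suml.
have inordE (C : {set T}) : (#|C| <= K)%N -> (inord #|C| == j) = (#|C| == j).
  by move=> CK; rewrite -val_eqE /= inordK.
apply: eq_big => [C|C].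
  rewrite inE -andbA; congr (_ && _).
  have [CK|CK] := leqP #|C| K; first by rewrite inordE.
  by apply/esym/negbTE; apply: contraTN CK => /eqP ->; rewrite -leqNgt -ltnS.
by move=> /andP[/andP[_ CK]]; rewrite inordE// => /eqP ->; rewrite mul1r.
Qed.

Lemma sum_mu_bin mu (K : nat) :
  \sum_D mu D * 'C(#|D|, K)%:R = \sum_(C : {set T} | #|C| == K) moment mu C.
Proof.
rewrite /moment (exchange_big_dep predT)//=.
apply: eq_bigr => D _; rewrite -cards_draws -sum1_card natr_sum mulr_sumr.
by apply: eq_big => [C|C _]; rewrite ?mulr1// inE andbC.
Qed.

(* [F] agrees with its truncated inclusion-exclusion expansion [F'] on sets of
   size at most [K], and [F'] only sees moments of order at most [K]. *)
Lemma moment_transfer mu nu F (K : nat) (delta : R) :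
  (forall D, 0 <= mu D) -> (forall D, 0 <= nu D) -> (forall D, `|F D| <= 1) ->
  0 <= delta ->
  (forall C, (#|C| <= K)%N -> `|moment mu C - moment nu C| <= delta) ->
  `|\sum_D mu D * F D - \sum_D nu D * F D| <=
    2 * 3 ^+ K * (\sum_(C : {set T} | #|C| == K) moment mu C +
                  \sum_(C : {set T} | #|C| == K) moment nu C) +
    delta * (1 + 2 * #|T|%:R) ^+ K.
Proof.
move=> mu0 nu0 F1 d0 hd.
pose F' D := \sum_(C : {set T} | (C \subset D) && (#|C| <= K)%N) mobius_coef F C.
have hF D : `|F D - F' D| <= 2 * 3 ^+ K * 'C(#|D|, K)%:R.
  have [DK|DK] := leqP #|D| K.
    rewrite (_ : F' D = F D) ?subrr ?normr0 ?mulr_ge0 ?exprn_ge0//.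
    rewrite -[RHS]mobius_inversion; apply: eq_bigl => C.
    by have [CD|] := boolP (C \subset D) => //=; exact: leq_trans (subset_leq_card CD) DK.
  have C1 : 1 <= 'C(#|D|, K)%:R :> R by rewrite ler1n bin_gt0 ltnW.
  (* The sum of ['C(#|D|, j) * 2 ^ j] over [j <= K] is at most ['C(#|D|, K)] times the binomial
     expansion of [(1 + 2) ^ K]. *)
  have hF' : `|F' D| <= 3 ^+ K * 'C(#|D|, K)%:R.
    apply: (le_trans (ler_norm_sum _ _ _)).
    apply: (le_trans (ler_sum _ (fun C _ => norm_mobius_coef C F1))).
    rewrite (sum_subsets_card D K (fun j => 2 ^+ j)).
    have -> : (3 : R) = 1 + 2 by ring.
    rewrite exprDn mulr_suml; apply: ler_sum => j _.
    rewrite expr1n mul1r mulr_natl mulrnAl -mulrnAr -[_ *+ 'C(_, _)]mulr_natr.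
    rewrite ler_wpM2l ?exprn_ge0// -mulrnA ler_nat.
    by apply: bin_mul_ge; rewrite -ltnS ltn_ord ltnW.
  apply: (le_trans (ler_normB _ _)).
  have : `|F D| <= 3 ^+ K * 'C(#|D|, K)%:R.
    apply: (le_trans (F1 D)); rewrite -[leLHS]mulr1 ler_pM// exprn_ege1//.
    by rewrite ler1n.
  by move=> ?; rewrite -mulrA mulr_natl mulr2n lerD.
have hmu (m : {set T} -> R) : (forall D, 0 <= m D) ->
    `|\sum_D m D * F D - \sum_D m D * F' D| <=
    2 * 3 ^+ K * \sum_(C : {set T} | #|C| == K) moment m C.
  move=> m0; rewrite -sum_mu_bin -sumrB mulr_sumr.
  apply: (le_trans (ler_norm_sum _ _ _)); apply: ler_sum => D _.
  by rewrite -mulrBr normrM (ger0_norm (m0 D)) mulrCA ler_wpM2l.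
have swap (m : {set T} -> R) : \sum_D m D * F' D =
    \sum_(C : {set T} | (C \subset finset.setT) && (#|C| <= K)%N) mobius_coef F C * moment m C.
  rewrite /F'; under eq_bigr do rewrite mulr_sumr.
  rewrite (exchange_big_dep (fun C : {set T} => (C \subset finset.setT) && (#|C| <= K)%N))/=; last first.
    by move=> D C _ /andP[_ ->]; rewrite finset.subsetT.
  apply: eq_bigr => C /andP[_ CK]; rewrite /moment mulr_sumr.
  by apply: eq_big => [D|D _]; rewrite ?CK ?andbT// mulrC.
have hdiff : `|\sum_D mu D * F' D - \sum_D nu D * F' D| <=
    delta * (1 + 2 * #|T|%:R) ^+ K.
  rewrite !swap -sumrB.
  apply: (le_trans (ler_norm_sum _ _ _)).
  apply: (@le_trans _ _ (\sum_(C : {set T} | (C \subset finset.setT) && (#|C| <= K)%N)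
     2 ^+ #|C| * delta)).
    apply: ler_sum => C /andP[_ CK]; rewrite -mulrBr normrM.
    by apply: ler_pM => //; [exact: norm_mobius_coef | exact: hd].
  rewrite -mulr_suml mulrC ler_wpM2l// (sum_subsets_card finset.setT K (fun j => 2 ^+ j)).
  rewrite exprDn; apply: ler_sum => j _; rewrite expr1n mul1r finset.cardsT.
  apply: (@le_trans _ _ ((2 * #|T|%:R) ^+ j)).
    by rewrite exprMn mulrC ler_wpM2l ?exprn_ge0// -natrX ler_nat bin_le_expn.
  by rewrite -[leRHS]mulr_natr ler_peMr ?exprn_ge0 ?mulr_ge0// ler1n bin_gt0 -ltnS.
have h1 := hmu mu mu0; have h2 := hmu nu nu0.
rewrite [X in `|X|](_ : _ = (\sum_D mu D * F D - \sum_D mu D * F' D) +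
  (\sum_D mu D * F' D - \sum_D nu D * F' D) -
  (\sum_D nu D * F D - \sum_D nu D * F' D)); last by ring.
apply: (le_trans (ler_normB _ _)).
apply: (le_trans (lerD (ler_normD _ _) (lexx _))).
by rewrite mulrDr; lra.
Qed.

Lemma moment_bern (f : T -> R) C : moment (bern f) C = \prod_(i in C) f i.
Proof.
rewrite /moment /bern big_mkcond /=.
transitivity (\sum_(D : {set T})
    \prod_i (if i \in D then f i else (i \notin C)%:R * (1 - f i))).
  apply: eq_bigr => D _; case: ifPn => [CD|/fintype.subsetPn[i iC iD]].
    apply: eq_bigr => i _; case: ifPn => // iD.
    by rewrite (contra (fintype.subsetP CD i) iD) mul1r.
  by rewrite (bigD1 i)//= (negbTE iD) iC !mul0r.
rewrite -[LHS](@bigA_distr R 0 1 *%R +%R T f (fun i => (i \notin C)%:R * (1 - f i))).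
rewrite [RHS]big_mkcond; apply: eq_bigr => i _.
by case: (i \in C) => /=; ring.
Qed.

Lemma bern_ge0 (f : T -> R) D : (forall i, 0 <= f i <= 1) -> 0 <= bern f D.
Proof.
move=> f01; apply: prodr_ge0 => i _; have /andP[f0 f1] := f01 i.
by case: ifP => // _; rewrite subr_ge0.
Qed.

(** Rankin's trick: weighting each element by [z] bounds the elementary symmetric sum by the product
    of the [1 + z * f i], divided by [z ^+ K]. *)
Lemma sum_prod_card_le (f : T -> R) (K : nat) (z : R) :
  (forall i, 0 <= f i) -> 0 < z ->
  \sum_(C : {set T} | #|C| == K) \prod_(i in C) f i <=
    expR (z * \sum_i f i) / z ^+ K.
Proof.
move=> f0 z0; rewrite ler_pdivlMr ?exprn_gt0// mulr_sumr expR_sum.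
apply: (@le_trans _ _ (\prod_i (z * f i + 1))); last first.
  apply: ler_prod => i _; rewrite addr_ge0 ?mulr_ge0 ?(ltW z0)//= addrC.
  exact: expR_ge1Dx.
rewrite (@bigA_distr R 0 1 *%R +%R T (fun i => z * f i) (fun=> 1)).
rewrite mulr_suml big_mkcond /=; apply: ler_sum => C _.
have -> : \prod_i (if i \in C then z * f i else 1) = (\prod_(i in C) f i) * z ^+ #|C|.
  by rewrite -big_mkcond big_split /= prodr_const mulrC.
by case: ifPn => [/eqP ->//|_]; rewrite mulr_ge0 ?exprn_ge0 ?(ltW z0)// prodr_ge0.
Qed.

(** Only subsets of [l] are summed, so that the induction can drop the head: sets without it are
    subsets of the tail, and those with it are reindexed by removing it. *)
Lemma Emod_bern_seq (f : T -> R) (l : seq T) (F : seq T -> R) : uniq l ->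
  \sum_(A : {set T} | A \subset [set x in l])
    (\prod_(i <- l) (if i \in A then f i else 1 - f i)) *
    F (seq.filter (fun i => i \in A) l) = Emod f l F.
Proof.
elim: l F => [|p l IH] F /=.
  move=> _; rewrite (big_pred1 finset.set0) => [|A].
    by rewrite big_nil mul1r.
  have -> : [set x in [::]] = finset.set0 :> {set T} by apply/setP => x; rewrite !inE.
  by rewrite finset.subset0.
move=> /andP[pl ul].
have sub A : p \notin A -> (A \subset [set x in p :: l]) = (A \subset [set x in l]).
  move=> pA; apply/fintype.subsetP/fintype.subsetP => h x xA; have := h x xA; rewrite !inE.
    by case: eqP => //= xp; rewrite -xp xA in pA.
  by move=> ->; rewrite orbT.
rewrite (bigID (fun A : {set T} => p \notin A)) /=; congr (_ + _).
  rewrite -IH// mulr_sumr; apply: eq_big => [A|A /andP[_ pA]].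
    have [pA|pA] := boolP (p \in A); last by rewrite andbT sub.
    rewrite andbF; apply/esym/negbTE/fintype.subsetPn; exists p => //.
    by rewrite inE.
  by rewrite big_cons (negbTE pA) mulrA.
rewrite -IH// mulr_sumr (reindex_onto (fun A => p |: A) (fun A => A :\ p)) /=; last first.
  by move=> A /andP[_]; rewrite negbK => /finset.setD1K.
apply: eq_big => [A|A /andP[_ /eqP pA]].
  have [pA|pA] := boolP (p \in A).
    have -> : (p |: A) :\ p == A = false.
      by apply/negbTE/eqP => /setP/(_ p); rewrite !inE eqxx pA.
    rewrite andbF; apply/esym/negbTE/fintype.subsetPn; exists p => //.
    by rewrite inE.
  rewrite finset.setU1K// eqxx andbT negbK !inE eqxx andbT finset.subUset -sub// finset.sub1set !inE eqxx.
  by [].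
have pA' : p \notin A by rewrite -pA !inE eqxx.
rewrite big_cons !inE eqxx /= mulrA; congr (_ * _ * _).
  rewrite big_seq [RHS]big_seq; apply: eq_bigr => i il; rewrite !inE.
  by case: eqP => // ip; rewrite -ip il in pl.
congr (F (_ :: _)); apply: eq_in_filter => i il; rewrite !inE.
by case: eqP => // ip; rewrite -ip il in pl.
Qed.

Lemma enum_setE (A : {set T}) : enum A = seq.filter (fun i => i \in A) (enum T).
Proof.
by rewrite {1}/enum_mem /enum_mem -filter_predI; apply: eq_filter => i /=; rewrite andbT.
Qed.

Lemma Emod_bern (f : T -> R) (F : seq T -> R) :
  \sum_(A : {set T}) bern f A * F (enum A) = Emod f (enum T) F.
Proof.
rewrite -Emod_bern_seq ?enum_uniq//; apply: eq_big => [A|A _].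
  by apply/esym/fintype.subsetP => x _; rewrite inE mem_enum.
by rewrite /bern big_enum /= enum_setE.
Qed.

End Transfer.

(** * Mertens' theorem *)

Lemma primes_prod_dvdn (a b N : nat) :
  (forall p, (a < p <= b)%N -> prime p -> (p %| N)%N) ->
  ((\prod_(a.+1 <= p < b.+1 | prime p) p) %| N)%N.
Proof.
have [ab|ba] := leqP a b; last by rewrite big_geq ?dvd1n// ltnS ltnW.
rewrite -(subnKC ab); elim: (b - a)%N => [|k IH] h.
  by rewrite addn0 big_geq// dvd1n.
rewrite addnS big_mkcond big_nat_recr/= -?big_mkcond/=; last by rewrite ltnS leq_addr.
have IH' : (\prod_(a.+1 <= p < (a + k).+1 | prime p) p %| N)%N.
  by apply: IH => p hp; apply: h; lia.
case: ifPn => [pp|_]; last by rewrite muln1.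
rewrite Gauss_dvd ?IH' ?h//=; first by lia.
rewrite coprime_sym prime_coprime// Euclid_dvd_prod//.
rewrite big_has_cond; apply/negP => /hasP[q]; rewrite mem_index_iota => hq /andP[pq].
by rewrite dvdn_prime2// => /eqP e; move: hq; rewrite -e; lia.
Qed.

Lemma bin_odd_le m : ('C(m.*2.+1, m) <= 4 ^ m)%N.
Proof.
have h : ('C(m.*2.+1, m) + 'C(m.*2.+1, m.+1) <= 2 ^ m.*2.+1)%N.
  rewrite -[2%N]/(1 + 1)%N expnDn.
  have hm : (m.+1 < m.*2.+2)%N by lia.
  have hm' : (m < m.*2.+2)%N by lia.
  rewrite (bigD1 (Ordinal hm))//= (bigD1 (Ordinal hm'))/=; last first.
    by rewrite -val_eqE /= neq_ltn ltnSn.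
  by rewrite !exp1n !muln1 addnCA addnA leq_addr.
have e : 'C(m.*2.+1, m.+1) = 'C(m.*2.+1, m).
  by rewrite -bin_sub; [congr 'C(_, _); lia | lia].
move: h; rewrite e addnn expnS -mul2n leq_pmul2l// => /leq_trans; apply.
by rewrite -mul2n expnM.
Qed.

(** Erdos's induction: for odd [n = 2 m + 1] the primes in [(m + 1, n]] divide ['C(n, m) <= 4 ^ m],
    and the smaller ones contribute at most [4 ^ (m + 1)]. *)
Lemma primorial_le n : (\prod_(0 <= p < n.+1 | prime p) p <= 4 ^ n)%N.
Proof.
elim/ltn_ind: n => n IH.
have [n2|n2] := leqP n 2.
  by case: n n2 {IH} => [|[|[|]]] // _; rewrite /index_iota /= !big_cons big_nil.
have [no|ne] := boolP (odd n); last first.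
  have np : ~~ prime n.
    by apply/negP => /even_prime[]; [lia | move=> o; rewrite o in ne].
  rewrite big_mkcond big_nat_recr//= -big_mkcond/= (negbTE np) muln1.
  case: n {ne np} n2 IH => // n n2 IH.
  apply: (leq_trans (IH n (ltnSn _))); by rewrite leq_exp2l.
pose m := n./2.
have nE : n = m.*2.+1 by rewrite -[LHS]odd_double_half no.
have m1 : (0 < m)%N by rewrite /m; lia.
rewrite (@big_cat_nat _ _ _ m.+2)//=; last by lia.
have h1 : (\prod_(0 <= p < m.+2 | prime p) p <= 4 ^ m.+1)%N by apply: IH; lia.
have h2 : (\prod_(m.+2 <= p < n.+1 | prime p) p <= 4 ^ m)%N.
  apply: leq_trans (bin_odd_le m); apply: dvdn_leq; first by rewrite bin_gt0; lia.
  apply: primes_prod_dvdn => p hp pp.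
  have : (p %| (m.*2.+1)`!)%N by apply: dvdn_fact; lia.
  rewrite -(@bin_fact m.*2.+1 m); last by lia.
  have nd k : (k < p)%N -> (p %| k`!)%N = false.
    move=> kp; apply/negbTE; rewrite fact_prod Euclid_dvd_prod// big_has.
    apply/negP => /hasP[q]; rewrite mem_index_iota => /andP[q1 q2] /(dvdn_leq q1); lia.
  by rewrite !Euclid_dvdM// !nd ?orbF//; lia.
apply: (leq_trans (leq_mul h1 h2)); rewrite -expnD leq_exp2l//; lia.
Qed.

Section Mertens.
Variable R : realType.

Definition theta (n : nat) : R := \sum_(0 <= p < n.+1 | prime p) ln p%:R.
Definition lnp_sum (n : nat) : R := \sum_(0 <= p < n.+1 | prime p) ln p%:R / p%:R.
Definition recip_sum (n : nat) : R := \sum_(0 <= p < n.+1 | prime p) p%:R^-1.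

Lemma ln_nat_ge0 (n : nat) : 0 <= ln (n%:R : R).
Proof. by case: n => [|n]; [rewrite ln0 | rewrite ln_ge0// ler1n]. Qed.

Lemma ln2_gt0 : 0 < ln (2 : R). Proof. by rewrite ln_gt0// ltr1n. Qed.

Lemma theta_le n : theta n <= ln 4 * n%:R.
Proof.
have e : theta n = ln (\prod_(0 <= p < n.+1 | prime p) p)%:R.
  rewrite /theta natr_prod; elim: (index_iota 0 n.+1) => [|p s IH].
    by rewrite !big_nil ln1.
  rewrite !big_cons; case: ifPn => // pp; rewrite lnM ?IH// posrE.
    by rewrite ltr0n prime_gt0.
  by rewrite prodr_gt0// => q /prime_gt0; rewrite ltr0n.
rewrite e mulrC mulr_natl -lnXn// -natrX ler_ln ?posrE ?ltr0n ?expn_gt0//.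
  by rewrite ler_nat primorial_le.
by rewrite prodn_cond_gt0// => p /prime_gt0.
Qed.

Lemma ln_factorization (m n : nat) : (0 < m <= n)%N ->
  ln (m%:R : R) = \sum_(0 <= p < n.+1 | prime p) (logn p m)%:R * ln p%:R.
Proof.
move=> /andP[m0 mn]; rewrite -[in LHS](partnT m0) (widen_partn _ mn) natr_prod.
rewrite (eq_bigl predT)// [RHS]big_mkcond.
elim: (index_iota 0 n.+1) => [|p s IH]; first by rewrite !big_nil ln1.
rewrite !big_cons /=; case: ifPn => [pp|np]; last first.
  by rewrite lognE (negbTE np) /= mul1r add0r.
have p0 : 0 < p%:R :> R by rewrite ltr0n prime_gt0.
rewrite natrX lnM ?posrE ?exprn_gt0//; last first.
  elim: s {IH} => [|q s IH]; first by rewrite big_nil.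
  rewrite big_cons mulr_gt0//; case: q => [|q]; first by rewrite lognE expn0.
  by rewrite ltr0n expn_gt0.
by rewrite IH lnXn// mulr_natl.
Qed.

Lemma ln_fact_sum (n : nat) :
  ln (n`!%:R : R) = \sum_(0 <= p < n.+1 | prime p) (logn p n`!)%:R * ln p%:R.
Proof.
suff h k : (k <= n)%N ->
    ln (k`!%:R : R) = \sum_(0 <= p < n.+1 | prime p) (logn p k`!)%:R * ln p%:R.
  exact: h.
elim: k => [_|k IH kn].
  by rewrite fact0 ln1 big1// => p _; rewrite logn1 mul0r.
rewrite factS natrM lnM ?posrE ?ltr0n ?fact_gt0// IH ?(ltnW kn)//.
rewrite (@ln_factorization _ n)// -big_split /=; apply: eq_bigr => p pp.
by rewrite lognM ?fact_gt0// natrD mulrDl.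
Qed.

Lemma logn_fact_ge (n p : nat) : prime p -> n%:R / p%:R - 1 <= (logn p n`!)%:R :> R.
Proof.
move=> pp; have p0 : 0 < p%:R :> R by rewrite ltr0n prime_gt0.
apply: (@le_trans _ _ (n %/ p)%:R).
  rewrite lerBlDr ler_pdivrMr// natr1 -natrM ler_nat ltnW// mulnC.
  by rewrite mulnC -ltn_divLR ?prime_gt0.
rewrite ler_nat logn_fact//; case: n => [|n]; first by rewrite div0n.
by rewrite big_nat_recl// expn1 leq_addr.
Qed.

Lemma logn_fact_le (n p : nat) : prime p ->
  (logn p n`!)%:R <= n%:R / p%:R + 2 * n%:R / p%:R ^+ 2 :> R.
Proof.
move=> pp; have p2 : 2 <= p%:R :> R by rewrite ler_nat prime_gt1.
have p0 : 0 < p%:R :> R by lra.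
have n0 : 0 <= n%:R :> R by [].
rewrite logn_fact// natr_sum.
have h k : \sum_(1 <= i < k.+1) ((n %/ p ^ i)%:R : R) <=
    n%:R / (p%:R - 1) * (1 - (p%:R ^+ k)^-1).
  elim: k => [|k IH]; first by rewrite big_geq// expr0 invr1 subrr mulr0.
  rewrite big_nat_recr//=; apply: (le_trans (lerD IH (lexx _))).
  have hk : (n %/ p ^ k.+1)%:R <= n%:R / (p%:R ^+ k.+1) :> R.
    by rewrite ler_pdivlMr ?exprn_gt0// -natrX -natrM ler_nat leq_divM.
  apply: (le_trans (lerD (lexx _) hk)).
  rewrite le_eqVlt; apply/orP; left; apply/eqP; rewrite exprS.
  by field; rewrite expf_neq0 ?gt_eqF//=; lra.
apply: (le_trans (h n)).
apply: (@le_trans _ _ (n%:R / (p%:R - 1))).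
  rewrite ler_piMr// ?divr_ge0//; first by lra.
have -> : n%:R / p%:R + 2 * n%:R / p%:R ^+ 2 = n%:R * ((p%:R + 2) / p%:R ^+ 2) :> R.
  by field; rewrite gt_eqF.
rewrite ler_wpM2l// ler_pdivlMr ?exprn_gt0// ler_pdivrMl; last by lra.
have -> : (p%:R - 1) * (p%:R + 2) = p%:R ^+ 2 + (p%:R - 2) :> R by ring.
lra.
Qed.

(** [n ^ n / n!] is a single term of the exponential series at [n]. *)
Lemma ln_fact_ge (n : nat) : n%:R * ln n%:R - n%:R <= ln (n`!%:R : R).
Proof.
case: n => [|n]; first by rewrite mul0r subr0 fact0 ln1.
have p : 0 < n.+1%:R :> R by [].
have h : n.+1%:R ^+ n.+1 / n.+1`!%:R <= expR (n.+1%:R : R).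
  by apply: le_trans (expR_ge1Dxn n (ltW p)); rewrite lerDr.
rewrite lerBlDr -lerBlDl mulr_natl -lnXn// -ln_div ?posrE ?exprn_gt0 ?ltr0n ?fact_gt0//.
rewrite -[leRHS](expRK (R := R)) ler_ln ?posrE ?expR_gt0// divr_gt0 ?exprn_gt0//.
Qed.

Lemma ln_fact_le (n : nat) : ln (n`!%:R : R) <= n%:R * ln n%:R.
Proof.
case: n => [|n]; first by rewrite mul0r fact0 ln1.
rewrite mulr_natl -lnXn// ler_ln ?posrE ?exprn_gt0 ?ltr0n ?fact_gt0//.
rewrite -natrX ler_nat; elim: n => // n IH; rewrite factS expnS leq_mul//.
by rewrite (leq_trans IH)// leq_exp2r.
Qed.

(** [ln m <= 2 * Num.sqrt m] reduces the sum to that of [2 * m ^ (- 3/2)], and [powRN_tail] from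
    [J = 1] gives twice 2. *)
Lemma ln_over_sq_sum (n : nat) :
  \sum_(0 <= p < n.+1 | prime p) ln p%:R / p%:R ^+ 2 <= 4 :> R.
Proof.
have l (m : nat) : (0 < m)%N ->
    ln (m%:R : R) / m%:R ^+ 2 <= 2 * m%:R `^ (- (1 + 2^-1)).
  move=> m0; have m0' : 0 < m%:R :> R by rewrite ltr0n.
  have -> : m%:R `^ (- (1 + 2^-1)) = m%:R `^ 2^-1 / m%:R ^+ 2 :> R.
    rewrite -powR_mulrn ?ler0n// -powRN -powRD; last by rewrite (gt_eqF m0') implybT.
    by congr (_ `^ _); field.
  rewrite mulrA ler_wpM2r ?invr_ge0 ?exprn_ge0//.
  have := ln_sublinear (powR_gt0 2^-1 m0'); rewrite ln_powR.
  by lra.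
apply: (@le_trans _ _ (\sum_(2 <= m < n.+1) 2 * (m%:R : R) `^ (- (1 + 2^-1)))).
  rewrite big_mkcond /=.
  have [n1|n1] := leqP n.+1 2.
    rewrite big_nat big1 ?[leRHS]big_geq// => p hp; rewrite ifF//.
    by apply/negP => /prime_gt1; lia.
  rewrite (@big_cat_nat _ _ _ 2)//=; last by lia.
  rewrite [X in X + _]big_nat [X in X + _]big1 ?add0r => [|p hp]; last first.
    by rewrite ifF//; apply/negP => /prime_gt1; lia.
  rewrite big_nat [leRHS]big_nat; apply: ler_sum => p hp; case: ifP => _.
    by apply: l; lia.
  by rewrite mulr_ge0 ?powR_ge0.
rewrite -mulr_sumr; have h := @powRN_tail R 2^-1 1 n.+1.
apply: (@le_trans _ _ (2 * (2^-1^-1 * 1%:R `^ (- 2^-1)))).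
  by rewrite ler_wpM2l// h// invr_gt0.
by rewrite powR1 invrK; lra.
Qed.

(** Legendre's formula for [ln n!] is compared with [n * ln n]. One direction loses
    [theta n <= 4 n]; the other loses [n] from Stirling's bound and [8 n] from higher prime powers,
    hence 9. *)
Lemma mertens1 (n : nat) : (0 < n)%N -> `|lnp_sum n - ln n%:R| <= 9.
Proof.
move=> n0; have n0' : 0 < n%:R :> R by rewrite ltr0n.
have up : n%:R * lnp_sum n - theta n <= n%:R * ln n%:R.
  apply: le_trans (ln_fact_le n); rewrite ln_fact_sum /lnp_sum /theta mulr_sumr -sumrB.
  apply: ler_sum => p pp.
  have -> : n%:R * (ln p%:R / p%:R) - ln p%:R = (n%:R / p%:R - 1) * ln p%:R :> R by ring.
  by rewrite ler_wpM2r ?ln_nat_ge0// logn_fact_ge.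
have lo : n%:R * ln n%:R - n%:R <= n%:R * lnp_sum n + 2 * n%:R * 4.
  apply: (le_trans (ln_fact_ge n)).
  apply: (@le_trans _ _ (n%:R * lnp_sum n + 2 * n%:R *
      \sum_(0 <= p < n.+1 | prime p) ln p%:R / p%:R ^+ 2)); last first.
    by rewrite lerD2l ler_wpM2l ?mulr_ge0// ln_over_sq_sum.
  rewrite ln_fact_sum /lnp_sum !mulr_sumr -big_split /=.
  apply: ler_sum => p pp.
  have -> : n%:R * (ln p%:R / p%:R) + 2 * n%:R * (ln p%:R / p%:R ^+ 2) =
    (n%:R / p%:R + 2 * n%:R / p%:R ^+ 2) * ln p%:R :> R by ring.
  by rewrite ler_wpM2r ?ln_nat_ge0// logn_fact_le.
have th := theta_le n.
have l4 : ln 4 < 4 :> R by exact: ln_sublinear.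
have th' : theta n <= n%:R * 4.
  by apply: (le_trans th); rewrite mulrC ler_wpM2l// ltW.
have u1 : n%:R * (lnp_sum n - ln n%:R) <= n%:R * 9 by lra.
have u2 : n%:R * (ln n%:R - lnp_sum n) <= n%:R * 9 by lra.
move: u1 u2; rewrite !ler_pM2l// => u1 u2.
by rewrite ler_norml; apply/andP; split; lra.
Qed.

Lemma psumS (g : nat -> R) (n : nat) :
  \sum_(0 <= p < n.+2 | prime p) g p =
  \sum_(0 <= p < n.+1 | prime p) g p + (if prime n.+1 then g n.+1 else 0).
Proof. by rewrite big_mkcond big_nat_recr//= -big_mkcond. Qed.

Let lnn (k : nat) : R := ln k%:R.

Let lnn_gt0 k : (1 < k)%N -> 0 < lnn k.
Proof. by move=> k1; rewrite ln_gt0// ltr1n. Qed.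

Let lnnS k : (0 < k)%N -> lnn k.+1 - lnn k <= k%:R^-1.
Proof.
move=> k0; have := @harmonic_ge_ln R k k.+1 k0 (leqnSn k).
by rewrite big_nat1.
Qed.

Let lnn_ltS k : (0 < k)%N -> lnn k < lnn k.+1.
Proof. by move=> k0; rewrite ltr_ln ?posrE ?ltr0n// ltr_nat. Qed.

Let dl (k : nat) : R := (lnn k)^-1 - (lnn k.+1)^-1.

(** Partial summation with the weight [1 / ln], as [1 / p] is [ln p / p] divided by [ln p]. *)
Lemma abel_recip n : (2 <= n)%N ->
  recip_sum n = lnp_sum n / lnn n + \sum_(2 <= k < n) lnp_sum k * dl k.
Proof.
move=> n2; rewrite -(subnKC n2); have F (X S a b P : R) : P != 0 -> a != 0 -> b != 0 ->
    X / b + S + P^-1 = (X + a / P) / a + (S + X * (b^-1 - a^-1)).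
  by move=> *; field; apply/and3P.
elim: (n - 2)%N => [|k IH].
  rewrite addn0 [X in _ + X]big_geq// addr0 /recip_sum /lnp_sum /lnn.
  rewrite /index_iota /= !big_cons !big_nil /= !addr0.
  by field; rewrite gt_eqF ?ln2_gt0.
rewrite addnS big_nat_recr ?leq_addr//= /recip_sum psumS -/(recip_sum _) IH.
rewrite {3}/lnp_sum psumS -/(lnp_sum _) /dl.
have l1 : lnn (2 + k) != 0 by rewrite gt_eqF// lnn_gt0.
have l2 : lnn (2 + k).+1 != 0 by rewrite gt_eqF// lnn_gt0.
have p0 : ((2 + k).+1%:R : R) != 0 by rewrite pnatr_eq0.
rewrite -/(lnn (2 + k).+1).
case: ifP => _; last by field; rewrite l1 l2.
rewrite -/(lnn (2 + k).+1).
exact: F.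
Qed.

(** For [a = ln k / ln (k + 1)] both quantities lie between [1 - a] and [a^-1 - 1], an interval of
    length [(ln (k + 1) - ln k) ^ 2 / (ln k * ln (k + 1))], which is summable. *)
Lemma lnln_step k : (2 <= k)%N ->
  `|lnn k * dl k - (ln (lnn k.+1) - ln (lnn k))| <=
     (ln 2)^-1 ^+ 2 * k%:R `^ (- (1 + 1)).
Proof.
move=> k2; have k0 : (0 < k)%N by lia.
have l1 := lnn_gt0 k2; have l2 : 0 < lnn k.+1 by apply: lnn_gt0; lia.
have l12 := lnn_ltS k0; have lS := lnnS k0.
have k0' : 0 < k%:R :> R by rewrite ltr0n.
set a := lnn k / lnn k.+1.
have a0 : 0 < a by rewrite divr_gt0.
have -> : lnn k * dl k = 1 - a by rewrite /dl /a; field; rewrite !gt_eqF.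
have -> : ln (lnn k.+1) - ln (lnn k) = - ln a.
  by rewrite /a ln_div ?posrE// opprB.
have h1 : 1 - a <= - ln a.
  have := @le_ln1Dx R (a - 1); rewrite addrCA subrr addr0 => h.
  by have := h (ltac:(lra)); lra.
have h2 : - ln a <= a^-1 - 1.
  rewrite -lnV ?posrE//; have := @le_ln1Dx R (a^-1 - 1); rewrite addrCA subrr addr0; apply.
  by have : 0 < a^-1; [rewrite invr_gt0|lra].
have h3 : a^-1 - 1 - (1 - a) <= (ln 2)^-1 ^+ 2 * k%:R `^ (- (1 + 1)).
  have -> : a^-1 - 1 - (1 - a) = (lnn k.+1 - lnn k) ^+ 2 * ((lnn k)^-1 * (lnn k.+1)^-1).
    by rewrite /a; field; rewrite !gt_eqF.
  have -> : k%:R `^ (- (1 + 1)) = k%:R^-1 ^+ 2 :> R.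
    rewrite -[1 + 1]/(2%:R : R) powRN powR_mulrn ?exprVn//.
  rewrite [leRHS]mulrC; apply: ler_pM; rewrite ?sqr_ge0//.
  - by rewrite mulr_ge0// invr_ge0 ltW.
  - by rewrite ler_pXn2r ?nnegrE ?invr_ge0//; lra.
  - have ll k' : (2 <= k')%N -> (lnn k')^-1 <= (ln 2)^-1.
      move=> hk; rewrite lef_pV2 ?posrE ?lnn_gt0 ?ln2_gt0//.
      by rewrite ler_ln ?posrE ?ltr0n ?ler_nat//; lia.
    by rewrite expr2; apply: ler_pM; rewrite ?invr_ge0 ?(ltW l1) ?(ltW l2)// ll//; lia.
by rewrite ler_norml; apply/andP; split; lra.
Qed.

Lemma mertens_nat : exists C : R, forall n : nat, (2 <= n)%N ->
  `|recip_sum n - ln (ln n%:R)| <= C.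
Proof.
pose L : R := (ln 2)^-1.
have L0 : 0 < L by rewrite invr_gt0 ln2_gt0.
(* The boundary term of the partial summation is 1 up to [9 * L], replacing [lnp_sum] by [ln] costs
   [9 * L], passing to a telescoping sum costs [L ^+ 2], and the lower end of that sum is
   [ln (ln 2)]. *)
exists (1 + 9 * L + 9 * L + L ^+ 2 + `|ln (ln 2)|) => n n2.
rewrite abel_recip//.
have ln0 := lnn_gt0 n2.
have lnL : (lnn n)^-1 <= L.
  by rewrite lef_pV2 ?posrE ?ln2_gt0// ler_ln ?posrE ?ltr0n ?ler_nat//; lia.
have t1 : `|lnp_sum n / lnn n - 1| <= 9 * L.
  have -> : lnp_sum n / lnn n - 1 = (lnp_sum n - lnn n) * (lnn n)^-1.
    by rewrite mulrBl mulfV// gt_eqF.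
  rewrite normrM; apply: ler_pM => //; first by apply: mertens1; lia.
  by rewrite ger0_norm// invr_ge0 ltW.
have dl0 k : (2 <= k)%N -> 0 <= dl k.
  move=> k2; rewrite subr_ge0 lef_pV2 ?posrE ?lnn_gt0//; last by lia.
  by rewrite ltW// lnn_ltS//; lia.
have sdl : \sum_(2 <= k < n) dl k <= L.
  have -> : \sum_(2 <= k < n) dl k = (lnn 2)^-1 - (lnn n)^-1.
    rewrite -(subnKC n2); elim: (n - 2)%N => [|k IH].
      by rewrite addn0 big_geq// subrr.
    by rewrite addnS big_nat_recr ?leq_addr//= IH /dl; ring.
  by rewrite -/L lerBlDr lerDl invr_ge0 ltW.
have t2 : `|\sum_(2 <= k < n) lnp_sum k * dl k - \sum_(2 <= k < n) lnn k * dl k| <= 9 * L.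
  rewrite -sumrB; apply: (le_trans (ler_norm_sum _ _ _)).
  apply: (@le_trans _ _ (\sum_(2 <= k < n) 9 * dl k)).
    rewrite big_nat [leRHS]big_nat; apply: ler_sum => k /andP[k2 _].
    rewrite -mulrBl normrM (ger0_norm (dl0 k k2)) ler_wpM2r ?dl0//.
    by apply: mertens1; lia.
  by rewrite -mulr_sumr ler_wpM2l.
have t3 : `|\sum_(2 <= k < n) lnn k * dl k - (ln (lnn n) - ln (lnn 2))| <= L ^+ 2.
  have -> : ln (lnn n) - ln (lnn 2) = \sum_(2 <= k < n) (ln (lnn k.+1) - ln (lnn k)).
    by rewrite telescope_sumr.
  rewrite -sumrB; apply: (le_trans (ler_norm_sum _ _ _)).
  apply: (@le_trans _ _ (\sum_(2 <= k < n) L ^+ 2 * k%:R `^ (- (1 + 1)))).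
    rewrite big_nat [leRHS]big_nat; apply: ler_sum => k /andP[k2 _].
    exact: lnln_step.
  rewrite -mulr_sumr ler_piMr ?sqr_ge0//.
  by apply: (le_trans (@powRN_tail R 1 1 n ltr01 isT)); rewrite powR1 invr1 mulr1.
rewrite -/(lnn n) -[ln 2]/(lnn 2).
move: t1 t2 t3; set X := _ / _; set Y := \sum_(_ <= _ < _) _; set Z := \sum_(_ <= _ < _) _.
have := ler_norm (ln (lnn 2)); have := ler_norm (- ln (lnn 2)); rewrite normrN => q1 q2.
rewrite !ler_norml => /andP[? ?] /andP[? ?] /andP[? ?].
by apply/andP; split; lra.
Qed.

Lemma mertens : exists C : R, forall t : R, 2 <= t ->
  `|recip_sum (Num.truncn t) - ln (ln t)| <= C.
Proof.
have [C hC] := mertens_nat.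
exists (C + (ln 2)^-1) => t t2; set n := Num.truncn t.
have t0 : 0 <= t by lra.
have n2 : (2 <= n)%N by rewrite /n truncn_ge_nat.
have nt : n%:R <= t by rewrite truncn_le.
have tn : t < n.+1%:R by exact: truncnS_gt.
have l0 := lnn_gt0 n2.
have n0 : 0 < n%:R :> R by rewrite ltr0n; lia.
have l1 : lnn n <= ln t by rewrite ler_ln ?posrE//; lra.
have l2 : ln t <= lnn n.+1 by rewrite ler_ln ?posrE ?(ltW tn)//; lra.
have lS : lnn n.+1 - lnn n <= 1.
  apply: (le_trans (lnnS _)); first by lia.
  by rewrite invf_le1// ler1n; lia.
have q1 : ln (lnn n) <= ln (ln t) by rewrite ler_ln ?posrE//; lra.
have q2 : ln (ln t) - ln (lnn n) <= (ln 2)^-1.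
  rewrite -ln_div ?posrE//; last by lra.
  have -> : ln t / lnn n = 1 + (ln t - lnn n) / lnn n by field; rewrite gt_eqF.
  apply: (@le_trans _ _ ((ln t - lnn n) / lnn n)).
    by apply: le_ln1Dx; apply: (lt_le_trans (ltrN10 R)); rewrite divr_ge0// ?(ltW l0)// subr_ge0.
  rewrite -[leRHS]mul1r; apply: ler_pM; rewrite ?invr_ge0 ?(ltW l0)// ?subr_ge0//; first by lra.
  by rewrite lef_pV2 ?posrE ?ln2_gt0// ler_ln ?posrE ?ler_nat.
have := hC n n2; rewrite -/(lnn n) !ler_norml => /andP[? ?].
by apply/andP; split; lra.
Qed.

End Mertens.

(** * Prime divisors along a progression *)

(** Solving [d * a = -1] modulo [q] turns the condition into [q %| m + b] with [b = q - a], so one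
    counts multiples of [q] in [(b, X + b]]. *)
Lemma card_dvd_progression (q d X : nat) : (0 < q)%N -> coprime q d ->
  exists2 b, (0 < b <= q)%N &
  ((\sum_(1 <= m < X.+1) (q %| d * m + 1)) = (X + b) %/ q - b %/ q)%N.
Proof.
move=> q0 qd; have [a aq ha] := Bezoutl d q0; rewrite (eqP qd) in ha.
exists (q - a)%N; first by lia.
set b := (q - a)%N; have b0 : (0 < b)%N by rewrite /b; lia.
have e m : (q %| d * m + 1)%N = (q %| m + b)%N.
  rewrite -[RHS](@Gauss_dvdr q d (m + b)%N qd).
  have -> : (q %| d * m + 1)%N = (q %| d * m + 1 + d * q)%N.
    by rewrite [RHS]dvdn_addl// dvdn_mull.
  have -> : (d * m + 1 + d * q = d * (m + b) + (1 + a * d))%N.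
    rewrite -[q in LHS](subnK (ltnW aq)) -/b; lia.
  by rewrite dvdn_addl.
under eq_bigr do rewrite e.
rewrite !divn_count_dvd.
have -> : (\sum_(1 <= i < (X + b).+1) (q %| i) =
    \sum_(1 <= i < b.+1) (q %| i) + \sum_(b.+1 <= i < (X + b).+1) (q %| i))%N.
  by rewrite -big_cat_nat//; lia.
rewrite addKn -[b.+1 in RHS]add1n -[(X + b).+1 in RHS]addSn big_addn addnK.
by rewrite !big_add1.
Qed.

Section Progression.
Variable R : realType.
Implicit Types (t : R).

Lemma progression_density (q d X : nat) : (0 < q)%N -> coprime q d ->
  `|(\sum_(1 <= m < X.+1) (q %| d * m + 1))%N%:R - X%:R / q%:R| <= 1 :> R.
Proof.
move=> q0 qd; have [b /andP[b0 bq] ->] := card_dvd_progression X q0 qd.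
have q0' : 0 < q%:R :> R by rewrite ltr0n.
have hdiv (n : nat) : (n %/ q)%:R = n%:R / q%:R - (n %% q)%:R / q%:R :> R.
  rewrite {2}(divn_eq n q) natrD natrM mulrDl mulfK ?gt_eqF//; ring.
have hm (n : nat) : 0 <= (n %% q)%:R / q%:R :> R by rewrite divr_ge0.
have hm1 (n : nat) : (n %% q)%:R / q%:R <= 1 :> R.
  by rewrite ler_pdivrMr// mul1r ler_nat ltnW// ltn_mod.
rewrite natrB; last by rewrite leq_div2r// leq_addl.
rewrite !hdiv natrD mulrDl ler_norml.
have := hm (X + b)%N; have := hm b; have := hm1 (X + b)%N; have := hm1 b.
by move=> *; apply/andP; split; lra.
Qed.

Variables (d M : nat).

Definition valid (p : nat) : bool := prime p && ~~ (p %| d)%N.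
(** Weight 0 matches the fact that composites and primes dividing [d] never belong to [pdset]; the
    index set can then be all of ['I_M] for every [d]. *)
Definition pw (i : 'I_M) : R := if valid i then (i : nat)%:R^-1 else 0.
Definition ordkey (i : 'I_M) : R := (i : nat)%:R.
Definition pdset (m : nat) : {set 'I_M} := [set i : 'I_M | prime i && (i %| d * m + 1)%N].

Lemma pw01 i : 0 <= pw i <= 1.
Proof.
rewrite /pw; case: ifP => [/andP[/prime_gt0 p0 _]|_]; last by rewrite lexx ler01.
by rewrite invr_ge0 ler0n /= invf_le1 ?ltr0n// ler1n.
Qed.

Lemma pw_key i : 0 < ordkey i -> pw i <= (ordkey i)^-1.
Proof. by move=> k0; rewrite /pw; case: ifP => // _; rewrite invr_ge0 ltW. Qed.

Lemma pairwise_ordkey : pairwise (fun i j => ordkey i <= ordkey j) (enum 'I_M).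
Proof.
have h : pairwise (fun i j : nat => (i <= j)%N) (map val (enum 'I_M)).
  rewrite val_enum_ord -sorted_pairwise; last exact: leq_trans.
  exact: iota_sorted.
by move: h; rewrite pairwise_map; apply: sub_pairwise => i j /=; rewrite ler_nat.
Qed.

Lemma pdset_valid m i : i \in pdset m -> valid i.
Proof.
rewrite inE /valid => /andP[pi dv]; rewrite pi /=; apply/negP => id.
move: dv; rewrite dvdn_addr; last by rewrite dvdn_mulr.
by rewrite Euclid_dvd1.
Qed.

Definition prog_mu (X : nat) (D : {set 'I_M}) : R :=
  (\sum_(1 <= m < X.+1) (pdset m == D)%:R) / X%:R.

Lemma sum_prog_mu (X : nat) (F : {set 'I_M} -> R) :
  \sum_D prog_mu X D * F D = (\sum_(1 <= m < X.+1) F (pdset m)) / X%:R.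
Proof.
rewrite /prog_mu.
under eq_bigr do rewrite mulrAC mulr_suml.
rewrite -mulr_suml exchange_big /=; congr (_ / _); apply: eq_bigr => m _.
rewrite (bigD1 (pdset m))//= eqxx mul1r big1 ?addr0// => D /negbTE.
by rewrite eq_sym => ->; rewrite mul0r.
Qed.

Lemma moment_prog_mu (X : nat) (C : {set 'I_M}) :
  moment (prog_mu X) C = (\sum_(1 <= m < X.+1) (C \subset pdset m)%:R) / X%:R.
Proof.
rewrite -(sum_prog_mu X (fun D => (C \subset D)%:R)) /moment big_mkcond /=.
by apply: eq_bigr => D _; case: ifP; rewrite ?mulr1 ?mulr0.
Qed.

Lemma dvdn_prod_primes (C : {set 'I_M}) (n : nat) :
  (forall i, i \in C -> prime i) ->
  (\prod_(i in C) (i : nat) %| n)%N = [forall i in C, (i %| n)%N].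
Proof.
move=> hC; rewrite -(big_enum _ _ C (fun i : 'I_M => (i : nat)))/=.
have : {subset enum C <= C} by move=> i; rewrite mem_enum.
have -> : [forall i in C, (i %| n)%N] = all (fun i : 'I_M => (i %| n)%N) (enum C).
  apply/forall_inP/allP => h i; first by rewrite mem_enum => /h.
  by move=> iC; apply: h; rewrite mem_enum.
have := enum_uniq C; elim: (enum C) => [|i s IH] /=.
  by rewrite big_nil dvd1n.
move=> /andP[si us] sC; rewrite big_cons Gauss_dvd.
  by rewrite IH// => j js; apply: sC; rewrite inE js orbT.
have pi : prime i by apply: hC; apply: sC; rewrite inE eqxx.
rewrite prime_coprime// Euclid_dvd_prod// big_has; apply/hasPn => j js.
rewrite dvdn_prime2//; last by apply: hC; apply: sC; rewrite inE js orbT.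
by apply: contra si => /eqP/val_inj ->.
Qed.

(** If [C] contains an index that is not [valid], both moments are 0. Otherwise the product [q] of
    [C] is coprime to [d], and [q %| d * m + 1] selects one residue class, whose count differs from
    [X / q] by at most 1. *)
Lemma moment_prog_bern (X : nat) (C : {set 'I_M}) : (0 < X)%N ->
  `|moment (prog_mu X) C - moment (bern pw) C| <= X%:R^-1.
Proof.
move=> X0; have X0' : 0 < X%:R :> R by rewrite ltr0n.
rewrite moment_bern moment_prog_mu.
have [hC|] := boolP [forall i in C, valid i]; last first.
  rewrite negb_forall_in => /exists_inP[i iC niv].
  rewrite (bigD1 i)//= {1}/pw (negbTE niv) mul0r subr0.
  rewrite big1 ?mul0r ?normr0 ?invr_ge0 ?(ltW X0')// => m _.
  case: (boolP (C \subset pdset m)) => // /fintype.subsetP/(_ i iC)/pdset_valid.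
  by rewrite (negbTE niv).
have {}hC i : i \in C -> valid i by move/forall_inP : hC; apply.
set q := (\prod_(i in C) (i : nat))%N.
have q0 : (0 < q)%N.
  by rewrite prodn_cond_gt0// => i /hC/andP[/prime_gt0].
have qd : coprime q d.
  rewrite /q; apply: (big_ind (fun k => coprime k d)) => [|a b ca cb|i /hC/andP[pi nd]].
  - exact: coprime1n.
  - by rewrite coprimeMl ca.
  - by rewrite prime_coprime.
have -> : \prod_(i in C) pw i = q%:R^-1.
  rewrite /q natr_prod -prodfV; apply: eq_bigr => i /hC vi.
  by rewrite /pw vi.
have -> : \sum_(1 <= m < X.+1) (C \subset pdset m)%:R =
    (\sum_(1 <= m < X.+1) (q %| d * m + 1))%N%:R :> R.
  rewrite natr_sum; apply: eq_bigr => m _; congr (nat_of_bool _)%:R.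
  rewrite dvdn_prod_primes; last by move=> i /hC/andP[].
  apply/fintype.subsetP/forall_inP => h i iC; first by have := h i iC; rewrite inE => /andP[].
  by rewrite inE h// andbT; case/andP: (hC i iC).
have := progression_density X q0 qd; set c := _%:R => h.
have -> : c / X%:R - q%:R^-1 = (c - X%:R / q%:R) * X%:R^-1.
  by field; rewrite !pnatr_eq0 -!lt0n q0 X0.
by rewrite normrM [`|X%:R^-1|]ger0_norm ?invr_ge0 ?(ltW X0')// ler_piMl// invr_ge0 ltW.
Qed.

(** Rankin's trick with [z = 9] against the [3 ^ K] of [moment_transfer] leaves [3 ^ (- K)], once
    for each of the two laws. The second term collects the errors [1 / X] of at most [M ^ K] moments
    of order [K] and of the truncated expansion. *)
Definition transfer_err (X K : nat) : R :=
  4 * (expR (9 * \sum_i pw i) / 3 ^+ K) + 3 * ((3 * M%:R) ^+ K) / X%:R.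

Lemma progression_transfer (X K : nat) (P : seq 'I_M -> Prop) :
  (0 < X)%N -> (0 < M)%N ->
  \sum_(1 <= m < X.+1) `[< P (enum (pdset m)) >]%:R <=
    X%:R * (Pmod pw (enum 'I_M) P + transfer_err X K).
Proof.
move=> X0 M0; have X0' : 0 < X%:R :> R by rewrite ltr0n.
have M1 : 1 <= M%:R :> R by rewrite ler1n.
pose F (D : {set 'I_M}) : R := `[< P (enum D) >]%:R.
have := @moment_transfer R 'I_M (prog_mu X) (bern pw) F K X%:R^-1.
rewrite sum_prog_mu (Emod_bern pw (fun s => `[< P s >]%:R)).
rewrite -/(Pmod _ _ _) card_ord.
set Sm := \sum_(1 <= m < X.+1) _.
have S2 : \sum_(C : {set 'I_M} | #|C| == K) moment (bern pw) C <=
    expR (9 * \sum_i pw i) / 9 ^+ K.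
  under eq_bigr do rewrite moment_bern.
  by apply: sum_prod_card_le => // i; case/andP: (pw01 i).
have S1 : \sum_(C : {set 'I_M} | #|C| == K) moment (prog_mu X) C <=
    expR (9 * \sum_i pw i) / 9 ^+ K + M%:R ^+ K / X%:R.
  apply: (@le_trans _ _ (\sum_(C : {set 'I_M} | #|C| == K) (moment (bern pw) C + X%:R^-1))).
    apply: ler_sum => C _; have := moment_prog_bern C X0.
    by rewrite ler_norml => /andP[_]; lra.
  rewrite big_split /= lerD// sumr_const -[leLHS]mulr_natl.
  rewrite ler_wpM2r ?invr_ge0 ?ler0n// -natrX ler_nat.
  rewrite (leq_trans _ (bin_le_expn _ _))// -[X in 'C(X, K)]card_ord -card_draws.
  by rewrite subset_leq_card//; apply/fintype.subsetP => C; rewrite !inE.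
move=> /(_ _ _ _ _ _) h.
have : `|Sm / X%:R - Pmod pw (enum 'I_M) P| <= transfer_err X K.
  apply: (le_trans (h _ _ _ _ _)).
  - by move=> D; rewrite divr_ge0// sumr_ge0.
  - by move=> D; apply: bern_ge0; exact: pw01.
  - by move=> D; rewrite /F; case: asboolP => _; rewrite ?normr1 ?normr0.
  - by rewrite invr_ge0 ltW.
  - by move=> C _; exact: moment_prog_bern.
  have p3 : 0 <= 2 * 3 ^+ K :> R by rewrite mulr_ge0// exprn_ge0.
  apply: (le_trans (lerD (ler_wpM2l p3 (lerD S1 S2)) (lexx _))).
  set E := expR _; rewrite /transfer_err -/E.
  have -> : (9 : R) ^+ K = 3 ^+ K * 3 ^+ K by rewrite -exprMn; congr (_ ^+ _); ring.
  have h2 : (1 + 2 * M%:R) ^+ K <= (3 * M%:R : R) ^+ K.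
    by apply: lerXn2r; rewrite ?nnegrE; lra.
  have h3 : X%:R^-1 * (1 + 2 * M%:R) ^+ K <= X%:R^-1 * (3 * M%:R) ^+ K :> R.
    by rewrite ler_wpM2l// invr_ge0 ltW.
  apply: (le_trans (lerD (lexx _) h3)).
  have e3 : 3 ^+ K != 0 :> R by rewrite expf_neq0.
  rewrite le_eqVlt; apply/orP; left; apply/eqP; rewrite exprMn; field.
  by rewrite e3 gt_eqF.
rewrite ler_norml => /andP[_ h1].
have : Sm / X%:R <= Pmod pw (enum 'I_M) P + transfer_err X K by lra.
by rewrite ler_pdivrMr// mulrC.
Qed.

Lemma omega_count (n : nat) t : (0 < n)%N -> t < M%:R ->
  omega n t = count (fun p => prime p && (p %| n)%N && (p%:R <= t)) (iota 0 M).
Proof.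
move=> n0 tM; rewrite /omega -size_filter; apply: perm_size; apply: uniq_perm.
- by rewrite filter_uniq// primes_uniq.
- by rewrite filter_uniq// iota_uniq.
move=> p; rewrite !mem_filter mem_primes mem_iota n0 /= add0n.
have [pt|] := boolP (p%:R <= t); last by rewrite andbF.
by rewrite andbT -[(p < M)%N](ltr_nat R) (le_lt_trans pt tM) andbT.
Qed.

Lemma cnt_omega (m : nat) t : t < M%:R ->
  cnt ordkey (enum (pdset m)) t = omega (d * m + 1) t.
Proof.
move=> tM; rewrite (omega_count _ tM) ?addn1// -val_enum_ord count_map /cnt.
rewrite enum_setE count_filter.
by apply: eq_count => i /=; rewrite inE andbC addn1.
Qed.

End Progression.

(** * Choice of parameters and large prime factors *)

Section Ranges.
Variable R : realType.
Implicit Types (s t : R).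

Lemma ler_lilsc (u v : R) : 0 < u -> 1 <= ln u -> u <= v -> lilsc u <= lilsc v.
Proof.
move=> u0 lu uv; have v0 : 0 < v by exact: lt_le_trans uv.
have luv : ln u <= ln v by rewrite ler_ln ?posrE.
have lv0 : 0 < ln v by lra.
have lu0 : 0 < ln u by lra.
rewrite ler_wsqrtr// ler_pM// ?ln_ge0//; first by rewrite mulr_ge0// ltW.
  by rewrite ler_wpM2l.
by rewrite ler_ln ?posrE.
Qed.

Lemma ler_npoly_exp s : 72 <= s -> 3 * s ^+ 2 <= expR s / 4.
Proof.
move=> hs; have s0 : 0 <= s by lra.
have h := expR_ge1Dxn 2 s0.
have e6 : (3`!%:R : R) = 6 by rewrite !factS fact0.
rewrite e6 in h.
have : 72 * s ^+ 2 <= s ^+ 3 by rewrite [leRHS]exprS ler_wpM2r// sqr_ge0.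
lra.
Qed.

(* With [x = exp (exp s)] this is [exp (ln x / (log_2 x) ^ 3)]: products of
   [(log_2 x) ^ 2] primes below it are far smaller than [x ^ (1/4)], while
   [log_2] of it is only [3 * log_3 x] below [log_2 x]. *)
Definition range_end s : R := expR (expR s / s ^+ 3).

Lemma lnln_range_end s : 0 < s -> ln (ln (range_end s)) = s - 3 * ln s.
Proof.
move=> s0; rewrite expRK ln_div ?posrE ?expR_gt0 ?exprn_gt0// expRK lnXn//.
by rewrite mulr_natl.
Qed.

(** [s] is log_2 x. With [K] near [s ^+ 2], [3 ^ K] beats [expR (9 * L)], while [m ^ K] is only
    about [expR (expR s / s)] and [X] is at least [expR (expR s / 2) / 2]. The two terms are at most
    [4 * expR (- s)] and [6 * expR (- s)], whence [10 / eta]. *)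
Lemma err_small (C eta : R) : 0 < eta ->
  exists s1 : R, forall s, s1 <= s -> exists K : nat, forall L m X : R,
    L <= s + C -> 0 <= m <= 2 * range_end s -> 0 < X -> expR (expR s) <= 4 * X ^+ 2 ->
    4 * (expR (9 * L) / 3 ^+ K) + 3 * ((3 * m) ^+ K) / X <= eta.
Proof.
move=> eta0; exists (Num.max 72 (Num.max (11 + 9 * C) (10 / eta))) => s.
rewrite !ge_max => /and3P[s72 sC seta].
have s0 : 0 < s by lra.
have s20 : 0 <= s ^+ 2 by exact: sqr_ge0.
exists (Num.truncn (s ^+ 2)) => L m X LC /andP[m0 mY] X0 xX.
set K := Num.truncn _.
have K1 : K%:R <= s ^+ 2 by rewrite truncn_le.
have K2 : s ^+ 2 < K%:R + 1 by rewrite natr1; exact: truncnS_gt.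
have ss : 72 * s <= s ^+ 2 by rewrite expr2 ler_wpM2r// ltW.
have e3 : expR 1 <= 3 :> R.
  by have := @expR_le_cubic R 1; rewrite !expr1n lexx ler01 => /(_ isT); lra.
have ems : expR (- s) <= s^-1.
  by rewrite expRN lef_pV2 ?posrE ?expR_gt0//; have := expR_ge1Dx s; lra.
have h1 : expR (9 * L) / 3 ^+ K <= expR (- s).
  rewrite ler_pdivrMr ?exprn_gt0//.
  apply: (@le_trans _ _ (expR (- s) * expR 1 ^+ K)).
    rewrite -expRM_natl mulr1 -expRD ler_expR.
    have : (11 + 9 * C) * s <= s * s by rewrite ler_wpM2r// ltW.
    have : 9 * C <= 9 * C * s \/ C < 0.
      by have [C0|C0] := leP 0 C; [left; rewrite ler_peMr ?mulr_ge0//; lra|right].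
    rewrite -expr2; case=> ?; lra.
  by rewrite ler_wpM2l ?expR_ge0// lerXn2r ?nnegrE ?expR_ge0.
have h2 : 3 * ((3 * m) ^+ K) / X <= 6 * expR (- s).
  have X2 : expR (expR s / 2) <= 2 * X.
    rewrite -(@ler_pXn2r _ 2) ?nnegrE ?expR_ge0//; last by rewrite mulr_ge0// ltW.
    rewrite -expRM_natl exprMn; apply: le_trans (le_trans xX _); last by lra.
    by rewrite ler_expR; lra.
  have s3 : 0 < s ^+ 3 by rewrite exprn_gt0.
  have m3 : 3 * m <= expR (2 + expR s / s ^+ 3).
    rewrite expRD; have e2 : 6 <= expR 2 :> R.
      rewrite -[X in expR X]mulr1 expRM_natl.
      have := @expR_ge_quad0 R 1 ler01; rewrite expr1n => h.
      have : (5 / 2) ^+ 2 <= expR 1 ^+ 2 :> R.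
        by rewrite lerXn2r ?nnegrE ?expR_ge0//; lra.
      by lra.
    have : 6 * range_end s <= expR 2 * range_end s by rewrite ler_wpM2r ?expR_ge0.
    rewrite -/(range_end s); lra.
  have m3K : (3 * m) ^+ K <= expR (2 * s ^+ 2 + expR s / 4).
    apply: (@le_trans _ _ (expR (2 + expR s / s ^+ 3) ^+ K)).
      by apply: lerXn2r; rewrite ?nnegrE ?expR_ge0 ?mulr_ge0.
    rewrite -expRM_natl ler_expR.
    apply: (@le_trans _ _ (s ^+ 2 * (2 + expR s / s ^+ 3))).
      by rewrite ler_wpM2r// addr_ge0// divr_ge0 ?expR_ge0 ?(ltW s3).
    have -> : s ^+ 2 * (2 + expR s / s ^+ 3) = 2 * s ^+ 2 + expR s * s^-1.
      by field; rewrite gt_eqF.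
    rewrite lerD2l ler_wpM2l ?expR_ge0// lef_pV2 ?posrE//; lra.
  rewrite ler_pdivrMr//.
  have := ler_npoly_exp s72 => np.
  have : expR (2 * s ^+ 2 + expR s / 4) <= expR (- s) * expR (expR s / 2).
    by rewrite -expRD ler_expR; lra.
  have : expR (- s) * expR (expR s / 2) <= expR (- s) * (2 * X).
    by rewrite ler_wpM2l ?expR_ge0.
  lra.
have : 10 * s^-1 <= eta.
  by rewrite ler_pdivrMr// mulrC -ler_pdivrMr.
lra.
Qed.

(** [s - 3 * ln s] is log_2 of [range_end s], and [eps / 16 * Num.sqrt s] is the number of primes
    tolerated between that point and x^(1/4). The fourth bound feeds Markov's inequality; in the
    last one, 3 counts the primes beyond x^(1/4) and [3 * ln s] is the growth of log_2 t. The
    logarithms are absorbed through [ln s <= 4 * s ^ (1/4)]. *)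
Lemma tail_params (eps eta C : R) : 0 < eps -> 0 < eta -> 0 <= C ->
  exists s1 : R, forall s, s1 <= s ->
    [/\ 1 <= s, s / 2 <= s - 3 * ln s, 1 <= ln (s - 3 * ln s),
      3 * ln s + 2 * C + 2 <= eta * (eps / 16 * Num.sqrt s) &
      eps / 16 * Num.sqrt s + 3 + 3 * ln s <= eps / 2 * lilsc (s - 3 * ln s)].
Proof.
move=> eps0 eta0 C0.
pose w0 := Num.max 3 (Num.max (40 / eps) (Num.max (16 * (14 + 2 * C) / (eta * eps))
   (2 * expR (expR 1)))).
have w03 : 3 <= w0 by rewrite le_max lexx.
exists (w0 ^+ 4) => s hs.
have w04 : w0 <= w0 ^+ 4 by rewrite -[leLHS]expr1 ler_weXn2l//; lra.
have s3 : 3 <= s by lra.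
have s0 : 0 < s by lra.
pose v := Num.sqrt s; pose w := Num.sqrt v.
have v0 : 0 < v by rewrite sqrtr_gt0.
have w0' : 0 < w by rewrite sqrtr_gt0.
have vE : v ^+ 2 = s by rewrite sqr_sqrtr// ltW.
have wE : w ^+ 2 = v by rewrite sqr_sqrtr// ltW.
have ww : w0 <= w.
  rewrite -(@ler_pXn2r _ 4) ?nnegrE ?(ltW w0')//; last by lra.
  by rewrite (_ : 4 = 2 * 2)%N// exprM (exprM w) wE vE -exprM.
move: ww; rewrite !ge_max => /and4P[w3 wa wb wc].
have lsw : ln s <= 4 * w.
  have -> : ln s = 4 * ln w.
    by rewrite -vE -wE -exprM lnXn// mulr_natl.
  by rewrite ler_wpM2l// ltW// ln_sublinear.
have w2 : 3 * w <= v by rewrite -wE expr2 ler_wpM2r// ltW.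
have sw : 9 * v <= s.
  rewrite -vE expr2 ler_wpM2r ?(ltW v0)//; lra.
have q1 : s / 2 <= s - 3 * ln s.
  suff : 24 * w <= s by lra.
  lra.
have ees : expR (expR 1) <= s / 2 by lra.
have se : expR (expR 1) <= s - 3 * ln s by lra.
have se0 : 0 < s - 3 * ln s by apply: lt_le_trans se; exact: expR_gt0.
have l1 : expR 1 <= ln (s - 3 * ln s).
  by rewrite -[leLHS](expRK (R := R)) ler_ln ?posrE ?expR_gt0.
have l1' : 1 <= expR 1 :> R by have := expR_ge1Dx (1 : R); lra.
have l0 : 0 < ln (s - 3 * ln s) by lra.
have ll1 : 1 <= ln (ln (s - 3 * ln s)).
  by rewrite -[leLHS](expRK (R := R)) ler_ln ?posrE ?expR_gt0.
have hl : v <= lilsc (s - 3 * ln s).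
  rewrite ler_wsqrtr//; apply: (@le_trans _ _ (2 * (s - 3 * ln s))); first by lra.
  by rewrite ler_peMr// mulr_ge0// ltW.
split => //.
- by lra.
- by lra.
- rewrite -/v -wE.
  have : 16 * (14 + 2 * C) <= w * (eta * eps) by rewrite -ler_pdivrMr// mulr_gt0.
  move=> hw.
  have : 16 * (14 + 2 * C) * w <= w * (eta * eps) * w by rewrite ler_wpM2r// ltW.
  have -> : eta * (eps / 16 * w ^+ 2) = w * (eta * eps) * w / 16 by field.
  have : C <= C * w by rewrite ler_peMr//; lra.
  lra.
- have : eps / 2 * v <= eps / 2 * lilsc (s - 3 * ln s) by rewrite ler_wpM2l// divr_ge0// ltW.
  rewrite -/v.
  have : 40 <= w * eps by rewrite -ler_pdivrMr.
  move=> hw; have : 40 * w <= w * eps * w by rewrite ler_wpM2r// ltW.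
  have -> : w * eps * w = eps * v by rewrite -wE; ring.
  lra.
Qed.

Lemma omega_mono (n : nat) t t' : t <= t' -> (omega n t <= omega n t')%N.
Proof.
move=> tt'; rewrite /omega !size_filter; apply: sub_count => p /= pt.
exact: le_trans tt'.
Qed.

Lemma omega_split (n : nat) t z : t <= z ->
  (omega n z = omega n t + count (fun p => t < p%:R <= z)%R (primes n))%N.
Proof.
move=> tz; rewrite /omega !size_filter; elim: (primes n) => //= p l ->.
have [h|h] := leP (p%:R : R) t; last by lia.
by rewrite (le_trans h tz) /=; lia.
Qed.

Lemma prod_sub_primes (n : nat) (a : pred nat) : (0 < n)%N ->
  (\prod_(p <- seq.filter a (primes n)) p %| n)%N.
Proof.
move=> n0.
have : {subset seq.filter a (primes n) <= primes n} by move=> p; rewrite mem_filter => /andP[].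
have : uniq (seq.filter a (primes n)) by rewrite filter_uniq// primes_uniq.
elim: (seq.filter a _) => [|p l IH] /=; first by rewrite big_nil dvd1n.
move=> /andP[pl ul] sl; rewrite big_cons.
have := sl p (mem_head _ _); rewrite mem_primes => /and3P[pp _ pn].
rewrite Gauss_dvd ?pn /=; first by apply: IH => // q ql; apply: sl; rewrite inE ql orbT.
rewrite prime_coprime// Euclid_dvd_prod// big_has; apply/hasPn => q ql.
have := sl q; rewrite inE ql orbT mem_primes => /(_ isT) /and3P[qq _ _].
by rewrite dvdn_prime2//; apply: contra pl => /eqP ->.
Qed.

(** Otherwise the product of [k + 1] distinct prime factors above [z] would exceed [n]. *)
Lemma count_large_primes (n : nat) (z : R) (k : nat) : (0 < n)%N -> 1 <= z ->
  n%:R <= z ^+ k.+1 -> (count (fun p => z < p%:R)%R (primes n) <= k)%N.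
Proof.
move=> n0 z1 nz; rewrite leqNgt; apply/negP => hk.
have hdvd := dvdn_leq n0 (prod_sub_primes (fun p => (z < p%:R)%R) n0).
have hz : z ^+ k.+1 < (\prod_(p <- seq.filter (fun p => (z < p%:R)%R) (primes n)) p)%:R.
  move: hk; rewrite -size_filter natr_prod.
  have : all (fun p => (z < p%:R)%R) (seq.filter (fun p => (z < p%:R)%R) (primes n)).
    exact: filter_all.
  elim: k {nz} (seq.filter _ _) => [|k IH] [|p l]//=.
    move=> /andP[zp zl] _; rewrite big_cons expr1.
    apply: (lt_le_trans zp); rewrite ler_peMr//.
    elim: l zl => [|q l IH] /=; first by rewrite big_nil.
    by move=> /andP[zq zl]; rewrite big_cons mulr_ege1 ?IH//; lra.
  move=> /andP[zp zl] hl; rewrite big_cons exprS ltr_pM ?exprn_ge0//; [lra|lra|].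
  by apply: IH.
have : z ^+ k.+1 < z ^+ k.+1 by apply: lt_le_trans hz (le_trans _ nz); rewrite ler_nat.
by rewrite ltxx.
Qed.

End Ranges.

(** * Uniformity in the modulus *)

Section PerModulus.
Variable R : realType.
Implicit Types (t eps eta W : R) (d X : nat).

(** Bounds the mass that the model loses to the primes dividing [d]. *)
Definition wdiv d : R := \sum_(p <- primes d) p%:R^-1.

Lemma sum_iota_primes (d N : nat) (a : pred nat) (g : nat -> R) : (0 < d)%N ->
  (forall p, a p -> (p < N)%N) ->
  \sum_(0 <= p < N | prime p && (p %| d)%N && a p) g p = \sum_(p <- primes d | a p) g p.
Proof.
move=> d0 aN; rewrite -big_filter -[RHS]big_filter; apply: perm_big; apply: uniq_perm.
- by rewrite filter_uniq// iota_uniq.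
- by rewrite filter_uniq// primes_uniq.
move=> p; rewrite !mem_filter mem_primes mem_index_iota d0 /=.
have [ap|] := boolP (a p); last by rewrite andbF.
by rewrite (aN p ap) !andbT.
Qed.

Lemma wdiv_ge0 d : 0 <= wdiv d.
Proof. by rewrite sumr_ge0// => p _; rewrite invr_ge0. Qed.

Lemma mass_bounds d M t : (0 < d)%N -> 0 <= t -> t < M%:R ->
  recip_sum R (Num.truncn t) - wdiv d <= mass (pw R d (M := M)) (ordkey R (M := M)) (enum 'I_M) t
    <= recip_sum R (Num.truncn t).
Proof.
move=> d0 t0 tM; set n := Num.truncn t.
have nM : (n.+1 <= M)%N.
  by rewrite -(ltr_nat R); apply: le_lt_trans tM; rewrite truncn_le.
have nt (p : nat) : (p%:R <= t) = (p < n.+1)%N by rewrite ltnS /n truncn_ge_nat.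
have -> : mass (pw R d (M := M)) (ordkey R (M := M)) (enum 'I_M) t =
    \sum_(0 <= p < n.+1 | prime p && ~~ (p %| d)%N) p%:R^-1.
  rewrite /mass big_enum_cond /= (big_nat_widen _ _ M)//= big_mkord.
  rewrite big_mkcond [RHS]big_mkcond /=; apply: eq_bigr => i _.
  rewrite /ordkey nt /pw /valid.
  by case: (prime i && _); case: (_ < n.+1)%N.
have -> : recip_sum R n = \sum_(0 <= p < n.+1 | prime p && ~~ (p %| d)%N) p%:R^-1 +
    \sum_(p <- primes d | (p < n.+1)%N) p%:R^-1.
  rewrite -(@sum_iota_primes d n.+1 (fun p => (p < n.+1)%N))// /recip_sum.
  rewrite (bigID (fun p => (p %| d)%N)) /= addrC; congr (_ + _).
  rewrite big_nat_cond [RHS]big_nat_cond; apply: eq_bigl => p.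
  by case: (0 <= p < n.+1)%N / andP => [[_ ->]|] //=; rewrite andbT.
set A := \sum_(0 <= _ < _ | _) _; set Q := \sum_(_ <- _ | _) _.
have Q0 : 0 <= Q by rewrite sumr_ge0// => p _; rewrite invr_ge0.
have QW : Q <= wdiv d.
  rewrite /Q /wdiv [leRHS](bigID (fun p => (p < n.+1)%N)) /= lerDl sumr_ge0// => p _.
by apply/andP; split; lra.
Qed.

Lemma count_primes_sum (n N : nat) (a : pred nat) : (0 < n)%N ->
  (forall p, a p -> (p < N)%N) ->
  (count a (primes n))%:R = \sum_(0 <= p < N | prime p && a p) (p %| n)%N%:R :> R.
Proof.
move=> n0 aN; rewrite -sum1_count natr_sum -(sum_iota_primes (fun=> 1%:R) n0 aN).
rewrite big_mkcond [RHS]big_mkcond; apply: eq_bigr => p _.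
by case: (prime p); case: (p %| n)%N; case: (a p).
Qed.

(** A prime dividing [d] never occurs, and any other divides at most [X / p + 1] of the terms; the
    extra ones sum to at most [z]. *)
Lemma mid_primes_sum d X (y z : R) : (0 < d)%N -> 0 <= y <= z ->
  \sum_(1 <= m < X.+1) (count (fun p => y < p%:R <= z)%R (primes (d * m + 1)))%:R <=
  X%:R * (recip_sum R (Num.truncn z) - recip_sum R (Num.truncn y)) + z.
Proof.
move=> d0 /andP[y0 yz]; have z0 : 0 <= z by exact: le_trans yz.
set N := (Num.truncn z).+1; set Ny := (Num.truncn y).+1.
have NyN : (Ny <= N)%N by rewrite ltnS le_truncn.
have az (p : nat) : (y < p%:R <= z)%R -> (p < N)%N.
  by move=> /andP[_ pz]; rewrite ltnS truncn_ge_nat.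
have ay (p : nat) : (y < p%:R)%R = (Ny <= p)%N.
  by rewrite ltNge -truncn_ge_nat// -ltnNge.
under eq_bigr do rewrite (@count_primes_sum _ N _ _ az) ?addn1//.
rewrite exchange_big /=.
apply: (@le_trans _ _ (\sum_(0 <= p < N | prime p && (y < p%:R <= z)) (X%:R * p%:R^-1 + 1))).
  apply: ler_sum => p /andP[pp _].
  have [pd|npd] := boolP (p %| d)%N.
    rewrite big1 => [|m _]; first by rewrite addr_ge0// mulr_ge0// invr_ge0.
    by rewrite -addn1 dvdn_addr ?dvdn_mulr// Euclid_dvd1.
  have cop : coprime p d by rewrite prime_coprime.
  have := progression_density R X (prime_gt0 pp) cop.
  rewrite ler_norml natr_sum => /andP[_ h].
  have -> : \sum_(1 <= i < X.+1) (p %| (d * i).+1)%N%:R =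
      \sum_(1 <= i < X.+1) (p %| d * i + 1)%N%:R :> R.
    by apply: eq_bigr => m _; rewrite addn1.
  lra.
rewrite big_split /= -mulr_sumr.
have -> : \sum_(0 <= p < N | prime p && (y < p%:R <= z)) p%:R^-1 =
    recip_sum R (Num.truncn z) - recip_sum R (Num.truncn y).
  have -> : recip_sum R (Num.truncn z) = recip_sum R (Num.truncn y) +
      \sum_(Ny <= p < N | prime p) p%:R^-1 by rewrite /recip_sum -big_cat_nat.
  rewrite addrAC subrr add0r.
  rewrite [RHS](@big_nat_widenl _ _ _ Ny 0)//= big_nat_cond [RHS]big_nat_cond.
  apply: eq_bigl => p; rewrite ay.
  have -> : (p%:R <= z) = (p < N)%N by rewrite ltnS truncn_ge_nat.
  by case: (p < N)%N; rewrite /= ?andbT ?andbF.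
apply: lerD => //.
apply: (@le_trans _ _ (\sum_(1 <= p < N) 1)); last first.
  by rewrite sumr_const_nat subn1 /= truncn_le.
rewrite big_mkcond big_nat_recl//= add0r big_add1 /=.
by apply: ler_sum => p _; case: ifP.
Qed.

Definition mtop (s : R) : nat := (Num.truncn (range_end s)).+1.

Lemma range_end_ge0 (s : R) : 0 <= range_end s. Proof. exact: expR_ge0. Qed.

Lemma lt_mtop (s t : R) : t <= range_end s -> t < (mtop s)%:R.
Proof. by move=> /le_lt_trans; apply; exact: truncnS_gt. Qed.

(* Uniformly in the modulus [d] with [wdiv d <= W]: the divisibility pattern of
   [d m + 1] by the primes up to [range_end s] is that of independent events,
   up to an error [eta]. *)
Lemma modulus_transfer eta W : 0 < eta -> 0 <= W ->
  exists B s0 : R, forall s, s0 <= s -> forall d X : nat, (0 < d)%N -> wdiv d <= W ->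
    expR (expR s) <= 4 * X%:R ^+ 2 ->
    (forall t, 2 <= t <= range_end s -> `|mass (pw R d (M := mtop s))
        (ordkey R (M := mtop s)) (enum 'I_(mtop s)) t - ln (ln t)| <= B) /\
    forall P : seq 'I_(mtop s) -> Prop,
      \sum_(1 <= m < X.+1) `[< P (enum (pdset d (mtop s) m)) >]%:R <=
      X%:R * (Pmod (pw R d (M := mtop s)) (enum 'I_(mtop s)) P + eta).
Proof.
move=> eta0 W0; have [C hC] := mertens R.
have C0 : 0 <= C by apply: le_trans (hC 2 (lexx _)).
have [s1 hs1] := err_small C eta0.
(* Mertens' error plus the mass lost to the primes dividing [d]. *)
exists (C + W), (Num.max s1 72) => s; rewrite ge_max => /andP[ss1 s72] d X d0 dW xX.
have s0 : 0 < s by lra.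
set Y := range_end s; set M := mtop s.
have hB t : 2 <= t <= Y -> `|mass (pw R d (M := M)) (ordkey R (M := M)) (enum 'I_M) t
     - ln (ln t)| <= C + W.
  move=> /andP[t2 tY]; have t0 : 0 <= t by lra.
  have /andP[m1 m2] := mass_bounds d0 t0 (lt_mtop tY).
  have := hC t t2; rewrite !ler_norml => /andP[c1 c2].
  by apply/andP; split; lra.
split => // P.
have X0' : 0 < X%:R :> R.
  rewrite lt_neqAle ler0n andbT eq_sym; apply/negP => /eqP X0.
  by move: xX; rewrite X0 expr0n mulr0 leNgt expR_gt0.
have X0 : (0 < X)%N by rewrite -(ltr_nat R).
have Y2 : 2 <= Y.
  have h4 : 1 <= expR s / s ^+ 3.
    have p3 : 0 < s ^+ 3 by rewrite exprn_gt0.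
    rewrite ler_pdivlMr// mul1r.
    have := expR_ge1Dxn 3 (ltW s0); rewrite !factS fact0 => h.
    have : 72 * s ^+ 3 <= s ^+ 4 by rewrite [leRHS]exprS ler_wpM2r// ltW.
    have e24 : (4 * (3 * (2 * (1 * 1))))%:R = 24 :> R by [].
    by rewrite e24 in h => h5; apply: le_trans h; lra.
  by apply: le_trans (expR_ge1Dx _); lra.
have [K hK] := hs1 s ss1.
apply: (le_trans (progression_transfer R d K P X0 (ltn0Sn _))).
rewrite ler_wpM2l// lerD2l; apply: hK => //.
- apply: (@le_trans _ _ (mass (pw R d (M := M)) (ordkey R (M := M)) (enum 'I_M) Y)).
    rewrite /mass big_enum_cond /= big_mkcond [leRHS]big_mkcond /=.
    apply: ler_sum => i _; case: ifPn => // /negP[].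
    rewrite /ordkey -truncn_ge_nat ?range_end_ge0// -ltnS; exact: ltn_ord.
  have /andP[_ m2] := mass_bounds d0 (range_end_ge0 s) (lt_mtop (lexx (range_end s))).
  apply: (le_trans m2).
  have := hC Y Y2; rewrite lnln_range_end// ler_norml => /andP[_].
  have : 0 <= ln s by rewrite ln_ge0//; lra.
  lra.
- rewrite ler0n /=.
  have -> : M%:R = (Num.truncn Y)%:R + 1 :> R by rewrite natr1.
  have hY : (Num.truncn Y)%:R <= Y by rewrite truncn_le range_end_ge0.
  by rewrite -/Y; lra.
Qed.

End PerModulus.

(** * The two halves for a fixed modulus *)

Section UpperLower.
Variable R : realType.
Implicit Types (t s eps eta W : R) (d X : nat).

Lemma lilsc_gt0 t : tower 1 < t -> 0 < lilsc (ln (ln t)).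
Proof.
move=> ht.
have l0 : 0 < t by apply: lt_trans ht; exact: expR_gt0.
have l1 : expR (expR 1) < ln t by rewrite -[ltLHS](expRK (R := R)) ltr_ln ?posrE ?expR_gt0.
have l2 : 0 < ln t by apply: lt_trans l1; exact: expR_gt0.
have l3 : expR 1 < ln (ln t) by rewrite -[ltLHS](expRK (R := R)) ltr_ln ?posrE ?expR_gt0.
have l4 : 0 < ln (ln t) by apply: lt_trans l3; exact: expR_gt0.
have l5 : 1 < ln (ln (ln t)) by rewrite -[ltLHS](expRK (R := R)) ltr_ln ?posrE ?expR_gt0.
by rewrite sqrtr_gt0 !mulr_gt0// ln_gt0.
Qed.

Lemma tower1_gt2 : 2 < tower 1 :> R.
Proof.
apply: lt_trans (_ : expR 1 + 0 < _).
  have := @expR_gt1Dx R 1 (oner_neq0 _); lra.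
by rewrite addr0 /tower ltr_expR; have := expR_gt1Dx (oner_neq0 R);
   have := @expR_gt1Dx R (expR 1); rewrite gt_eqF ?expR_gt0// => /(_ isT); lra.
Qed.

Lemma range_end_large (T : R) : exists s0, forall s, s0 <= s -> T < range_end s.
Proof.
(* [12 * 10] is 5!: the fifth-order term of the series gives [expR s >= s ^+ 4]. *)
exists (Num.max (12 * 10) T) => s; rewrite ge_max => /andP[s120 sT].
have s0 : 0 < s by lra.
have h : s <= expR s / s ^+ 3.
  rewrite ler_pdivlMr ?exprn_gt0// -exprS.
  have := expR_ge1Dxn 4 (ltW s0); rewrite !factS fact0.
  have -> : (5 * (4 * (3 * (2 * (1 * 1)))))%:R = 12 * 10 :> R by rewrite -natrM.
  have : 12 * 10 * s ^+ 4 <= s ^+ 5 by rewrite [leRHS]exprS ler_wpM2r// exprn_ge0// ltW.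
  lra.
by apply: (le_lt_trans sT); have := expR_ge1Dx (expR s / s ^+ 3); rewrite /range_end; lra.
Qed.

Lemma range_end_le s : 3 <= s -> range_end s <= expR (expR s / 4).
Proof.
move=> s3; rewrite ler_expR ler_wpM2l ?expR_ge0// lef_pV2 ?posrE ?exprn_gt0//; last by lra.
have : 3 ^+ 3 <= s ^+ 3 by rewrite lerXn2r ?nnegrE//; lra.
lra.
Qed.

(** Beyond [range_end s] the count grows by at most the tolerated primes and three large ones, while
    log_2 t grows by at most [3 * ln s]. Half of [eps] absorbs both, as the scale does not
    decrease. *)
Lemma extend_upper eps s n t : 0 < eps -> 3 <= s -> (0 < n)%N ->
  s / 2 <= s - 3 * ln s -> 1 <= ln (s - 3 * ln s) ->
  eps / 16 * Num.sqrt s + 3 + 3 * ln s <= eps / 2 * lilsc (s - 3 * ln s) ->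
  n%:R <= expR (expR s) ->
  (count (fun p => range_end s < p%:R <= expR (expR s / 4))%R (primes n))%:R
    <= eps / 16 * Num.sqrt s ->
  `|(omega n (range_end s))%:R - ln (ln (range_end s))| <=
    (1 + eps / 2) * lilsc (ln (ln (range_end s))) ->
  range_end s < t <= expR (expR s) ->
  `|(omega n t)%:R - ln (ln t)| <= (1 + eps) * lilsc (ln (ln t)).
Proof.
move=> eps0 s3 n0 ps1 ps2 ps3 nx hc + /andP[Yt tx].
have s0 : 0 < s by lra.
set Y := range_end s in Yt hc *; set z := expR (expR s / 4) in hc.
have Yz : Y <= z by exact: range_end_le.
have zx : z <= expR (expR s).
  by rewrite ler_expR; have := expR_gt0 s; lra.
rewrite lnln_range_end//; set u := s - 3 * ln s in ps1 ps2 ps3 *.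
have u0 : 0 < u by lra.
have Y0 : 0 < Y by exact: expR_gt0.
have t0 : 0 < t by exact: lt_trans Yt.
have lY0 : 0 < ln Y by rewrite expRK divr_gt0 ?expR_gt0 ?exprn_gt0.
have lYt : ln Y <= ln t by rewrite ler_ln ?posrE// ltW.
have lt0 : 0 < ln t by exact: lt_le_trans lYt.
have uE : ln (ln Y) = u by exact: lnln_range_end.
have ut : u <= ln (ln t) by rewrite -uE ler_ln ?posrE.
have ltx : ln t <= expR s by rewrite -[leRHS](expRK (R := R)) ler_ln ?posrE ?expR_gt0.
have ts : ln (ln t) <= s by rewrite -[leRHS](expRK (R := R)) ler_ln ?posrE ?expR_gt0.
have hh : lilsc u <= lilsc (ln (ln t)) by exact: ler_lilsc.
have h0 := lilsc_ge0 u.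
have o1 : (omega n Y)%:R <= (omega n t)%:R :> R by rewrite ler_nat omega_mono// ltW.
have o2 : (omega n t)%:R <= (omega n Y)%:R + eps / 16 * Num.sqrt s + 3 :> R.
  apply: (@le_trans _ _ (omega n (expR (expR s)))%:R); first by rewrite ler_nat omega_mono.
  rewrite (omega_split n zx) (omega_split n Yz) !natrD lerD//; first by rewrite lerD2l.
  rewrite ler_nat; apply: leq_trans (@count_large_primes R n z 3 n0 _ _).
  - by apply: sub_count => p /andP[].
  - by apply: le_trans (expR_ge1Dx _); rewrite lerDl divr_ge0// expR_ge0.
  - apply: (le_trans nx); rewrite -expRM_natl ler_expR; lra.
rewrite !ler_norml => /andP[a1 a2].
have e1 : (1 + eps) * lilsc u <= (1 + eps) * lilsc (ln (ln t)) by rewrite ler_wpM2l//; lra.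
have ls0 : 0 <= ln s by rewrite ln_ge0//; lra.
have sq0 : 0 <= eps / 16 * Num.sqrt s by rewrite mulr_ge0 ?sqrtr_ge0//; lra.
have us : u = s - 3 * ln s by [].
by apply/andP; split; lra.
Qed.

Lemma markov_count (X : nat) (c : nat -> nat) (r : R) : 0 < r ->
  \sum_(1 <= m < X.+1) `[< r < (c m)%:R >]%:R <= (\sum_(1 <= m < X.+1) (c m)%:R) / r.
Proof.
move=> r0; rewrite ler_pdivlMr// mulr_suml; apply: ler_sum => m _.
by case: asboolP => [/ltW|_]; rewrite ?mul1r// mul0r.
Qed.

(** The budget is [eta / 4] for the model, [eta / 4] for the transfer, and [eta / 2] for Markov's
    inequality on the primes between [range_end s] and x^(1/4). *)
Lemma upper_modulus eps eta W : 0 < eps -> 0 < eta -> 0 <= W ->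
  exists T0 s0, tower 1 <= T0 /\ forall s, s0 <= s -> forall d X, (0 < d)%N ->
    wdiv R d <= W -> expR (expR s) <= 4 * X%:R ^+ 2 ->
    (d * X + 1)%:R <= expR (expR s) ->
    \sum_(1 <= m < X.+1) `[< exists2 t, T0 < t <= expR (expR s) &
       (1 + eps) * lilsc (ln (ln t)) < `|(omega (d * m + 1) t)%:R - ln (ln t)| >]%:R
    <= X%:R * eta.
Proof.
move=> eps0 eta0 W0.
have eta4 : 0 < eta / 4 by rewrite divr_gt0.
have eta2 : 0 < eta / 2 by rewrite divr_gt0.
have eps2 : 0 < eps / 2 by rewrite divr_gt0.
have [B [s1 hs1]] := modulus_transfer eta4 W0.
have [T1 hT1] := lil_upper_model B eps2 eta4.
pose T0 := Num.max T1 (tower 1).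
have [C hC] := mertens R.
have C0 : 0 <= C by apply: le_trans (hC 2 (lexx _)).
have [s2 hs2] := tail_params eps0 eta2 C0.
have [s3 hs3] := range_end_large T0.
exists T0, (Num.max 3 (Num.max s1 (Num.max s2 s3))); split.
  by rewrite le_max lexx orbT.
move=> s; rewrite !ge_max => /and4P[s_3 ss1 ss2 ss3] d X d0 dW xX dXx.
have s0 : 0 < s by lra.
have [_ p1 p2 p3 p4] := hs2 s ss2.
have YT0 := hs3 s ss3.
have T02 : 2 <= T0.
  by apply: ltW; apply: (lt_le_trans tower1_gt2); rewrite le_max lexx orbT.
have [hB htr] := hs1 s ss1 d X d0 dW xX.
set Y := range_end s in YT0 hB; set z := expR (expR s / 4).
have Yz : Y <= z by exact: range_end_le.
have Y0 : 0 <= Y by exact: expR_ge0.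
pose P (w : seq 'I_(mtop s)) := exists2 t, T0 < t <= Y &
    (1 + eps / 2) * lilsc (ln (ln t)) < `|(cnt (ordkey R (M := mtop s)) w t)%:R - ln (ln t)|.
pose r := eps / 16 * Num.sqrt s.
have r0 : 0 < r by rewrite mulr_gt0 ?divr_gt0// sqrtr_gt0.
pose c m := count (fun p => Y < p%:R <= z)%R (primes (d * m + 1)).
apply: (@le_trans _ _ (\sum_(1 <= m < X.+1) (`[< P (enum (pdset d (mtop s) m)) >]%:R +
    `[< r < (c m)%:R >]%:R))).
  rewrite big_nat [leRHS]big_nat; apply: ler_sum => m /andP[m1 mX].
  case: asboolP => [[t /andP[t1 t2] ht]|_]; last by rewrite addr_ge0.
  have [hP|nP] := asboolP (P _); first by rewrite lerDl.
  have [hr|nr] := asboolP (r < _); first by rewrite lerDr.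
  exfalso.
  have nP' t' : T0 < t' <= Y -> `|(omega (d * m + 1) t')%:R - ln (ln t')| <=
      (1 + eps / 2) * lilsc (ln (ln t')).
    move=> /andP[t1' t2']; rewrite leNgt; apply/negP => hb; apply: nP.
    by exists t'; rewrite ?t1' ?t2'// cnt_omega// lt_mtop.
  have n0 : (0 < d * m + 1)%N by rewrite addn1.
  have hc : (c m)%:R <= r by rewrite leNgt; apply/negP.
  have nx : (d * m + 1)%:R <= expR (expR s) :> R.
    by apply: le_trans dXx; rewrite ler_nat leq_add2r leq_mul2l -ltnS mX orbT.
  move: ht; apply/negP; rewrite -leNgt.
  have [tY|Yt] := leP t Y.
    apply: (le_trans (nP' t _)); first by rewrite t1.
    by rewrite ler_wpM2r ?lilsc_ge0//; clear -eps0; lra.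
  apply: (@extend_upper eps s _ t) => //; last by rewrite Yt.
  by apply: nP'; rewrite YT0 lexx.
rewrite big_split /=.
have e1 : \sum_(1 <= m < X.+1) `[< P (enum (pdset d (mtop s) m)) >]%:R <=
    X%:R * (eta / 4 + eta / 4).
  apply: (le_trans (htr P)); rewrite ler_wpM2l// lerD2r.
  apply: hT1; first by rewrite le_max lexx.
  - exact: pw01.
  - exact: pairwise_ordkey.
  - move=> t /andP[t1 t2]; apply: hB; rewrite t2 andbT; clear -t1 T02; lra.
have e2 : \sum_(1 <= m < X.+1) `[< r < (c m)%:R >]%:R <= X%:R * (eta / 2).
  apply: (le_trans (markov_count X c r0)); rewrite ler_pdivrMr//.
  have Y0z : 0 <= Y <= z by rewrite Y0.
  apply: (le_trans (mid_primes_sum X d0 Y0z)).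
  have X0' : 0 <= X%:R :> R by [].
  have z4 : z ^+ 4 = expR (expR s) by rewrite -expRM_natl; congr expR; field.
  have z1 : 1 <= z.
    by apply: le_trans (expR_ge1Dx _); rewrite lerDl divr_ge0// expR_ge0.
  (* This turns the rounding term [z] of [mid_primes_sum] into the summand 2 of the fourth bound of
     [tail_params]. *)
  have zX : z <= 2 * X%:R.
    rewrite -(@ler_pXn2r _ 2) ?nnegrE ?mulr_ge0//; last by clear -z1; lra.
    rewrite exprMn; apply: (@le_trans _ _ (z ^+ 4)); first by rewrite ler_weXn2l.
    by rewrite z4; apply: (le_trans xX); clear -X0'; lra.
  have mz : recip_sum R (Num.truncn z) - recip_sum R (Num.truncn Y) <= 3 * ln s + 2 * C.
    have Y2 : 2 <= Y by clear -T02 YT0; lra.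
    have := hC Y Y2; rewrite lnln_range_end// ler_norml => /andP[c1 _].
    have := hC z (le_trans Y2 Yz); rewrite ler_norml => /andP[_ c2].
    have : ln (ln z) <= s.
      rewrite /z expRK -[leRHS](expRK (R := R)) ler_ln ?posrE ?divr_gt0 ?expR_gt0//.
      by have := expR_gt0 s; clear -s; lra.
    by clear -c1 c2; lra.
  have m1 : X%:R * (recip_sum R (Num.truncn z) - recip_sum R (Num.truncn Y)) <=
     X%:R * (3 * ln s + 2 * C) by rewrite ler_wpM2l.
  have m2 : X%:R * (3 * ln s + 2 * C + 2) <= X%:R * (eta / 2 * r) by rewrite ler_wpM2l.
  by clear -m1 m2 zX; lra.
by clear -e1 e2; lra.
Qed.

(** The window of the model ends at a constant [T1], which [range_end s] exceeds for large [s], so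
    primes beyond the reach of the moments do not enter. *)
Lemma lower_modulus eps eta W T0 sg : 0 < eps <= 1 -> 0 < eta -> 0 <= W ->
  sg = 1 \/ sg = -1 ->
  exists s0, forall s, s0 <= s -> forall d X, (0 < d)%N ->
    wdiv R d <= W -> expR (expR s) <= 4 * X%:R ^+ 2 ->
    \sum_(1 <= m < X.+1) `[< forall t, T0 < t <= expR (expR s) ->
       sg * ((omega (d * m + 1) t)%:R - ln (ln t)) < (1 - eps) * lilsc (ln (ln t)) >]%:R
    <= X%:R * eta.
Proof.
move=> eps01 eta0 W0 hsg.
have eta2 : 0 < eta / 2 by rewrite divr_gt0.
have [B [s1 hs1]] := modulus_transfer eta2 W0.
pose T0' := Num.max T0 2.
have [T1 hT1] := lil_lower_model B T0' eps01 eta2 hsg.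
have [s3 hs3] := range_end_large T1.
exists (Num.max 3 (Num.max s1 s3)) => s; rewrite !ge_max => /and3P[s_3 ss1 ss3] d X d0 dW xX.
have YT1 := hs3 s ss3.
have [hB htr] := hs1 s ss1 d X d0 dW xX.
have Yx : range_end s <= expR (expR s).
  by apply: (le_trans (range_end_le s_3)); rewrite ler_expR; have := expR_gt0 s; lra.
pose P (w : seq 'I_(mtop s)) := forall t, T0' < t <= T1 ->
  sg * ((cnt (ordkey R (M := mtop s)) w t)%:R - ln (ln t)) < (1 - eps) * lilsc (ln (ln t)).
apply: (@le_trans _ _ (\sum_(1 <= m < X.+1) `[< P (enum (pdset d (mtop s) m)) >]%:R)).
  apply: ler_sum => m _; case: asboolP => [h|_]; last by rewrite ler0n.
  rewrite asboolT// => t /andP[t1 t2]; rewrite cnt_omega; last first.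
    by apply: lt_mtop; lra.
  apply: h; apply/andP; split; last by lra.
  by apply: le_lt_trans t1; rewrite le_max lexx.
apply: (le_trans (htr P)); rewrite ler_wpM2l//.
suff : Pmod (pw R d (M := mtop s)) (enum 'I_(mtop s)) P <= eta / 2 by lra.
apply: hT1.
- exact: pw01.
- exact: pw_key.
- exact: pairwise_ordkey.
- move=> t /andP[t1 t2]; apply: hB; apply/andP; split; last by lra.
  by apply: ltW; apply: le_lt_trans t1; rewrite le_max lexx orbT.
Qed.

End UpperLower.

(** * Averaging over the divisor *)

Section Averaging.
Variable R : realType.
Implicit Types (d k n : nat).

Lemma perm_divisors_div k : (0 < k)%N ->
  perm_eq [seq (k %/ d)%N | d <- divisors k] (divisors k).
Proof.
move=> k0.
have inj : {in divisors k &, injective (fun d => k %/ d)%N}.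
  move=> d e; rewrite -!dvdn_divisors// => dk ek h.
  have q0 : (0 < k %/ d)%N by rewrite divn_gt0 ?(dvdn_gt0 k0 dk)// dvdn_leq.
  by apply/eqP; rewrite -(eqn_pmul2l q0) {2}h !divnK.
apply: uniq_perm; rewrite ?map_inj_in_uniq ?divisors_uniq// => e.
apply/mapP/idP => [[d]|].
  by rewrite -!dvdn_divisors// => dk ->; rewrite dvdn_div.
rewrite -dvdn_divisors// => ek; exists (k %/ e)%N.
  by rewrite -dvdn_divisors// dvdn_div.
by rewrite divnA// mulKn.
Qed.

(** The involution sending [d] to [k %/ d] carries divisors above the square root of [k] to divisors
    below it. *)
Lemma tau_le_small_divisors k : (0 < k)%N ->
  (tau k <= 2 * count (fun d => d * d <= k)%N (divisors k))%N.
Proof.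
move=> k0; rewrite /tau -(count_predC (fun d => d * d <= k)%N) mul2n -addnn leq_add2l.
rewrite -[leqRHS](permP (perm_divisors_div k0)) count_map.
rewrite -!sum1_count big_seq_cond [leqRHS]big_seq_cond.
rewrite big_mkcond [leqRHS]big_mkcond /=; apply: leq_sum => d _.
have [|] //= := boolP (d \in divisors k); rewrite -dvdn_divisors// => dk.
have [|dd] //= := leqP (d * d)%N k.
rewrite (_ : (_ <= k)%N = true)//.
have e := divnK dk; set q := (k %/ d)%N in e *.
have : (q <= d)%N by rewrite leqNgt; apply/negP => h; nia.
nia.
Qed.

Lemma count_divisors (a : pred nat) k M : (0 < k <= M)%N ->
  count a (divisors k) = (\sum_(1 <= d < M.+1) ((d %| k) && a d))%N.
Proof.
move=> /andP[k0 kM]; rewrite -sum1_count -big_mkcond /= -[RHS]big_filter -[LHS]big_filter.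
apply: perm_big; apply: uniq_perm; rewrite ?filter_uniq ?divisors_uniq ?iota_uniq// => d.
rewrite !mem_filter -dvdn_divisors// mem_index_iota andbC.
have [dk|] //= := boolP (d %| k)%N; have := dvdn_leq k0 dk; have := dvdn_gt0 k0 dk.
by move=> -> dk'; rewrite ltnS (leq_trans dk' kM) /= andbT.
Qed.

Lemma sum_multiples (F : nat -> R) d n : (0 < d)%N ->
  \sum_(1 <= k < n.+1 | (d %| k)%N) F k = \sum_(1 <= m < (n %/ d).+1) F (d * m)%N.
Proof.
move=> d0; elim: n => [|n IH]; first by rewrite div0n !big_geq.
rewrite big_mkcond big_nat_recr//= -big_mkcond /= IH divnS//.
have [dn|] := boolP (d %| n.+1)%N; last by rewrite addr0.
rewrite add1n [RHS]big_nat_recr//=; congr (_ + F _).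
by rewrite -[LHS](divnK dn) divnS// dn add1n mulnC.
Qed.

Definition harm (M : nat) : R := \sum_(1 <= d < M.+1) d%:R^-1.

(** The sum counts multiples, and [M %/ d] is at least half of [M / d] for [d <= M]. *)
Lemma sum_tau_ge (M : nat) :
  M%:R / 2 * harm M <= \sum_(1 <= k < M.+1) (tau k)%:R.
Proof.
have -> : \sum_(1 <= k < M.+1) (tau k)%:R =
    \sum_(1 <= d < M.+1) (M %/ d)%:R :> R.
  transitivity (\sum_(1 <= k < M.+1) \sum_(1 <= d < M.+1) ((d %| k)%N : nat)%:R : R).
    rewrite big_nat [RHS]big_nat; apply: eq_bigr => k hk.
    rewrite /tau -(count_predT (divisors k)) (@count_divisors _ k M) ?natr_sum//.
    by apply: eq_bigr => d _; rewrite andbT.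
  rewrite exchange_big /= big_nat [RHS]big_nat; apply: eq_bigr => d /andP[d0 _].
  rewrite -(@natr_sum R) divn_count_dvd//.
rewrite /harm mulr_sumr big_nat [leRHS]big_nat; apply: ler_sum => d /andP[d0 dM].
have d0' : 0 < d%:R :> R by rewrite ltr0n.
have q1 : (1 <= M %/ d)%N by rewrite divn_gt0.
have h : (M <= 2 * (M %/ d) * d)%N.
  have := divn_eq M d; have := ltn_mod M d; rewrite d0; nia.
have : (M%:R : R) <= 2 * (M %/ d)%:R * d%:R by rewrite -!natrM ler_nat.
by rewrite -ler_pdivrMr//; lra.
Qed.

(** Exchanging sums, the multiples [d] of [p] contribute at most [harm M / p ^ 2], and the sum of
    [1 / p ^ 2] over all integers [p >= 2] is at most 1. *)
Lemma sum_wdiv_le (M : nat) : \sum_(1 <= d < M.+1) wdiv R d / d%:R <= harm M.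
Proof.
have harm0 : 0 <= harm M by rewrite sumr_ge0// => d _; rewrite invr_ge0.
apply: (@le_trans _ _ (\sum_(2 <= p < M.+1) p%:R^-1 * (p%:R^-1 * harm M))).
  apply: (@le_trans _ _ (\sum_(1 <= d < M.+1) \sum_(2 <= p < M.+1)
      (if (p %| d)%N then p%:R^-1 / d%:R else 0))).
    rewrite big_nat [leRHS]big_nat; apply: ler_sum => d /andP[d0 dM].
    rewrite /wdiv mulr_suml.
    have hp : all (fun p => (2 <= p < M.+1)%N && (p %| d)%N) (primes d).
      apply/allP => p; rewrite mem_primes => /and3P[pp _ pd].
      by rewrite prime_gt1//= pd andbT (leq_ltn_trans _ dM)// dvdn_leq.
    rewrite -big_mkcond /= -[leRHS]big_filter.
    have [r hr] : exists r, perm_eq (primes d ++ r)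
        (seq.filter (fun p => p %| d)%N (index_iota 2 M.+1)).
      exists (seq.filter (fun p => p \notin primes d)
         (seq.filter (fun p => p %| d)%N (index_iota 2 M.+1))).
      rewrite perm_sym; apply: perm_trans (_ : perm_eq _ (seq.filter (mem (primes d))
         (seq.filter (fun p => p %| d)%N (index_iota 2 M.+1)) ++ _)) _.
        by rewrite perm_sym; apply/permPl; exact: perm_filterC.
      rewrite perm_cat2r; apply: uniq_perm.
      - by rewrite !filter_uniq// iota_uniq.
      - exact: primes_uniq.
      - move=> p; rewrite mem_filter /= andbC mem_filter mem_index_iota.
        have [pd|] := boolP (p \in primes d); last by rewrite andbF.
        by have /allP/(_ p pd)/andP[-> ->] := hp.
    rewrite -(perm_big _ hr) big_cat /= lerDl sumr_ge0// => p _.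
  rewrite exchange_big /= big_nat [leRHS]big_nat; apply: ler_sum => p /andP[p2 _].
  have p0 : (0 < p)%N by lia.
  rewrite -big_mkcond /= sum_multiples// /harm !mulr_sumr.
  apply: (@le_trans _ _ (\sum_(1 <= m < (M %/ p).+1) p%:R^-1 * (p%:R^-1 * m%:R^-1))).
    by apply: ler_sum => m _; rewrite natrM invfM.
  rewrite [leRHS](@big_cat_nat _ _ _ (M %/ p).+1)//=; last by rewrite ltnS leq_div.
  by rewrite lerDl sumr_ge0// => m _; rewrite !mulr_ge0 ?invr_ge0.
rewrite -[leRHS]mul1r.
under eq_bigr do rewrite mulrA.
rewrite -mulr_suml ler_wpM2r//.
apply: (@le_trans _ _ (\sum_(2 <= p < M.+1) (p%:R : R) `^ (- (1 + 1)))).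
  rewrite big_nat [leRHS]big_nat; apply: ler_sum => p /andP[p2 _].
  rewrite -[1 + 1]/(2%:R : R) powRN powR_mulrn// -exprVn expr2.
  by [].
by apply: (le_trans (@powRN_tail R 1 1 M.+1 ltr01 isT)); rewrite powR1 invr1 mulr1.
Qed.

Lemma shifted_div_probE (x : R) (A : set nat) :
  shifted_div_prob x A =
  (\sum_(1 <= k < Num.truncn x | `[< A k.+1 >]) (tau k)%:R) /
  (\sum_(1 <= k < Num.truncn x) (tau k)%:R).
Proof.
by rewrite /shifted_div_prob; congr (_ / _); rewrite big_add1 /=.
Qed.

(** The 4 is a factor 2 for keeping only divisors up to the square root and a factor 2 from the
    denominator [M / 2 * harm M]. Divisors with [wdiv R d > W] are bounded trivially: by Markov's
    inequality for the weights [1 / d] their share is at most [W^-1]. *)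
Lemma shifted_div_prob_le (x eta W : R) (A : set nat) : 2 <= x -> 0 < W -> 0 <= eta ->
  (forall d X, (0 < d)%N -> wdiv R d <= W -> x <= 4 * X%:R ^+ 2 ->
    (d * X + 1)%:R <= x ->
    \sum_(1 <= m < X.+1) `[< A (d * m + 1)%N >]%:R <= X%:R * eta) ->
  shifted_div_prob x A <= 4 * (eta + W^-1).
Proof.
move=> x2 W0 eta0 hA; rewrite shifted_div_probE.
have x0 : 0 <= x by lra.
have N2 : (2 <= Num.truncn x)%N by rewrite truncn_ge_nat.
pose M := (Num.truncn x).-1.
have NE : Num.truncn x = M.+1 by rewrite /M; lia.
have M0 : (0 < M)%N by lia.
have Mx : M.+1%:R <= x by rewrite -NE truncn_le.
have xM : x < M.+2%:R by rewrite -NE; exact: truncnS_gt.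
rewrite NE.
have harm1 : 0 < harm M.
  rewrite /harm big_ltn//= invr1 ltr_wpDr// sumr_ge0// => d _; by rewrite invr_ge0.
have M0' : 0 < M%:R :> R by rewrite ltr0n.
have den := sum_tau_ge M.
have den0 : 0 < M%:R / 2 * harm M by rewrite !mulr_gt0// invr_gt0.
rewrite ler_pdivrMr; last exact: lt_le_trans den.
apply: (@le_trans _ _ (4 * (eta + W^-1) * (M%:R / 2 * harm M))); last first.
  by rewrite ler_wpM2l// mulr_ge0// addr_ge0// invr_ge0 ltW.
have -> : 4 * (eta + W^-1) * (M%:R / 2 * harm M) =
  2 * (M%:R * (eta * harm M + W^-1 * harm M)) by field; rewrite gt_eqF.
pose b k : R := `[< A k.+1 >]%:R.
pose S d := \sum_(1 <= m < (M %/ d).+1) b (d * m)%N.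
apply: (@le_trans _ _ (2 * \sum_(1 <= d < M.+1 | (d * d <= M)%N) S d)).
  rewrite big_mkcond /=.
  apply: (@le_trans _ _ (\sum_(1 <= k < M.+1) \sum_(1 <= d < M.+1 | (d * d <= M)%N)
      2 * (if (d %| k)%N then b k else 0))).
    rewrite big_nat [leRHS]big_nat; apply: ler_sum => k /andP[k0 kM].
    rewrite -mulr_sumr /b; case: asboolP => _ /=; last first.
      by rewrite big1 ?mulr0// => d _; case: ifP.
    apply: (@le_trans _ _ ((2 * count (fun d => d * d <= k)%N (divisors k))%:R)).
      by rewrite ler_nat tau_le_small_divisors.
    rewrite natrM ler_wpM2l// (@count_divisors _ k M) ?k0//.
    rewrite natr_sum [leRHS]big_mkcond; apply: ler_sum => d _.
    case: (d %| k)%N => /=; last by case: ifP.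
    have [dk|] := leqP (d * d)%N k; last by case: ifP.
    by rewrite (leq_trans dk).
  rewrite exchange_big /= mulr_sumr big_nat_cond [leRHS]big_nat_cond.
  apply: ler_sum => d /andP[/andP[d0 _] _]; rewrite -mulr_sumr -big_mkcond /=.
  by rewrite sum_multiples.
rewrite ler_wpM2l//.
have bS d : (0 < d)%N -> S d <= (M %/ d)%:R.
  move=> d0; rewrite -[leRHS]mulr1n -[X in _ *+ X]mul1n.
  apply: (@le_trans _ _ (\sum_(1 <= m < (M %/ d).+1) 1)).
    by apply: ler_sum => m _; rewrite /b; case: asbool.
  by rewrite sumr_const_nat subn1.
have divR d : (0 < d)%N -> (M %/ d)%:R <= M%:R / d%:R :> R.
  by move=> d0; rewrite ler_pdivlMr ?ltr0n// -natrM ler_nat leq_divM.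
apply: (@le_trans _ _ (\sum_(1 <= d < M.+1)
   (eta * (M%:R / d%:R) + W^-1 * (M%:R * (wdiv R d / d%:R))))).
  rewrite big_nat_cond [leRHS]big_nat_cond.
  rewrite big_mkcond [leRHS]big_mkcond /=; apply: ler_sum => d _.
  have t1 : (0 < d)%N -> 0 <= eta * (M%:R / d%:R) by move=> d0; rewrite mulr_ge0// divr_ge0.
  have t2 : (0 < d)%N -> 0 <= W^-1 * (M%:R * (wdiv R d / d%:R)).
    by move=> d0; rewrite !mulr_ge0 ?invr_ge0 ?wdiv_ge0 ?(ltW W0).
  case: (1 <= d < M.+1)%N / andP => [[d0 dM]|] //=; rewrite ?andbT.
  case: ifP => [dd|_]; last by rewrite addr_ge0 ?t1 ?t2.
  have [dW|Wd] := leP (wdiv R d) W.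
    apply: (@le_trans _ _ (eta * (M%:R / d%:R))); last by rewrite lerDl t2.
    apply: (@le_trans _ _ ((M %/ d)%:R * eta)); last by rewrite mulrC ler_wpM2l// divR.
    (* As [d <= X], one has [M < (X + 1) * d <= X + X ^ 2], which gives [x <= 4 * X ^ 2]. *)
    set X := (M %/ d)%N.
    have dX : (d <= X)%N by rewrite leq_divRL.
    have MX : (M < X.+1 * d)%N by rewrite -ltn_divLR.
    apply: le_trans (hA d X d0 dW _ _).
    - by rewrite /S /b -/X; apply: ler_sum => m _; rewrite addn1.
    - have X1 : (0 < X)%N by exact: leq_trans dX.
      have h1 : (X <= X * X)%N by rewrite leq_pmulr.
      have h2 : (M < X + X * X)%N.
        by apply: (leq_trans MX); rewrite -mulSn leq_mul2l dX orbT.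
      apply: (le_trans (ltW xM)); rewrite -natrX -natrM ler_nat -mulnn.
      by clear -X1 h1 h2; lia.
    - apply: le_trans Mx; rewrite ler_nat addn1 ltnS mulnC leq_divM//.
  apply: (@le_trans _ _ (W^-1 * (M%:R * (wdiv R d / d%:R)))); last by rewrite lerDr t1.
  apply: (le_trans (bS d d0)); apply: (le_trans (divR d d0)).
  have -> : W^-1 * (M%:R * (wdiv R d / d%:R)) = (W^-1 * wdiv R d) * (M%:R / d%:R) by ring.
  by rewrite ler_peMl ?divr_ge0// ler_pdivlMl// mulr1 ltW.
rewrite big_split /= -!mulr_sumr -/(harm M).
have := sum_wdiv_le M; set Q := \sum_(_ <= _ < _) _ => hQ.
have : M%:R * (W^-1 * Q) <= M%:R * (W^-1 * harm M).
  by rewrite !ler_wpM2l ?invr_ge0 ?(ltW W0).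
have : \sum_(1 <= i < M.+1) M%:R / i%:R = M%:R * harm M by rewrite -mulr_sumr.
lra.
Qed.

Lemma shifted_div_probC (x : R) (A : set nat) : 2 <= x ->
  shifted_div_prob x A = 1 - shifted_div_prob x (~` A).
Proof.
move=> x2; rewrite !shifted_div_probE.
have N2 : (2 <= Num.truncn x)%N by rewrite truncn_ge_nat//; lra.
set D := \sum_(1 <= k < Num.truncn x) _.
have D0 : 0 < D.
  rewrite /D big_ltn//= ltr_wpDr ?sumr_ge0//.
have -> : \sum_(1 <= k < Num.truncn x | `[< A k.+1 >]) (tau k)%:R =
  D - \sum_(1 <= k < Num.truncn x | `[< (~` A) k.+1 >]) (tau k)%:R.
  rewrite /D [in X in X - _](bigID (fun k => `[< A k.+1 >]))/= .
  rewrite [X in _ - X](eq_bigl (fun k => ~~ `[< A k.+1 >])); last first.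
    by move=> k; rewrite -asbool_neg.
  by rewrite addrK.
by rewrite mulrBl divff// gt_eqF.
Qed.

Lemma shifted_div_prob_ge0 (x : R) (A : set nat) : 0 <= shifted_div_prob x A.
Proof. by rewrite divr_ge0 ?sumr_ge0. Qed.

Lemma shifted_div_prob_mono (x : R) (A B : set nat) : A `<=` B ->
  shifted_div_prob x A <= shifted_div_prob x B.
Proof.
move=> AB; rewrite /shifted_div_prob ler_wpM2r ?invr_ge0 ?sumr_ge0//.
rewrite big_mkcond [leRHS]big_mkcond; apply: ler_sum => n _.
case: (asboolP (A n)) => [/AB Bn|_]; first by rewrite asboolT.
by case: ifP.
Qed.

End Averaging.

(** * Conclusion *)

Section Assembly.
Variable R : realType.
Implicit Types (x t eps e : R).

Lemma expR_lnln x s0 : expR (expR s0) <= x ->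
  expR (expR (ln (ln x))) = x /\ s0 <= ln (ln x).
Proof.
move=> hx; have x0 : 0 < x by apply: lt_le_trans hx; exact: expR_gt0.
have h : expR s0 <= ln x by rewrite -[leLHS](expRK (R := R)) ler_ln ?posrE ?expR_gt0.
have l0 : 0 < ln x by apply: lt_le_trans h; exact: expR_gt0.
split; first by rewrite !lnK ?posrE.
by rewrite -[leLHS](expRK (R := R)) ler_ln ?posrE ?expR_gt0.
Qed.

(** [T0] and [x0] do not depend on [xi], so the upper half applies to every [xi] tending to
    infinity. *)
Lemma prob_Mabs_le eps e : 0 < eps -> 0 < e ->
  exists T0 x0, forall (xi : R -> R) x, x0 <= x -> T0 <= xi x ->
    shifted_div_prob x (~` [set n | (Mabs xi x n <= (1 + eps)%:E)%E]) <= e.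
Proof.
move=> eps0 e0.
have e8 : 0 < e / 8 by rewrite divr_gt0.
have W0 : 0 < 8 / e by rewrite divr_gt0.
have [T0 [s0 [T01 hs0]]] := upper_modulus eps0 e8 (ltW W0).
exists T0, (Num.max 2 (expR (expR s0))) => xi x.
rewrite ge_max => /andP[x2 /expR_lnln[xE ss]] T0x.
have := hs0 _ ss; rewrite xE => {}hs0.
have -> : e = 4 * (e / 8 + (8 / e)^-1) by field; rewrite gt_eqF.
apply: shifted_div_prob_le => //; first exact: ltW.
move=> d X d0 dW xX dXx; apply: le_trans (hs0 d X d0 dW xX dXx).
apply: ler_sum => m _; case: asboolP => [hm|_]; last by rewrite ler0n.
rewrite asboolT//.
apply: contrapT => hn; apply: hm => /=; apply: ge_ereal_sup => _ [t /= /andP[t1 t2] <-].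
rewrite lee_fin leNgt; apply/negP => ht; apply: hn; exists t.
  by rewrite t2 (le_lt_trans T0x t1).
have l0 : 0 < lilsc (ln (ln t)).
  by apply: lilsc_gt0; apply: (le_lt_trans T01); exact: le_lt_trans t1.
rewrite -ltr_pdivlMr//; move: ht.
by rewrite /Lambda normrM normfV -/(lilsc (ln (ln t))) (gtr0_norm l0).
Qed.

Lemma prob_one_sided eps e (T0 sg : R) : 0 < eps <= 1 -> 0 < e -> sg = 1 \/ sg = -1 ->
  exists x0, forall x, x0 <= x ->
    shifted_div_prob x [set n | forall t, T0 < t <= x ->
      sg * ((omega n t)%:R - ln (ln t)) < (1 - eps) * lilsc (ln (ln t))] <= e.
Proof.
move=> eps01 e0 hsg.
have e8 : 0 < e / 8 by rewrite divr_gt0.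
have W0 : 0 < 8 / e by rewrite divr_gt0.
have [s0 hs0] := lower_modulus T0 eps01 e8 (ltW W0) hsg.
exists (Num.max 2 (expR (expR s0))) => x.
rewrite ge_max => /andP[x2 /expR_lnln[xE ss]].
have := hs0 _ ss; rewrite xE => {}hs0.
have -> : e = 4 * (e / 8 + (8 / e)^-1) by field; rewrite gt_eqF.
apply: shifted_div_prob_le => //; first exact: ltW.
by move=> d X d0 dW xX dXx; exact: hs0.
Qed.

(** [K x] is the largest [k <= x] such that the thresholds of [P 0], ..., [P k] are all at most [x];
    the cap by [x] makes the maximum finite. *)
Lemma diagonal_choice (P : nat -> R -> Prop) :
  (forall k, exists x0, forall x, x0 <= x -> P k x) ->
  exists K : R -> nat, (K x)%:R @[x --> +oo] --> (+oo : set_system R) /\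
    exists x1, forall x, x1 <= x -> P (K x) x.
Proof.
move=> /choice[g hg].
pose A x := [pred k : 'I_(Num.truncn x).+1 | [forall j : 'I_k.+1, g j <= x]].
exists (fun x => \max_(k in A x) k); split; last first.
  exists (g 0%N) => x gx; apply: hg.
  have A0 : (0 < #|A x|)%N.
    apply/card_gt0P; exists ord0; rewrite inE; apply/forallP => j.
    by have -> : (j : nat) = 0%N by case: j => -[].
  have [k kA ->] := eq_bigmax_cond (fun k : 'I_(Num.truncn x).+1 => (k : nat)) A0.
  by move: kA; rewrite inE => /forallP/(_ ord_max).
apply/cvgryPge => a.
pose k := (Num.truncn a).+1.
pose M := \big[Num.max/k%:R]_(j < k.+1) g j.
near=> x.
have Mx : M <= x by near: x; exact: nbhs_pinfty_ge (num_real _).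
have kx : k%:R <= x by apply: le_trans Mx; rewrite /M bigmax_ge_id.
have x0 : 0 <= x by exact: le_trans kx.
have kN : (k < (Num.truncn x).+1)%N by rewrite ltnS truncn_ge_nat.
apply: (le_trans (ltW (truncnS_gt a))); rewrite ler_nat.
have kA : Ordinal kN \in A x.
  rewrite inE; apply/forallP => j; apply: le_trans Mx.
  exact: (le_bigmax_cond _ (fun j : 'I_k.+1 => g j)).
exact: (@leq_bigmax_cond _ (mem (A x)) (fun i : 'I_(Num.truncn x).+1 => (i : nat)) (Ordinal kN)).
Unshelve. all: by end_near. Qed.

Lemma cvg_prob1 (A : R -> set nat) :
  (forall e, 0 < e -> \forall x \near +oo, shifted_div_prob x (~` A x) <= e) ->
  shifted_div_prob x (A x) @[x --> +oo] --> (1 : R).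
Proof.
move=> hA; apply/cvgrPdist_le => e e0; near=> x.
have x2 : 2 <= x by near: x; exact: nbhs_pinfty_ge (num_real _).
rewrite shifted_div_probC// opprB addrCA subrr addr0.
rewrite ger0_norm ?shifted_div_prob_ge0//.
by near: x; exact: hA.
Unshelve. all: by end_near. Qed.

End Assembly.

Theorem theorem2p5 (R : realType) (eps : R) (eps_gt0 : 0 < eps) :
  exists xi0 : R -> R,
    (xi0 x @[x --> +oo] --> +oo) /\
    forall xi : R -> R,
      (xi x @[x --> +oo] --> +oo) ->
      (\forall x \near +oo, xi x <= xi0 x) ->
      [/\ shifted_div_prob x [set n | (Mabs xi x n <= (1 + eps)%:E)%E]
            @[x --> +oo] --> (1 : R),
          shifted_div_prob x [set n | ((1 - eps)%:E <= Mplus xi x n)%E]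
            @[x --> +oo] --> (1 : R)
        & shifted_div_prob x [set n | (Mminus xi x n <= (-1 + eps)%:E)%E]
            @[x --> +oo] --> (1 : R)].
Proof.
(* The lower model needs [eps <= 1], and lowering [eps] only strengthens both conclusions. *)
pose e1 := Num.min eps 1.
have e1eps : e1 <= eps by rewrite ge_min lexx.
have e101 : 0 < e1 <= 1 by rewrite lt_min eps_gt0 ltr01 ge_min lexx orbT.
(* The failure event for the lower half beyond [k]; starting no earlier than [tower 1] keeps the
   scale positive, so that one can divide by it. *)
pose L (sg : R) (k : nat) (x : R) := [set n | forall t : R, Num.max k%:R (tower 1) < t <= x ->
      sg * ((omega n t)%:R - ln (ln t)) < (1 - e1) * lilsc (ln (ln t))].
have [k|K [Koo [x1 hK]]] := @diagonal_choice R (fun k x =>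
    shifted_div_prob x (L 1 k x) <= k.+1%:R^-1 /\
    shifted_div_prob x (L (-1) k x) <= k.+1%:R^-1).
  have k0 : 0 < k.+1%:R^-1 :> R by rewrite invr_gt0.
  have [y1 h1] := prob_one_sided (Num.max k%:R (tower 1)) e101 k0 (or_introl erefl).
  have [y2 h2] := prob_one_sided (Num.max k%:R (tower 1)) e101 k0 (or_intror erefl).
  exists (Num.max y1 y2) => x; rewrite ge_max => /andP[xy1 xy2].
  by split; [exact: h1 | exact: h2].
(* Once [xi x <= K x], every [t] in [(K x, x]] also lies in [(xi x, x]] and thus bounds the supremum
   or infimum over that range. *)
exists (fun x => (K x)%:R); split => // xi xioo xile.
have Ksmall (e : R) : 0 < e -> \forall x \near +oo, (K x).+1%:R^-1 <= e.
  move=> e0; near=> x.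
  rewrite -[leRHS]invrK lef_pV2 ?posrE ?invr_gt0//.
  apply: (@le_trans _ _ (K x)%:R); last by rewrite ler_nat.
  by near: x; move/cvgryPge : Koo; apply.
have lower (sg : R) (A : R -> set nat) : sg = 1 \/ sg = -1 ->
    (forall x, xi x <= (K x)%:R -> ~` A x `<=` L sg (K x) x) ->
    shifted_div_prob x (A x) @[x --> +oo] --> (1 : R).
  move=> hsg AL; apply: cvg_prob1 => e e0; near=> x.
  apply: (@le_trans _ _ (shifted_div_prob x (L sg (K x) x))).
    by apply: shifted_div_prob_mono; apply: AL; near: x.
  have xx1 : x1 <= x by near: x; exact: nbhs_pinfty_ge (num_real _).
  apply: (@le_trans _ _ (K x).+1%:R^-1); last by near: x; exact: Ksmall.
  by have [h1 h2] := hK x xx1; case: hsg => ->.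
have scale_gt0 (k : nat) (t : R) : Num.max k%:R (tower 1) < t -> 0 < lilsc (ln (ln t)).
  by rewrite gt_max => /andP[_ /lilsc_gt0].
split.
- apply: cvg_prob1 => e e0.
  have [T0 [x0 hT]] := prob_Mabs_le eps_gt0 e0.
  near=> x; apply: hT.
    by near: x; exact: nbhs_pinfty_ge (num_real _).
  by near: x; move/cvgryPge : xioo; apply.
- apply: (lower 1); first by left.
  move=> x xiK n /= hn t /andP[t1 t2]; rewrite mul1r.
  have l0 := scale_gt0 _ _ t1.
  apply: (@lt_le_trans _ _ ((1 - eps) * lilsc (ln (ln t)))); last first.
    by rewrite ler_wpM2r ?(ltW l0)//; lra.
  rewrite -ltr_pdivrMr// ltNge; apply/negP => h; apply: hn.
  apply: (@le_trans _ _ (Lambda n t)%:E); first by rewrite lee_fin; exact: h.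
  apply: ereal_sup_ubound; exists t => //=; rewrite t2 andbT (le_lt_trans xiK)//.
  by move: t1; rewrite gt_max => /andP[].
- apply: (lower (-1)); first by right.
  move=> x xiK n /= hn t /andP[t1 t2]; rewrite mulN1r.
  have l0 := scale_gt0 _ _ t1.
  apply: (@lt_le_trans _ _ ((1 - eps) * lilsc (ln (ln t)))); last first.
    by rewrite ler_wpM2r ?(ltW l0)//; lra.
  rewrite -ltr_pdivrMr// ltNge; apply/negP => h; apply: hn.
  apply: (@le_trans _ _ (Lambda n t)%:E).
    apply: ereal_inf_lbound; exists t => //=.
    rewrite t2 andbT (le_lt_trans xiK)//.
    by move: t1; rewrite gt_max => /andP[].
  move: h; rewrite mulNr -/(Lambda n t) lee_fin lerNr opprB addrC; exact.
Unshelve. all: by end_near. Qed.
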